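(* Let $P$ be a stationary determinantal point process on $\mathbb R^d$ with Hermitian positive (definite) kernel $K$ normalized by $K(0,0)=1$, and assume that $\kappa(x)=|K(0,x)|$ is square integrable. Let $A\subset\mathbb R^d$ be a convex body and $\mathbf k\in\mathbb N^d$. Then $P$ is (linearly) $\mathbf k$-rigid on $A$ if and only if $(1-\widehat{\kappa^2})^{-1}$ has a pole of order $\mathbf k$ in $0$. When this is not the case, $P$ is $\mathbf k$-tolerant, in the sense that $P$ is not (linearly) $Q$-rigid on $A$ for any $\mathbf k$-polynomial $Q$.
   Context: A simple point process $P$ on $\mathbb R^d$ is determinantal with kernel $K:\mathbb R^d\times\mathbb R^d\to\mathbb C$ if for every $k\ge1$ its $k$-point correlation function is $\rho_k(x_1,\dots,x_k)=\det(K(x_i,x_j))_{1\le i,j\le k}\ge0$. By stationarity and the normalization $K(0,0)=1$ (unit intensity), $\rho_2(x,y)=1-\kappa(x-y)^2$. $\mathbb N=\{0,1,2,\dots\}$; for $\mathbf k\in\mathbb N^d$, $t^{\mathbf k}=\prod_{i}t_i^{k_i}$; $\mathbf k'\preceq\mathbf k$ means $k'_i\le k_i$ for all $i$. $\hat f(u)=\int e^{-i\langle u,x\rangle}f(x)\,dx$; $1/0=\infty$. A convex body is a compact convex set with non-empty interior. For $s:\mathbb R^d\to\mathbb R_+$, $s^{-1}$ has a pole of order $\mathbf k$ in $0$ if for every polynomial $Q(u)=\sum_{\mathbf m}a_{\mathbf m}u^{\mathbf m}$ such that $\int_{B(0,\varepsilon)}|Q|^2s^{-1}<\infty$ for some $\varepsilon>0$,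 one has $a_{\mathbf k}=0$. A $\mathbf k$-polynomial is a polynomial $Q(t)=\sum_{\mathbf m}a_{\mathbf m}t^{\mathbf m}$ such that for some $\mathbf k_0\succeq\mathbf k$, $a_{\mathbf k_0}\ne0$ and all $\mathbf m$ with $a_{\mathbf m}\neq0$ satisfy $\mathbf m\preceq\mathbf k_0$. Let $I_P(f)=\int f\,dP$. For a polynomial $Q$, $P$ is linearly $Q$-rigid on $A$ if $\inf_h\mathrm{Var}(I_P(Q1_A)-I_P(h))=0$, the infimum being over bounded measurable compactly supported $h$ vanishing on $A$; linear $\mathbf k$-rigidity is the case $Q(t)=t^{\mathbf k}$. *)

(* Defs.v *)
From HB Require Import structures.
From mathcomp Require Import all_boot all_order all_algebra.
From mathcomp Require Import all_classical all_reals all_analysis.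
From mathcomp Require Import measurable_realfun.
From mathcomp Require Import complex.
From mathcomp Require mpoly.

Set Implicit Arguments.
Unset Strict Implicit.
Unset Printing Implicit Defensive.

Import Order.TTheory GRing.Theory Num.Theory.
Import numFieldNormedType.Exports.

Local Open Scope classical_set_scope.
Local Open Scope complex_scope.
Local Open Scope ring_scope.

Definition rV_display : measure_display.
Proof. exact: default_measure_display. Qed.

Section row_vector_measurable.
Context {R : realType} (d : nat).

Let coords (i : 'I_d) (x : 'rV[R]_d) : measurableTypeR R := x ord0 i.

Let rV_set0 : g_sigma_preimage coords set0.
Proof. exact: sigma_algebra0. Qed.

Let rV_setC A : g_sigma_preimage coords A -> g_sigma_preimage coords (~` A).
Proof. exact: sigma_algebraC. Qed.

Let rV_bigcup (F : (set 'rV[R]_d)^nat) :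
  (forall i, g_sigma_preimage coords (F i)) ->
  g_sigma_preimage coords (\bigcup_i (F i)).
Proof. exact: sigma_algebra_bigcup. Qed.

(* The Borel sigma-algebra of R^d, generated by the coordinates; R^d itself
   carries the library's (product) topology on row vectors. *)
HB.instance Definition _ := @isMeasurable.Build
  rV_display 'rV[R]_d (g_sigma_preimage coords)
  rV_set0 rV_setC rV_bigcup.

End row_vector_measurable.

Lemma measurable_coord (R : realType) (d : nat) (i : 'I_d) :
  measurable_fun [set: 'rV[R]_d] (fun x => x ord0 i : measurableTypeR R).
Proof.
move=> _ Y mY; rewrite setTI; apply: sub_sigma_algebra => /=.
rewrite -bigcup_seq/=; exists i => /=; first by rewrite mem_index_enum.
by exists Y => //; rewrite setTI.
Qed.

Lemma pushforward_sigma_finite d1 d2 (T1 : measurableType d1)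
    (T2 : measurableType d2) (R : realType)
    (m : set T1 -> \bar R) (f : T1 -> T2) (g : T2 -> T1) :
  sigma_finite [set: T1] m -> measurable_fun [set: T2] g -> cancel f g ->
  sigma_finite [set: T2] (pushforward m f).
Proof.
move=> [F FT Foo] mg fK.
exists (fun n => g @^-1` F n).
  by rewrite -preimage_bigcup -FT preimage_setT.
move=> n; have [mF Fn] := Foo n; split.
  by rewrite -[X in measurable X]setTI; exact: mg.
rewrite /pushforward -comp_preimage.
by rewrite (_ : g \o f = id)//; apply/funext => x /=; rewrite fK.
Qed.

Lemma product_sigma_finite d1 d2 (T1 : measurableType d1)
    (T2 : measurableType d2) (R : realType)
    (m1 : {sigma_finite_measure set T1 -> \bar R})
    (m2 : {sigma_finite_measure set T2 -> \bar R}) :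
  sigma_finite [set: T1 * T2] (m1 \x m2)%E.
Proof.
have /sigma_finiteP[F [TF ndF Foo]] := sigma_finiteT m1.
have /sigma_finiteP[G [TG ndG Goo]] := sigma_finiteT m2.
exists (fun n => F n `*` G n).
  rewrite -setXTT TF TG predeqE => -[x y]; split.
    move=> [/= [n _ Fnx] [k _ Gky]]; exists (maxn n k) => //; split.
    - by move: x Fnx; exact/subsetPset/ndF/leq_maxl.
    - by move: y Gky; exact/subsetPset/ndG/leq_maxr.
  by move=> [n _ []/= ? ?]; split; exists n.
move=> k; have [? ?] := Foo k; have [? ?] := Goo k.
split; first exact: measurableX.
by rewrite product_measure1E// lte_mul_pinfty// ge0_fin_numE.
Qed.

(* The product measure mu x ... x mu (n factors) on n-tuples. *)
Section tuple_measure.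
Context {disp : measure_display} {T : measurableType disp} {R : realType}.
Variable mu : {sigma_finite_measure set T -> \bar R}.

Section step.
Variables (n : nat) (nu : {sigma_finite_measure set (n.-tuple T) -> \bar R}).

Definition tuple_cons (p : T * n.-tuple T) : n.+1.-tuple T :=
  [tuple of p.1 :: p.2].

Let measurable_tuple_cons : measurable_fun [set: T * n.-tuple T] tuple_cons.
Proof. exact: measurable_cons. Qed.

Definition tuple_measureS : set (n.+1.-tuple T) -> \bar R :=
  pushforward (mu \x nu)%E tuple_cons.

Let tuple_measureS0 : tuple_measureS set0 = 0%E.
Proof. by rewrite /tuple_measureS /pushforward preimage_set0 measure0. Qed.

Let tuple_measureS_ge0 A : (0 <= tuple_measureS A)%E.
Proof. exact: measure_ge0. Qed.

Let tuple_measureS_sigma_additive : semi_sigma_additive tuple_measureS.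
Proof. exact: measure_semi_sigma_additive. Qed.

HB.instance Definition _ := isMeasure.Build _ _ _ tuple_measureS
  tuple_measureS0 tuple_measureS_ge0 tuple_measureS_sigma_additive.

Let tuple_measureS_sigma_finite : sigma_finite setT tuple_measureS.
Proof.
pose g (t : n.+1.-tuple T) : T * n.-tuple T := (thead t, [tuple of behead t]).
apply: (@pushforward_sigma_finite _ _ _ _ _ _ tuple_cons g).
- exact: product_sigma_finite.
- apply: measurable_fun_pair; last exact: measurable_behead.
  exact: measurable_tnth.
- by move=> [x t]; rewrite /g /tuple_cons theadE; congr pair; exact/val_inj.
Qed.

HB.instance Definition _ := Measure_isSigmaFinite.Build _ _ _ tuple_measureS
  tuple_measureS_sigma_finite.

End step.

Fixpoint tuple_measure n : {sigma_finite_measure set (n.-tuple T) -> \bar R} :=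
  if n is m.+1 then tuple_measureS (tuple_measure m) else \d_ [tuple].

End tuple_measure.

Section lebesgue_rV.
Context (R : realType) (d : nat).

Definition rV_of_tuple (t : d.-tuple (measurableTypeR R)) : 'rV[R]_d :=
  \row_i tnth t i.

Let measurable_rV_of_tuple : measurable_fun setT rV_of_tuple.
Proof.
apply: (@measurability _ _ _ _ setT rV_of_tuple
  (\big[setU/set0]_(i < d) preimage_set_system setT
     (fun x : 'rV[R]_d => x ord0 i : measurableTypeR R) measurable)) => //.
move=> _ [A + <-]; rewrite -bigcup_seq => -[i _ [B mB <-]] /=.
rewrite !setTI (_ : _ @^-1` _ = (@tnth d _ ^~ i) @^-1` B).
  by rewrite -[X in measurable X]setTI; exact: measurable_tnth.
by apply/seteqP; split => t /=; rewrite /rV_of_tuple mxE.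
Qed.

Definition lebesgue_rV : set 'rV[R]_d -> \bar R :=
  pushforward (tuple_measure (@lebesgue_measure R) d) rV_of_tuple.

Let lebesgue_rV0 : lebesgue_rV set0 = 0%E.
Proof. by rewrite /lebesgue_rV /pushforward preimage_set0 measure0. Qed.

Let lebesgue_rV_ge0 A : (0 <= lebesgue_rV A)%E.
Proof. exact: measure_ge0. Qed.

Let lebesgue_rV_sigma_additive : semi_sigma_additive lebesgue_rV.
Proof. exact: measure_semi_sigma_additive. Qed.

HB.instance Definition _ := isMeasure.Build _ _ _ lebesgue_rV
  lebesgue_rV0 lebesgue_rV_ge0 lebesgue_rV_sigma_additive.

Let lebesgue_rV_sigma_finite : sigma_finite setT lebesgue_rV.
Proof.
pose g (x : 'rV[R]_d) : d.-tuple (measurableTypeR R) := [tuple x ord0 i | i < d].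
apply: (@pushforward_sigma_finite _ _ _ _ _ _ rV_of_tuple g).
- exact: sigma_finiteT.
- apply/measurable_fun_tnthP => i.
  rewrite (_ : _ \o _ = fun x : 'rV[R]_d => x ord0 i); last first.
    by apply/funext => x /=; rewrite tnth_mktuple.
  exact: measurable_coord.
- by move=> t; apply: eq_from_tnth => i; rewrite tnth_mktuple mxE.
Qed.

HB.instance Definition _ := Measure_isSigmaFinite.Build _ _ _ lebesgue_rV
  lebesgue_rV_sigma_finite.

End lebesgue_rV.

Section complex_valued.
Context {R : realType}.

Definition modulus (z : R[i]) : R := Normc.normc z.

Definition expi (t : R) : R[i] := cos t +i* sin t.

Definition Cintegral {disp} {T : measurableType disp}
    (mu : {measure set T -> \bar R}) (f : T -> R[i]) : R[i] :=
  (\int[mu]_x complex.Re (f x)) +i* (\int[mu]_x complex.Im (f x)).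

Definition Cmeasurable {disp} {T : measurableType disp} (f : T -> R[i]) : Prop :=
  measurable_fun setT (fun x => complex.Re (f x)) /\
  measurable_fun setT (fun x => complex.Im (f x)).

(* E |Z - E Z|^2 is the sum of the variances of the two real components. *)
Definition Cvariance {disp} {T : measurableType disp} (P : probability T R)
    (Z : T -> R[i]) : \bar R :=
  ('V_P[fun w => complex.Re (Z w)] + 'V_P[fun w => complex.Im (Z w)])%E.

End complex_valued.

Section euclidean_space.
Context {R : realType} {d : nat}.
Implicit Types (u x : 'rV[R]_d) (f : 'rV[R]_d -> R[i]).

Definition dot u x : R := \sum_(i < d) u ord0 i * x ord0 i.

(* The library's [ball] on row vectors is the one of the sup norm. *)
Definition eball (e : R) : set 'rV[R]_d := [set u | Num.sqrt (dot u u) < e].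

Definition fourier f u : R[i] :=
  Cintegral (@lebesgue_rV R d) (fun x => expi (- dot u x) * f x).

Definition convex_body (A : set 'rV[R]_d) : Prop :=
  [/\ compact A, convex_set (A : set (convex_lmodType 'rV[R]_d))
    & (interior A) !=set0].

Definition poly_eval (Q : mpoly.mpoly d R[i]) x : R[i] :=
  mpoly.meval (fun i => (x ord0 i)%:C) Q.

(* Inversion in [\bar R] satisfies [0^-1 = +oo]. *)
Definition inv_pole_of_order (s : 'rV[R]_d -> R) (k : mpoly.multinom d) : Prop :=
  forall Q : mpoly.mpoly d R[i],
    (exists2 e : R, 0 < e &
      (\int[@lebesgue_rV R d]_(u in eball e)
         ((modulus (poly_eval Q u) ^+ 2)%:E * ((s u)%:E)^-1) < +oo)%E) ->
    mpoly.mcoeff k Q = 0.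

(* [mpoly.lem] is the coordinatewise order on multi-indices (the library's
   order structure on them is a total, graded one). *)
Definition k_polynomial (k : mpoly.multinom d) (Q : mpoly.mpoly d R[i]) : Prop :=
  exists k0 : mpoly.multinom d,
    [/\ mpoly.lem k k0, mpoly.mcoeff k0 Q != 0
      & forall m, mpoly.mcoeff m Q != 0 -> mpoly.lem m k0].

End euclidean_space.

Section point_processes.
Context {R : realType} {d : nat}.
Notation E := 'rV[R]_d.

(* The sigma-algebra on configurations generated by the numbers of points in
   Borel sets. *)
Definition config_measurable : set (set (set E)) :=
  <<s [set F | exists (B : set E) (n : nat), measurable B /\
                 F = [set c : set E | (c `&` B #= `I_n)%card]] >>.

Context {disp : measure_display} {Om : measurableType disp}.
Variables (P : probability Om R) (Phi : Om -> set E).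

(* A simple point process, seen as a random locally finite set of points. *)
Definition simple_point_process : Prop :=
  (forall w (C : set E), compact C -> finite_set (Phi w `&` C)) /\
  (forall F, config_measurable F -> measurable (Phi @^-1` F)).

Definition stationary : Prop :=
  forall (v : E) F, config_measurable F ->
    P ((fun w => [set x + v | x in Phi w]) @^-1` F) = P (Phi @^-1` F).

Definition linear_statistic (f : E -> R[i]) (w : Om) : R[i] :=
  \sum_(x \in Phi w) f x.

Definition correlation_function (k : nat) (rho : k.-tuple E -> R) : Prop :=
  measurable_fun setT rho /\
  forall f : k.-tuple E -> \bar R,
    measurable_fun setT f -> (forall t, (0 <= f t)%E) ->
    (\int[P]_w (\esum_(t in [set t : k.-tuple E | uniq t /\
                               forall i, Phi w (tnth t i)]) f t) =
     \int[tuple_measure (@lebesgue_rV R d) k]_t (f t * (rho t)%:E))%E.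

Definition det_kernel (K : E -> E -> R[i]) k (t : k.-tuple E) : R[i] :=
  \det (\matrix_(i < k, j < k) K (tnth t i) (tnth t j)).

Definition determinantal (K : E -> E -> R[i]) : Prop :=
  forall k, (0 < k)%N ->
    (forall t : k.-tuple E, 0 <= det_kernel K t) /\
    correlation_function (fun t : k.-tuple E => complex.Re (det_kernel K t)).

Definition hermitian_kernel (K : E -> E -> R[i]) : Prop :=
  forall x y, K y x = (K x y)^*.

Definition positive_definite_kernel (K : E -> E -> R[i]) : Prop :=
  forall (n : nat) (x : 'I_n -> E) (c : 'I_n -> R[i]),
    0 <= \sum_(i < n) \sum_(j < n) c i * K (x i) (x j) * (c j)^*.

(* Stationarity of a process makes its correlation functions translation
   invariant only almost everywhere, and the values K(0, x) are not seen by the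
   law.  As usual, the version of the correlation functions given by the kernel
   is taken to be translation invariant; this is what makes rho_1 = K(0, 0) and
   rho_2(x, y) = K(0, 0)^2 - kappa(x - y)^2 hold. *)
Definition translation_invariant_correlations (K : E -> E -> R[i]) : Prop :=
  forall k (t : k.-tuple E) (v : E),
    det_kernel K (map_tuple (fun x => x + v) t) = det_kernel K t.

Definition kappa (K : E -> E -> R[i]) (x : E) : R := modulus (K 0 x).

(* The Fourier transform of kappa^2 is real because kappa is even. *)
Definition one_minus_fourier_kappa2 (K : E -> E -> R[i]) (u : E) : R :=
  1 - complex.Re (fourier (fun x => (kappa K x ^+ 2)%:C) u).

Definition exterior_test_function (A : set E) (h : E -> R[i]) : Prop :=
  [/\ Cmeasurable h,
      exists M : R, forall x, modulus (h x) <= M,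
      exists2 C : set E, compact C & forall x, ~ C x -> h x = 0
    & forall x, A x -> h x = 0].

Definition linearly_rigid (Q : mpoly.mpoly d R[i]) (A : set E) : Prop :=
  ereal_inf [set Cvariance P (fun w =>
               linear_statistic (patch (fun=> 0) A (poly_eval Q)) w -
               linear_statistic h w)
            | h in exterior_test_function A] = 0%E.

Definition linearly_k_rigid (k : mpoly.multinom d) (A : set E) : Prop :=
  linearly_rigid (mpoly.mpolyX R[i] k) A.

End point_processes.

(* Main.v *)
Require Import Defs.
From HB Require Import structures.
From mathcomp Require Import all_boot all_order all_algebra.
From mathcomp Require Import finmap.
From mathcomp Require Import all_classical all_reals all_analysis.
From mathcomp Require Import measurable_realfun.
From mathcomp Require Import complex.
From mathcomp Require mpoly.
From mathcomp Require Import ring lra.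
Import Order.TTheory GRing.Theory Num.Theory.
Import numFieldNormedType.Exports.
Local Open Scope classical_set_scope.
Local Open Scope complex_scope.
Local Open Scope ring_scope.

Set Implicit Arguments.
Unset Strict Implicit.
Unset Printing Implicit Defensive.

(** Write [k2] for [kappa ^ 2], [L] for its integral, [phi] for its Fourier
    transform and [s = 1 - phi].  For a bounded function [f] with bounded
    support, the one and two point correlation functions give

      Var I(f) = (1 - L) \int f(x)^2 dx
                 + 1/2 \int\int (f(x) - f(y))^2 k2(y - x) dx dy,

    the Dirichlet form of a random walk with jump law [k2], killed with
    probability [1 - L] at each step ([variance_rstat]).  That [L <= 1] follows
    from the nonnegativity of the variances of the counts in large cubes
    ([k2_mass_le1]).  The argument is potential theory for this walk, and never
    inverts a Fourier transform.

    Let [chi] be a product of tents supported in a small cube of frequencies,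
    and let [kern j x] be the integral of [chi(xi) phi(xi)^j cos<xi, x>].  The
    function [kern 0] is a product of Fejer kernels, hence nonnegative and
    integrable, and convolution with [k2] maps [kern j] to [kern (j + 1)]
    ([kern_conv]).  So all [kern j] are nonnegative, and their partial sums
    [G = green n] are positive functions with [G - k2 * G = kern 0 - kern n]
    ([green_conv]).  They are largest at the origin, where their value is the
    integral of [chi (1 + phi + ... + phi^(n-1))], a bounded function of [n] if
    [1/s] is integrable near 0 ([gsum_le]), and an unbounded one otherwise
    ([green_unbounded]).

    - If [1/s] is integrable near 0, the functions [G + 1] are positive, bounded
      independently of [n], and superharmonic up to the small error [kern n].
      Substituting [f = (G + 1) g] in the Dirichlet form bounds the variance
      below by a multiple of the integral of [f^2] over any given cube
      ([ground_state], [variance_lower_bound]).  As a nonzero polynomial does not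
      vanish almost everywhere ([poly_eval_neq0], [null_zero_set]), no
      polynomial [Q <> 0] is rigid ([not_rigid_integrable]).

    - If [1/s] is not integrable near 0, [G / G(0)] is almost 1 on [A], and its
      defect of harmonicity has small mass, at most that of [kern 0 / G(0)].
      Replacing it by 1 on [A] and by 0 far away costs little, and yields a
      function equal to 1 on [A] whose statistic has a small variance
      ([variance_small]).  So the constant polynomial is rigid.

    - If [L > 0], a nonconstant [Q] is never rigid.  The squared [L^2] norm [D(z)]
      of the increment of [f] along [z] satisfies [D(z' - z) <= 2 D(z) + 2 D(z')]
      and has [k2]-average at most [2 Var I(f)]; so the variance controls some
      short increments of [f], which those of [Q] inside [A] bound below
      ([variance_lower_nonconstant]).

    - If [L > 0], moreover [s(u) >= c |u|^2] near 0 ([gap_quadratic]), so that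
      [|u^k|^2 / s(u)] is locally bounded as soon as [k <> 0].  If [L = 0], then
      [s = 1] and the first item applies to every [Q <> 0].

    Hence for [k <> 0] there is never a pole of order [k], and no
    [k]-polynomial, being nonconstant, is rigid.  For [k = 0], a pole means that
    [1/s] is not integrable near 0, by continuity of [Q] at 0 ([pole0P]), and
    the first two items apply. *)

(** * Integrals over tuples and row vectors *)

Section tuple_measure_integral.
Context {disp : measure_display} {T : measurableType disp} {R : realType}.
Variable mu : {sigma_finite_measure set T -> \bar R}.
Local Open Scope ereal_scope.

Lemma measurable_tuple_cons n :
  measurable_fun setT (fun p : T * n.-tuple T => [tuple of p.1 :: p.2]).
Proof. exact: measurable_cons. Qed.

Lemma integral_tuple0 (F : 0.-tuple T -> \bar R) :
  \int[tuple_measure mu 0]_t F t = F [tuple].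
Proof.
rewrite (_ : F = cst (F [tuple])); last by apply/funext => t; rewrite (tuple0 t).
by rewrite /= integral_dirac// diracT mul1e.
Qed.

Lemma ge0_integral_tupleS n (F : n.+1.-tuple T -> \bar R) :
  measurable_fun setT F -> (forall t, 0 <= F t) ->
  \int[tuple_measure mu n.+1]_t F t =
  \int[mu]_x \int[tuple_measure mu n]_t F [tuple of x :: t].
Proof.
move=> mF F0; rewrite /= /tuple_measureS.
rewrite (@ge0_integral_pushforward _ _ _ _ _ _ (@measurable_tuple_cons n))//.
rewrite preimage_setT fubini_tonelli1//; last by move=> p; exact: F0.
exact: (measurableT_comp mF (@measurable_tuple_cons n)).
Qed.

Lemma measurable_prod_tnth n (g : T -> R) : measurable_fun setT g ->
  measurable_fun setT (fun t : n.-tuple T => (\prod_(i < n) g (tnth t i))%R).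
Proof.
move=> mg; apply: measurable_prod => i _.
by apply: measurableT_comp => //; exact: measurable_tnth.
Qed.

Lemma integral_prod_tnth n (g : T -> R) :
  measurable_fun setT g -> (forall x, 0 <= g x)%R ->
  \int[tuple_measure mu n]_t (\prod_(i < n) g (tnth t i))%:E =
  (\int[mu]_x (g x)%:E) ^+ n.
Proof.
move=> mg g0; have mgn k := @measurable_prod_tnth k g mg.
have gn0 k (t : k.-tuple T) : (0 <= \prod_(i < k) g (tnth t i))%R.
  exact: prodr_ge0.
elim: n => [|n IH].
  by rewrite integral_tuple0 big_ord0.
rewrite ge0_integral_tupleS//; last 2 first.
- by apply/measurable_EFinP; exact: (mgn n.+1).
- by move=> t; rewrite lee_fin; exact: (gn0 n.+1).
rewrite expeS -IH -ge0_integralZr//; last 3 first.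
- exact/measurable_EFinP.
- by move=> x _; rewrite lee_fin.
- by apply: integral_ge0 => t _; rewrite lee_fin.
apply: eq_integral => x _.
rewrite -ge0_integralZl//; last 3 first.
- by apply/measurable_EFinP; exact: mgn.
- by move=> t _; rewrite lee_fin.
- by rewrite lee_fin.
apply: eq_integral => t _; rewrite big_ord_recl -EFinM; congr (_ * _)%:E.
by apply: eq_bigr => i _; rewrite tnthS.
Qed.

Lemma measurable_tuple_map n (tau : 'I_n -> T -> T) :
  (forall i, measurable_fun setT (tau i)) ->
  measurable_fun setT
    (fun t : n.-tuple T => [tuple tau i (tnth t i) | i < n]).
Proof.
move=> mtau; apply/measurable_fun_tnthP => i.
rewrite (_ : _ \o _ = tau i \o (@tnth n T ^~ i)).
  exact: (measurableT_comp (mtau i) (measurable_tnth i)).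
by apply/funext => t /=; rewrite tnth_mktuple.
Qed.

(** Translations and reflections of row vectors act coordinatewise, which reduces
    the invariance of their Lebesgue measure to dimension 1. *)
Lemma integral_tuple_map n (tau : 'I_n -> T -> T) (F : n.-tuple T -> \bar R) :
  (forall i, measurable_fun setT (tau i)) ->
  (forall i (f : T -> \bar R), measurable_fun setT f -> (forall x, 0 <= f x) ->
     \int[mu]_x f (tau i x) = \int[mu]_x f x) ->
  measurable_fun setT F -> (forall t, 0 <= F t) ->
  \int[tuple_measure mu n]_t F [tuple tau i (tnth t i) | i < n] =
  \int[tuple_measure mu n]_t F t.
Proof.
elim: n tau F => [|n IH] tau F mtau tauP mF F0.
  by rewrite !integral_tuple0; congr F; exact: tuple0.
rewrite !ge0_integral_tupleS//; last first.
  exact: (measurableT_comp mF (measurable_tuple_map mtau)).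
have mcons : measurable_fun setT
    (fun p : T * n.-tuple T => F [tuple of p.1 :: p.2]).
  exact: (measurableT_comp mF (@measurable_tuple_cons n)).
pose G x := \int[tuple_measure mu n]_t F [tuple of x :: t].
rewrite -[RHS]/(\int[mu]_x G x) -(tauP ord0 G).
- apply: eq_integral => x _; rewrite /G.
  rewrite -(IH _ _ (fun i => mtau (lift ord0 i)) (fun i => tauP (lift ord0 i))
    (measurableT_comp mcons (pair1_measurable (tau ord0 x))) (fun t => F0 _)).
  apply: eq_integral => t _; congr F; apply: eq_from_tnth => i.
  rewrite tnth_mktuple; case: (unliftP ord0 i) => [j|] ->.
    by rewrite !tnthS tnth_mktuple.
  by rewrite !tnth0.
- by apply: (measurable_fun_fubini_tonelli_F
    (fun p : T * n.-tuple T => F [tuple of p.1 :: p.2])) => // -[x t]; exact: F0.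
- by move=> x; exact: integral_ge0.
Qed.

End tuple_measure_integral.

Section lebesgue_rV_integral.
Context {R : realType}.
Local Open Scope ereal_scope.

Lemma measurable_fun_rV {disp} {T : measurableType disp} {d : nat}
    (f : T -> 'rV[R]_d) :
  (forall i, measurable_fun setT (fun x => f x ord0 i : measurableTypeR R)) ->
  measurable_fun setT f.
Proof.
move=> mf; apply: (@measurability _ _ _ _ setT f
  (\big[setU/set0]_(i < d) preimage_set_system setT
     (fun x : 'rV[R]_d => x ord0 i : measurableTypeR R) measurable)) => //.
move=> _ [A + <-]; rewrite -bigcup_seq => -[i _ [B mB <-]] /=.
by rewrite !setTI; have := mf i measurableT B mB; rewrite setTI.
Qed.

Lemma measurable_rV_of_tuple d : measurable_fun setT (@rV_of_tuple R d).
Proof.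
apply: measurable_fun_rV => i.
rewrite (_ : (fun _ => _) = @tnth d R ^~ i); first exact: measurable_tnth.
by apply/funext => t; rewrite mxE.
Qed.

Lemma ge0_integral_lebesgue_rV d (F : 'rV[R]_d -> \bar R) :
  measurable_fun setT F -> (forall x, 0 <= F x) ->
  \int[@lebesgue_rV R d]_x F x =
  \int[tuple_measure (@lebesgue_measure R) d]_t F (rV_of_tuple t).
Proof.
move=> mF F0; rewrite /lebesgue_rV.
by rewrite (@ge0_integral_pushforward _ _ _ _ _ _ (@measurable_rV_of_tuple d)).
Qed.

Lemma integral_lebesgue_rV_prod d (g : R -> R) :
  measurable_fun setT g -> (forall x, 0 <= g x)%R ->
  \int[@lebesgue_rV R d]_x (\prod_(i < d) g (x ord0 i))%:E =
  (\int[lebesgue_measure]_x (g x)%:E) ^+ d.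
Proof.
move=> mg g0; rewrite ge0_integral_lebesgue_rV.
- rewrite -integral_prod_tnth//; apply: eq_integral => t _.
  by congr (_%:E); apply: eq_bigr => i _; rewrite mxE.
- apply/measurable_EFinP; apply: measurable_prod => i _.
  by apply: measurableT_comp => //; exact: measurable_coord.
- by move=> x; rewrite lee_fin prodr_ge0.
Qed.

Lemma integral_lebesgue_transl (a : R) (f : R -> \bar R) :
  measurable_fun setT f -> (forall x, 0 <= f x) ->
  \int[lebesgue_measure]_x f (x + a)%R = \int[lebesgue_measure]_x f x.
Proof.
move=> mf f0.
have ma : measurable_fun [set: measurableTypeR R]
    (fun x : R => (x + a)%R : measurableTypeR R) by exact: measurable_funD.
transitivity (\int[pushforward lebesgue_measure
    (fun x : R => (x + a)%R : measurableTypeR R)]_x f x).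
  by rewrite (@ge0_integral_pushforward _ _ _ _ _ _ ma).
apply: eq_measure_integral => A mA _; apply/esym/lebesgue_measure_unique => //.
move=> _ [[x y]] _ <-.
transitivity (@lebesgue_measure R `](x - a)%R, (y - a)%R]%classic).
  by rewrite !lebesgue_measure_itv/= !lte_fin ltrD2r -!EFinD opprD opprK
    addrACA (addrC (- a)%R) subrr addr0.
rewrite (_ : `](x - a)%R, (y - a)%R]%classic = +%R^~ a @^-1` `]x, y])//.
by apply/seteqP; split => z /=; rewrite !in_itv/= ltrBlDr lerBrDr.
Qed.

Lemma integral_lebesgueN (f : R -> \bar R) :
  measurable_fun setT f -> (forall x, 0 <= f x) ->
  \int[lebesgue_measure]_x f (- x)%R = \int[lebesgue_measure]_x f x.
Proof.
move=> mf f0.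
have ma : measurable_fun [set: measurableTypeR R]
  (-%R : R -> measurableTypeR R) by exact: measurable_funN.
transitivity (\int[pushforward lebesgue_measure
    (-%R : R -> measurableTypeR R)]_x f x).
  by rewrite (@ge0_integral_pushforward _ _ _ _ _ _ ma).
by apply: eq_measure_integral => A mA _; exact: lebesgue_measureN.
Qed.

Lemma measurable_funrVD {disp} {T : measurableType disp} {d}
    (f g : T -> 'rV[R]_d) :
  measurable_fun setT f -> measurable_fun setT g ->
  measurable_fun setT (fun x => f x + g x)%R.
Proof.
move=> mf mg; apply: measurable_fun_rV => i.
rewrite (_ : (fun _ => _) = (fun x => f x ord0 i + g x ord0 i)%R).
  exact: (measurable_funD (measurableT_comp (measurable_coord i) mf)
    (measurableT_comp (measurable_coord i) mg)).
by apply/funext => x; rewrite mxE.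
Qed.

Lemma measurable_funrVN {disp} {T : measurableType disp} {d}
    (f : T -> 'rV[R]_d) :
  measurable_fun setT f -> measurable_fun setT (fun x => - f x)%R.
Proof.
move=> mf; apply: measurable_fun_rV => i.
rewrite (_ : (fun _ => _) = (fun x => - f x ord0 i)%R).
  exact: (measurable_funN (measurableT_comp (measurable_coord i) mf)).
by apply/funext => x; rewrite mxE.
Qed.

Lemma measurable_funrVB {disp} {T : measurableType disp} {d}
    (f g : T -> 'rV[R]_d) :
  measurable_fun setT f -> measurable_fun setT g ->
  measurable_fun setT (fun x => f x - g x)%R.
Proof.
by move=> mf mg; apply: measurable_funrVD => //; exact: measurable_funrVN.
Qed.

Lemma measurable_fun_dot {disp} {T : measurableType disp} {d}
    (f g : T -> 'rV[R]_d) :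
  measurable_fun setT f -> measurable_fun setT g ->
  measurable_fun setT (fun x => dot (f x) (g x)).
Proof.
move=> mf mg; apply: measurable_sum => i.
exact: (measurable_funM (measurableT_comp (measurable_coord i) mf)
  (measurableT_comp (measurable_coord i) mg)).
Qed.

Lemma integral_rV_transl d (a : 'rV[R]_d) (F : 'rV[R]_d -> \bar R) :
  measurable_fun setT F -> (forall x, 0 <= F x) ->
  \int[@lebesgue_rV R d]_x F (x + a)%R = \int[@lebesgue_rV R d]_x F x.
Proof.
move=> mF F0; rewrite !ge0_integral_lebesgue_rV//; last first.
  exact: (measurableT_comp mF (measurable_funrVD (@measurable_id _ _ setT) (@measurable_cst _ _ _ _ _ _))).
pose tau (i : 'I_d) : measurableTypeR R -> measurableTypeR R :=
  fun x : R => (x + a ord0 i)%R.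
rewrite -[RHS](@integral_tuple_map _ _ _ _ _ tau)//.
- by apply: eq_integral => t _; congr F; apply/rowP => i; rewrite !mxE tnth_mktuple.
- by move=> i; exact: measurable_funD.
- by move=> i f mf f0; rewrite integral_lebesgue_transl.
- exact: (measurableT_comp mF (@measurable_rV_of_tuple d)).
Qed.

Lemma integral_rVN d (F : 'rV[R]_d -> \bar R) :
  measurable_fun setT F -> (forall x, 0 <= F x) ->
  \int[@lebesgue_rV R d]_x F (- x)%R = \int[@lebesgue_rV R d]_x F x.
Proof.
move=> mF F0; rewrite !ge0_integral_lebesgue_rV//; last first.
  by apply: measurableT_comp => //; apply: measurable_funrVN.
pose tau (i : 'I_d) : measurableTypeR R -> measurableTypeR R :=
  fun x : R => (- x)%R.
rewrite -[RHS](@integral_tuple_map _ _ _ _ _ tau)//.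
- by apply: eq_integral => t _; congr F; apply/rowP => i; rewrite !mxE tnth_mktuple.
- by move=> i; exact: measurable_funN.
- by move=> i f mf f0; exact: (integral_lebesgueN mf f0).
- exact: (measurableT_comp mF (@measurable_rV_of_tuple d)).
Qed.

Lemma integral_rV_refl d (a : 'rV[R]_d) (F : 'rV[R]_d -> \bar R) :
  measurable_fun setT F -> (forall x, 0 <= F x) ->
  \int[@lebesgue_rV R d]_x F (a - x)%R = \int[@lebesgue_rV R d]_x F x.
Proof.
move=> mF F0.
have mF' : measurable_fun setT (fun x : 'rV[R]_d => F (x + a)%R).
  exact: (measurableT_comp mF (measurable_funrVD (@measurable_id _ _ setT) (@measurable_cst _ _ _ _ _ _))).
rewrite -(integral_rV_transl a mF F0) -(integral_rVN mF')//.
by apply: eq_integral => x _; rewrite addrC.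
Qed.

End lebesgue_rV_integral.

(** * Cubes, compact sets and Borel sets of row vectors *)

Section boxes.
Context {R : realType} {d : nat}.
Notation E := 'rV[R]_d.
Local Notation leb := (@lebesgue_rV R d).

Definition box (N : R) : set E := [set x | forall i, `|x ord0 i| <= N].

Lemma box_compact N : compact (box N).
Proof.
rewrite (_ : box N = [set v : E | forall i, v ord0 i \in `[- N, N]]).
  apply: (@rV_compact _ _ (fun=> `[- N, N]%classic)) => _.
  exact: segment_compact.
by apply/seteqP; split => x /= xN i; move: (xN i); rewrite in_itv/= ler_norml.
Qed.

Lemma box_subset N M : N <= M -> box N `<=` box M.
Proof. by move=> NM x xN i; exact: le_trans (xN i) NM. Qed.

Lemma norm_coord_le (x : E) i : `|x ord0 i| <= `|x|.
Proof.
by rewrite [leRHS]/Num.norm /= mx_normrE; apply/bigmax_geP; right => /=;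
  exists (ord0, i).
Qed.

Lemma compact_sub_box (C : set E) : compact C ->
  exists2 N, 0 < N & C `<=` box N.
Proof.
move=> /compact_bounded[M [_ MC]].
exists (`|M| + 1) => [|x Cx i]; first by rewrite ltr_wpDl.
apply: le_trans (norm_coord_le x i) _; apply: MC => //.
by rewrite (le_lt_trans (ler_norm M))// ltrDl.
Qed.

Lemma measurable_forall_coord (B : 'I_d -> set R) :
  (forall i, measurable (B i : set (measurableTypeR R))) ->
  measurable [set x : E | forall i, B i (x ord0 i)].
Proof.
move=> mB.
rewrite (_ : [set _ | _] =
  \bigcap_(i in setT) ((fun x : E => x ord0 i : measurableTypeR R) @^-1` B i)).
  apply: fin_bigcap_measurable => // i _.
  rewrite -[X in measurable X]setTI; exact: (measurable_coord i).
by apply/seteqP; split => x /= xB i; [move=> _|]; exact: xB.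
Qed.

Lemma measurable_box N : measurable (box N).
Proof.
rewrite (_ : box N = [set x | forall i, `[- N, N]%classic (x ord0 i)]).
  by apply: (measurable_forall_coord (B := fun=> `[- N, N]%classic)) => i;
    exact: measurable_itv.
by apply/seteqP; split => x /= xN i; move: (xN i); rewrite in_itv/= ler_norml.
Qed.

Lemma measurable_rV_ball (x : E) (e : R) : 0 < e -> measurable (ball x e).
Proof.
move=> e0.
rewrite (_ : ball x e = [set y | forall i, ball (x ord0 i) e (y ord0 i)]).
  by apply: (measurable_forall_coord (B := fun i => ball (x ord0 i) e)) => i;
    exact: measurable_ball.
apply/seteqP; split => y /=; first by case=> _ xy i; exact: xy.
by move=> xy; split => // i j; rewrite (ord1 i); exact: xy.
Qed.

(** The sigma-algebra of the coordinates contains the open sets, as an open set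
    is the union of the countably many cubes with rational centers and radii
    [1 / (n + 1)] that it contains. *)
Lemma measurable_open_rV (U : set E) : open U -> measurable U.
Proof.
move=> oU.
pose c (q : 'rV[rat]_d) : E := \row_i ratr (q ord0 i).
pose F (p : 'rV[rat]_d * nat) : set E :=
  if pselect (ball (c p.1) p.2.+1%:R^-1 `<=` U) then
    ball (c p.1) p.2.+1%:R^-1 else set0.
rewrite (_ : U = \bigcup_p F p).
  apply: countable_bigcupT_measurable => [|p]; first exact: countableP.
  rewrite /F; case: pselect => [?|?] //=.
  by apply: measurable_rV_ball; rewrite invr_gt0.
apply/seteqP; split => [x Ux|x [p _]]; last first.
  by rewrite /F; case: pselect => [pU|?] //= px; exact: pU.
have /nbhs_ballP[e /= e0 xeU] : nbhs x U by exact: open_nbhs_nbhs.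
have [n ne] : exists n : nat, n.+1%:R^-1 < e / 2.
  have [n _ /(_ n (leqnn n))/=] :=
    near_infty_natSinv_lt (PosNum (divr_gt0 e0 (ltr0Sn R 1))).
  by move=> ?; exists n.
have /choice[q qP] : forall i : 'I_d, exists q : rat,
    ball (x ord0 i) n.+1%:R^-1 (ratr q : R).
  move=> i; have n0 : 0 < n.+1%:R^-1 :> R by rewrite invr_gt0.
  have [q] : exists q : rat, ratr q \in `]x ord0 i - n.+1%:R^-1, x ord0 i + n.+1%:R^-1[.
    by apply: rat_in_itvoo; rewrite ltrD2l (lt_trans _ n0)// oppr_lt0.
  by rewrite in_itv/= => qx; exists q; rewrite /ball/= distrC ltr_distl.
pose p := (\row_i q i : 'rV[rat]_d, n).
have px : ball (c p.1) n.+1%:R^-1 x.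
  split => [|i j]; first by rewrite invr_gt0.
  by rewrite (ord1 i) /c !mxE; apply: ball_sym; exact: qP.
exists p => //; rewrite /F; case: pselect => [?|] //=.
case => z pz; apply: xeU.
rewrite [e]splitr; apply: (@ball_triangle _ _ (c p.1)).
  by apply: ball_sym; apply: le_ball px; exact: ltW.
by apply: le_ball pz; exact: ltW.
Qed.

Lemma measurable_compact_rV (C : set E) : compact C -> measurable C.
Proof.
move=> /compact_closed cC; rewrite -(setCK C); apply: measurableC.
by apply: measurable_open_rV; apply: closed_openC; apply: cC; exact: norm_hausdorff.
Qed.

Lemma lebesgue_box (N : R) : 0 <= N -> leb (box N) = ((2 * N) ^+ d)%:E.
Proof.
move=> N0; transitivity (\int[leb]_x (\1_(box N) x)%:E)%E.
  by rewrite integral_indic ?setIT//; exact: measurable_box.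
rewrite EFin_expe.
have -> : ((2 * N)%:E = \int[lebesgue_measure]_x (\1_(`[- N, N]%classic) x)%:E)%E.
  rewrite integral_indic// setIT /=.
  rewrite lebesgue_measure_itv/= lte_fin; case: ltP => [_|].
    by rewrite -EFinD opprK mulrDl mul1r.
  by move=> NN; rewrite (_ : N = 0) ?mulr0//; lra.
rewrite -integral_lebesgue_rV_prod//.
  apply: eq_integral => x _; congr EFin.
  rewrite !indicE; have [xN|xN] := boolP (x \in box N).
    rewrite big1// => i _; rewrite indicE mem_set//=.
    by rewrite in_itv/= -ler_norml; move: xN; rewrite inE; exact.
  move: xN; rewrite notin_setE => /existsNP[i xi].
  rewrite (bigD1 i)//= indicE memNset ?mul0r//=.
  by rewrite in_itv/= -ler_norml.
Qed.

Lemma lebesgue_box_lty N : (leb (box N) < +oo)%E.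
Proof.
apply: (@le_lt_trans _ _ (leb (box `|N|))).
  by apply: le_measure; rewrite ?inE; [exact: measurable_box..|
    exact/box_subset/ler_norm].
by rewrite lebesgue_box// ltry.
Qed.

Lemma lebesgue_compact_lty (C : set E) : compact C -> (leb C < +oo)%E.
Proof.
move=> cC; have [N _ CN] := compact_sub_box cC.
apply: le_lt_trans (lebesgue_box_lty N).
by apply: le_measure; rewrite ?inE//; [exact: measurable_compact_rV|
  exact: measurable_box].
Qed.

Lemma interior_sub_cube (A : set E) : (interior A) !=set0 ->
  exists a : E, exists2 r : R, 0 < r & [set x | box r (x - a)] `<=` A.
Proof.
move=> [a] /nbhs_ballP[e /= e0 aeA]; exists a, (e / 2); first exact: divr_gt0.
move=> x xa; apply: aeA; split => // i j; rewrite (ord1 i) /ball/= distrC.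
by have := xa j; rewrite !mxE => /le_lt_trans; apply; lra.
Qed.

Lemma measurable_cube (a : E) (r : R) : measurable [set x | box r (x - a)].
Proof.
rewrite -[X in measurable X]setTI.
by apply: (measurable_funrVB (@measurable_id _ _ setT)
  (@measurable_cst _ _ _ _ _ a)) => //; exact: measurable_box.
Qed.

Lemma lebesgue_cube_gt0 (a : E) (r : R) : 0 < r ->
  (0 < leb [set x | box r (x - a)%R])%E.
Proof.
move=> r0; have mb := measurable_cube a r.
rewrite -[X in leb X]setIT -integral_indic//.
rewrite (_ : (fun x => _) = (fun x : E => (\1_(box r) (x - a))%:E)).
  rewrite (integral_rV_transl (- a) (F := fun x => (\1_(box r) x)%:E)).
  - rewrite integral_indic ?setIT//=; last exact: measurable_box.
    by rewrite lebesgue_box ?ltW// lte_fin exprn_gt0// mulr_gt0.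
  - by apply/measurable_EFinP; apply: measurable_indic; exact: measurable_box.
  - by move=> x; rewrite lee_fin.
by apply/funext => x; rewrite !indicE.
Qed.

Lemma cvg_integral_box (F : E -> R) : measurable_fun setT F ->
  (forall x, 0 <= F x) ->
  (\int[leb]_(x in box n%:R) (F x)%:E)%E @[n --> \oo] --> (\int[leb]_x (F x)%:E)%E.
Proof.
move=> mF F0; have bcup : \bigcup_n (box n%:R : set E) = setT.
  apply/seteqP; split => // x _.
  exists (Num.truncn `|x|).+1 => //= i.
  by apply: le_trans (norm_coord_le x i) _; apply/ltW; exact: truncnS_gt.
rewrite -bcup; apply: ge0_nondecreasing_set_cvg_integral.
- apply/nondecreasing_seqP => n; rewrite subsetEset; apply: box_subset.
  by rewrite ler_nat.
- by move=> i; exact: measurable_box.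
- by move=> i; apply: measurable_funTS; exact/measurable_EFinP.
- by move=> i x _; rewrite lee_fin.
Qed.

End boxes.

(** * Linear statistics of a point process *)

Section linear_statistics.
Context {R : realType} {d : nat}.
Notation E := 'rV[R]_d.
Context {disp : measure_display} {Om : measurableType disp}.
Variables (P : probability Om R) (Phi : Om -> set E).
Hypothesis Phi_spp : simple_point_process Phi.

Definition test_function (f : E -> R) :=
  [/\ measurable_fun setT f, exists M, forall x, `|f x| <= M
    & exists N, forall x, ~ box N x -> f x = 0].

Definition rstat (f : E -> R) (w : Om) : R := \sum_(x \in Phi w) f x.

(** Inside a cube there are finitely many points, so that all the sums over a
    configuration become finite ones. *)
Definition points (N : R) (w : Om) := fset_set (Phi w `&` box N).

Lemma finite_points N w : finite_set (Phi w `&` box N).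
Proof. by apply: Phi_spp.1; exact: box_compact. Qed.

Lemma fsum_points (V : nmodType) (N : R) (f : E -> V) w :
  (forall x, ~ box N x -> f x = 0) ->
  \sum_(x \in Phi w) f x = \sum_(x <- points N w) f x.
Proof.
move=> f0; rewrite -fsbig_finite//; last exact: finite_points.
apply/esym/fsbig_widen => [|x [Px nPN] /=]; first exact: subIsetl.
by apply: f0 => Nx; apply: nPN.
Qed.

Lemma esum_points (N : R) (f : E -> \bar R) w :
  (forall x, 0 <= f x)%E -> (forall x, ~ box N x -> f x = 0%E) ->
  (\esum_(x in Phi w) f x = \sum_(x <- points N w) f x)%E.
Proof.
move=> f_ge0 f0; rewrite -fsbig_finite/=; last exact: finite_points.
rewrite -esum_fset//; last exact: finite_points.
rewrite esum_mkcondr; apply: eq_esum => x _.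
by case: ifPn => //; rewrite notin_setE => /f0.
Qed.

Lemma esum_rstat (f : E -> R) w : test_function f -> (forall x, 0 <= f x) ->
  (\esum_(x in Phi w) (f x)%:E = (rstat f w)%:E)%E.
Proof.
move=> [_ _ [N fN]] f0; rewrite (@esum_points N)//.
- by rewrite /rstat (@fsum_points _ N)// sumEFin.
- by move=> x /fN ->.
Qed.

Lemma measurable_count N (B : set E) : measurable B -> B `<=` box N ->
  measurable_fun setT (rstat \1_B).
Proof.
move=> mB BN.
have BE w : rstat \1_B w = #|` fset_set (Phi w `&` B)|%:R.
  have fB : finite_set (Phi w `&` B).
    by apply: sub_finite_set (finite_points N w); exact: setIS.
  rewrite -sum1_size natr_sum -fsbig_finite//= /rstat.
  rewrite [RHS]fsbig_mkcondr; apply: eq_fsbigr => x _.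
  by rewrite /patch indicE; case: ifP.
move=> _ Y mY; rewrite setTI.
rewrite (_ : _ @^-1` Y = \bigcup_(n in [set n : nat | Y n%:R])
    Phi @^-1` [set c | (c `&` B #= `I_n)%card]); last first.
  apply/seteqP; split => w /=; rewrite BE.
    move=> Yw; exists #|` fset_set (Phi w `&` B)| => //=.
    have fB : finite_set (Phi w `&` B).
      by apply: sub_finite_set (finite_points N w); exact: setIS.
    by rewrite -[X in (X #= _)%card](fset_setK fB); exact/card_eq_fsetP.
  by case=> n Yn /card_fset_set ->.
apply: bigcup_measurable => n _; apply: Phi_spp.2.
by apply: sub_sigma_algebra; exists B, n.
Qed.

Import HBNNSimple.

(** Approximation by simple functions reduces the claim to the numbers of points
    in Borel sets, which generate the sigma-algebra of configurations. *)
Lemma measurable_rstat_ge0 (f : E -> R) : test_function f ->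
  (forall x, 0 <= f x) -> measurable_fun setT (rstat f).
Proof.
move=> [mf _ [N fN]] f0.
have mef : measurable_fun setT (EFin \o f) by exact/measurable_EFinP.
pose g := nnsfun_approx measurableT mef.
pose S n w := \sum_(x <- points N w) g n x.
apply: (@measurable_fun_cvg _ _ _ _ S).
  move=> n.
  have -> : S n = fun w => \sum_(v <- fset_set (range (g n)))
      (v * rstat \1_(g n @^-1` [set v] `&` box N) w).
    apply/funext => w; rewrite /S.
    under eq_bigr => x _ do rewrite fimfunE fsbig_finite//=.
    rewrite exchange_big/=; apply: eq_bigr => v _.
    rewrite -mulr_sumr; congr (_ * _).
    rewrite /rstat (@fsum_points _ N); last first.
      by move=> x Nx; rewrite indicE memNset// => -[].
    rewrite big_seq [RHS]big_seq; apply: eq_bigr => x.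
    rewrite in_fset_set; last exact: finite_points.
    rewrite inE => -[_ Nx]; rewrite !indicE in_setI.
    by rewrite [X in _ && X]mem_set ?andbT.
  apply: measurable_sum => v; apply: measurable_funM => //.
  apply: (@measurable_count N) => //.
  by apply: measurableI => //; exact: measurable_box.
move=> w _; rewrite /rstat (@fsum_points _ N)//.
rewrite /S; elim: (points N w : seq E) => [|x s IH].
  by under eq_fun do rewrite big_nil; rewrite big_nil; exact: cvg_cst.
under eq_fun do rewrite big_cons.
rewrite big_cons; apply: cvgD => //.
by have /fine_cvgP[_] := @cvg_nnsfun_approx _ _ _ setT measurableT _ mef
  (fun x _ => f0 x) x I.
Qed.

Lemma test_functionD f g : test_function f -> test_function g ->
  test_function (f \+ g).
Proof.
move=> [mf [M fM] [N fN]] [mg [M' gM] [N' gN]]; split.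
- exact: measurable_funD.
- exists (M + M') => x; apply: le_trans (ler_normD _ _) _.
  by rewrite lerD.
- exists (Num.max N N') => x xN; rewrite /= fN ?gN ?addr0// => Nx; apply: xN.
    by apply: box_subset Nx; rewrite le_max lexx orbT.
  by apply: box_subset Nx; rewrite le_max lexx.
Qed.

Lemma test_functionM f g : test_function f -> test_function g ->
  test_function (f \* g).
Proof.
move=> [mf [M fM] [N fN]] [mg [M' gM] [N' gN]]; split.
- exact: measurable_funM.
- exists (M * M') => x; rewrite normrM; apply: ler_pM => //.
- by exists N => x xN; rewrite /= fN ?mul0r.
Qed.

Lemma test_functionZ (c : R) f : test_function f ->
  test_function (fun x => c * f x).
Proof.
move=> [mf [M fM] [N fN]]; split.
- exact: measurable_funM.
- by exists (`|c| * M) => x; rewrite normrM ler_wpM2l.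
- by exists N => x xN; rewrite /= fN ?mulr0.
Qed.

Lemma test_functionN f : test_function f -> test_function (fun x => - f x).
Proof.
move=> tf; rewrite (_ : (fun _ => _) = fun x => -1 * f x).
  exact: test_functionZ.
by apply/funext => x; rewrite mulN1r.
Qed.

Lemma test_functionB f g : test_function f -> test_function g ->
  test_function (fun x => f x - g x).
Proof. by move=> tf tg; apply: test_functionD => //; exact: test_functionN. Qed.

Lemma test_function_norm f : test_function f ->
  test_function (fun x => `|f x|).
Proof.
move=> [mf [M fM] [N fN]]; split.
- exact: measurableT_comp.
- by exists M => x; rewrite normr_id.
- by exists N => x xN; rewrite /= fN ?normr0.
Qed.

Lemma rstatD f g w : test_function f -> test_function g ->
  rstat (f \+ g) w = rstat f w + rstat g w.
Proof.
move=> [_ _ [N fN]] [_ _ [N' gN]]; pose M := Num.max N N'.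
have fM x : ~ box M x -> f x = 0.
  by move=> Mx; apply: fN => Nx; apply: Mx; apply: box_subset Nx;
    rewrite le_max lexx.
have gM x : ~ box M x -> g x = 0.
  by move=> Mx; apply: gN => Nx; apply: Mx; apply: box_subset Nx;
    rewrite le_max lexx orbT.
rewrite /rstat !(@fsum_points _ M)// ?big_split//.
by move=> x xM /=; rewrite fM// gM// addr0.
Qed.

Lemma rstatZ c f w : test_function f ->
  rstat (fun x => c * f x) w = c * rstat f w.
Proof.
move=> [_ _ [N fN]]; rewrite /rstat !(@fsum_points _ N)// ?mulr_sumr//.
by move=> x xM /=; rewrite fN// mulr0.
Qed.

Lemma rstatB f g w : test_function f -> test_function g ->
  rstat (fun x => f x - g x) w = rstat f w - rstat g w.
Proof.
move=> tf tg.
have tNg : test_function (fun x => -1 * g x) by exact: test_functionZ.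
rewrite -mulN1r -rstatZ// -rstatD//; congr rstat.
by apply/funext => x /=; rewrite mulN1r.
Qed.

(** The diagonal of the double sum is separated, because the two point
    correlation function only sees pairs of distinct points. *)
Lemma rstat_sqr f w : test_function f -> (forall x, 0 <= f x) ->
  ((rstat f w ^+ 2)%:E = (rstat (f \* f) w)%:E +
  \esum_(t in [set t : 2.-tuple E | uniq t /\ forall i, Phi w (tnth t i)])
     (f (tnth t ord0) * f (tnth t ord_max))%:E)%E.
Proof.
move=> tf f0.
have f0e x : (0 <= (f x)%:E)%E by rewrite lee_fin.
have ff0 x y : (0 <= (f x * f y)%:E)%E by rewrite lee_fin mulr_ge0.
have sE x : ((f x * rstat f w)%:E =
    \esum_(y in Phi w) (f x * f y)%:E)%E.
  have tfx : test_function (fun y => f x * f y) by exact: test_functionZ.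
  by rewrite (esum_rstat w tfx) ?rstatZ// => y; rewrite mulr_ge0.
transitivity (\esum_(x in Phi w) \esum_(y in Phi w) (f x * f y)%:E)%E.
  under eq_esum do rewrite -sE.
  have ts : test_function (fun x => rstat f w * f x) by exact: test_functionZ.
  have s0 : 0 <= rstat f w.
    by rewrite -lee_fin -esum_rstat//; apply: esum_ge0.
  under eq_esum do rewrite mulrC.
  by rewrite (esum_rstat w ts) ?rstatZ// => y; rewrite mulr_ge0.
transitivity (\esum_(x in Phi w) ((f x * f x)%:E +
    \esum_(y in Phi w `&` ~` [set x]) (f x * f y)%:E))%E.
  apply: eq_esum => x Px; rewrite (esumID [set x])//; congr (_ + _)%E.
  rewrite (_ : _ `&` _ = [set x]) ?esum_set1//.
  by apply/seteqP; split => y /=; [case|move=> ->].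
rewrite esumD//; last by move=> x _; exact: esum_ge0.
congr (_ + _)%E.
  by rewrite -esum_rstat// => [|x]; [exact: test_functionM|exact: mulr_ge0].
rewrite esum_esum//.
apply/esym/(@reindex_esum _ _ _ _ _ (fun p : E * E => [tuple p.1; p.2])
  (fun t => (f (tnth t ord0) * f (tnth t ord_max))%:E)).
split.
- move=> [x y] /= [Px [Py yx]]; split; first by rewrite inE andbT eq_sym; exact/eqP.
  by move=> i; case: i => -[|[|]].
- by move=> [x y] [x' y'] _ _ /= [-> ->].
- move=> t [] /=.
  case: t => -[|x [|y [|]]]//= st; rewrite inE andbT => xy Pt.
  exists (x, y) => /=; last exact: val_inj.
  split; first by have := Pt ord0.
  split; first by have := Pt ord_max.
  by move=> yx; move: xy; rewrite yx eqxx.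
Qed.

End linear_statistics.

(** * The determinantal kernel *)

Section kernel.
Context {R : realType} {d : nat}.
Notation E := 'rV[R]_d.
Variable K : E -> E -> R[i].
Hypotheses (K_inv : translation_invariant_correlations K)
  (K_hermitian : hermitian_kernel K) (K00 : K 0 0 = 1).

Lemma kernel_diag x : K x x = 1.
Proof.
have := K_inv [tuple 0] x; rewrite /det_kernel !det_mx11 !mxE !(tnth_nth 0) /=.
by rewrite add0r => ->.
Qed.

Lemma modulus_sqr (z : R[i]) : modulus z ^+ 2 = complex.Re z ^+ 2 + complex.Im z ^+ 2.
Proof. by case: z => a b; rewrite /modulus/= sqr_sqrtr// addr_ge0 ?sqr_ge0. Qed.

Lemma det_kernel2 x y :
  det_kernel K [tuple x; y] = (1 - modulus (K x y) ^+ 2)%:C.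
Proof.
rewrite /det_kernel (expand_det_row _ ord0) !big_ord_recl big_ord0 addr0.
rewrite /cofactor !det_mx11 !mxE /= !(tnth_nth 0) /=.
rewrite !kernel_diag (K_hermitian x y) modulus_sqr.
by case: (K x y) => a b; apply/eqP; rewrite eq_complex /=; apply/andP; split;
  apply/eqP; ring.
Qed.

(** Equating the two point correlations at [(x, y)] and [(0, y - x)]. *)
Lemma modulus_kernel x y : modulus (K x y) ^+ 2 = kappa K (y - x) ^+ 2.
Proof.
have := K_inv [tuple x; y] (- x); rewrite (_ : map_tuple _ _ = [tuple 0; y - x]).
  by rewrite !det_kernel2 => -[] /addrI/oppr_inj.
by apply/val_inj; rewrite /= subrr.
Qed.

Lemma kappa2_even z : kappa K (- z) ^+ 2 = kappa K z ^+ 2.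
Proof.
rewrite -[- z]sub0r -modulus_kernel K_hermitian /kappa !modulus_sqr.
by case: (K 0 z) => a b /=; rewrite sqrrN.
Qed.

Lemma Re_det_kernel1 x : complex.Re (det_kernel K [tuple x]) = 1.
Proof. by rewrite /det_kernel !det_mx11 !mxE /= kernel_diag. Qed.

Lemma Re_det_kernel2 x y :
  complex.Re (det_kernel K [tuple x; y]) = 1 - kappa K (y - x) ^+ 2.
Proof. by rewrite det_kernel2 modulus_kernel. Qed.

End kernel.

(** * Signed integrals, inverses in the extended reals *)

Lemma integrableZ_EFin {disp} {T : measurableType disp} {R : realType}
    (mu : {measure set T -> \bar R}) (c : R) (f : T -> R) :
  mu.-integrable setT (EFin \o f) ->
  mu.-integrable setT (EFin \o (fun x => c * f x)).
Proof.
move=> h; have := integrableZl measurableT c h.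
by apply: eq_integrable => // x _; rewrite /= EFinM.
Qed.

Section signed_change_of_variable.
Context {R : realType} {d : nat}.
Notation E := 'rV[R]_d.
Local Notation leb := (@lebesgue_rV R d).

Lemma Rintegral_rV_transl (a : E) (F : E -> R) : measurable_fun setT F ->
  \int[leb]_x F (x + a) = \int[leb]_x F x.
Proof.
move=> mF; have mEF : measurable_fun setT (EFin \o F) by exact/measurable_EFinP.
rewrite /Rintegral integralE [in RHS]integralE; congr fine; congr (_ - _)%E.
  rewrite -(integral_rV_transl a (measurable_funepos mEF)).
    by apply: eq_integral => x _; rewrite !funeposE.
  by move=> x; exact: funepos_ge0.
rewrite -(integral_rV_transl a (measurable_funeneg mEF)).
  by apply: eq_integral => x _; rewrite !funenegE.
by move=> x; exact: funeneg_ge0.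
Qed.

Lemma Rintegral_rVN (F : E -> R) : measurable_fun setT F ->
  \int[leb]_x F (- x) = \int[leb]_x F x.
Proof.
move=> mF; have mEF : measurable_fun setT (EFin \o F) by exact/measurable_EFinP.
rewrite /Rintegral integralE [in RHS]integralE; congr fine; congr (_ - _)%E.
  rewrite -(integral_rVN (measurable_funepos mEF)).
    by apply: eq_integral => x _; rewrite !funeposE.
  by move=> x; exact: funepos_ge0.
rewrite -(integral_rVN (measurable_funeneg mEF)).
  by apply: eq_integral => x _; rewrite !funenegE.
by move=> x; exact: funeneg_ge0.
Qed.

Lemma dotDr (u x y : E) : dot u (x + y) = dot u x + dot u y.
Proof. by rewrite /dot -big_split; apply: eq_bigr => i _; rewrite mxE mulrDr. Qed.

Lemma dotNr (u x : E) : dot u (- x) = - dot u x.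
Proof. by rewrite /dot -sumrN; apply: eq_bigr => i _; rewrite mxE mulrN. Qed.

Lemma dot0r (u : E) : dot u 0 = 0.
Proof. by rewrite /dot big1// => i _; rewrite mxE mulr0. Qed.

Lemma measurable_cos_dot {disp} {T : measurableType disp} (f g : T -> E) :
  measurable_fun setT f -> measurable_fun setT g ->
  measurable_fun setT (fun x => cos (dot (f x) (g x))).
Proof.
move=> mf mg; apply: (measurableT_comp (f := @cos R)).
  by apply: continuous_measurable_fun; exact: continuous_cos.
exact: measurable_fun_dot.
Qed.

Lemma measurable_sin_dot {disp} {T : measurableType disp} (f g : T -> E) :
  measurable_fun setT f -> measurable_fun setT g ->
  measurable_fun setT (fun x => sin (dot (f x) (g x))).
Proof.
move=> mf mg; apply: (measurableT_comp (f := @sin R)).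
  by apply: continuous_measurable_fun; exact: continuous_sin.
exact: measurable_fun_dot.
Qed.

End signed_change_of_variable.

Section inverses.
Context {R : realType}.

Lemma measurable_funV_ge0 {disp} {T : measurableType disp} (f : T -> R) :
  measurable_fun setT f -> (forall x, 0 <= f x) ->
  measurable_fun setT (fun x => (f x)^-1).
Proof.
move=> mf f0; rewrite (_ : (fun _ => _) = (fun x => f x `^ -1)).
  exact: (measurableT_comp (measurable_powR (-1)) mf).
by apply/funext => x; rewrite powR_inv1.
Qed.

(** The convention [0^-1 = +oo] is the limit of the regularized inverses, which
    makes monotone convergence available. *)
Lemma cvg_inve_reg (s : R) : 0 <= s ->
  ((s + n.+1%:R^-1)^-1)%:E @[n --> \oo] --> (s%:E^-1)%E.
Proof.
rewrite le_eqVlt => /predU1P[<-|s0].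
  rewrite inve0; apply/cvgeryP; under eq_fun do rewrite add0r invrK.
  by have := @cvgr_idn R; rewrite -cvg_shiftS; exact.
rewrite inver gt_eqF//; apply: cvg_EFin; first by near=> n.
have : (fun n : nat => s + (n.+1%:R : R)^-1) @ \oo --> (s + 0 : R).
  by apply: cvgD; [exact: cvg_cst|exact: cvg_harmonic].
by rewrite addr0 => /(cvgV (lt0r_neq0 s0)) H; exact: H.
Unshelve. all: by end_near. Qed.

Lemma measurable_inve_ge0 {disp} {T : measurableType disp} (f : T -> R) :
  measurable_fun setT f -> (forall x, 0 <= f x) ->
  measurable_fun setT (fun x => ((f x)%:E^-1)%E).
Proof.
move=> mf f0.
apply: (emeasurable_fun_cvg (fun n x => ((f x + n.+1%:R^-1)^-1)%:E)).
  move=> n; apply/measurable_EFinP; apply: measurable_funV_ge0 => [|x].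
    exact: measurable_funD.
  by rewrite addr_ge0.
by move=> x _; exact: cvg_inve_reg.
Qed.

Lemma measurable_eball d (r : R) : 0 < r -> measurable (eball r : set 'rV[R]_d).
Proof.
move=> r0.
rewrite [eball r](_ : _ = setT `&` (fun x => dot x x) @^-1` `]-oo, (r ^+ 2)[).
  by apply: (measurable_fun_dot (@measurable_id _ _ setT) (@measurable_id _ _ setT)).
have sE (x : 'rV[R]_d) : (Num.sqrt (dot x x) < r) = (dot x x < r ^+ 2).
  have q0 : 0 <= dot x x by apply: sumr_ge0 => i _; rewrite -expr2 sqr_ge0.
  by rewrite -{2}(sqr_sqrtr q0) ltr_pXn2r ?nnegrE ?sqrtr_ge0 ?(ltW r0).
by rewrite setTI; apply/seteqP; split => x /=; rewrite /eball/= in_itv/= sE.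
Qed.

End inverses.

Lemma Lfun2_sqr {R : realType} {d} {T : measurableType d} (P : probability T R)
    (X : T -> R) :
  measurable_fun setT X -> (\int[P]_w (X w ^+ 2)%:E < +oo)%E ->
  X \in Lfun P 2%:E.
Proof.
move=> mX X2; rewrite inE; apply/andP; split; rewrite inE//= /finite_norm.
rewrite unlock poweR_lty//.
by under eq_integral do rewrite /= powR_mulrn// real_normK ?num_real//.
Qed.

(** * The tent function and its cosine transform *)

Section tent.
Context {R : realType}.
Local Notation mu := (@lebesgue_measure R).

Lemma Rintegral_FTC (F f : R -> R) (a b : R) : a < b ->
  (forall x : R, is_derive x (1 : R) F (f x)) -> continuous f ->
  \int[mu]_(x in `[a, b]) f x = F b - F a.
Proof.
move=> ab dF cf.
have cF : continuous F.
  move=> x; apply: differentiable_continuous; apply/derivable1_diffP.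
  by have [] := dF x.
rewrite /Rintegral (@continuous_FTC2 _ f F)//.
- by apply: continuous_in_subspaceT => x _; exact: cf.
- split.
  + by move=> x _; have [] := dF x.
  + by apply: cvg_at_right_filter; exact: cF.
  + by apply: cvg_at_left_filter; exact: cF.
- by move=> x _; rewrite derive1E; have [_ ->] := dF x.
Qed.

Lemma is_derive_affine (c x t : R) :
  is_derive t (1 : R) (fun t : R => c + t * x) x.
Proof.
have H : is_derive t (1 : R) (cst c + (id : R -> R) * cst x)
  (0 + (t *: (0 : R) + x *: (1 : R))).
  by apply: is_deriveD; apply: is_deriveM.
by move: H; rewrite scaler0 !add0r [_ *: _]mulr1.
Qed.

Lemma is_derive_sin_affine (th x t : R) :
  is_derive t (1 : R) (fun t : R => sin (th + t * x)) (cos (th + t * x) * x).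
Proof.
have d := is_derive_affine th x t.
exact: (@is_derive1_comp R sin _ t _ _ (is_derive_sin _) d).
Qed.

Lemma is_derive_cos_affine (th x t : R) :
  is_derive t (1 : R) (fun t : R => cos (th + t * x)) (- sin (th + t * x) * x).
Proof.
have d := is_derive_affine th x t.
exact: (@is_derive1_comp R cos _ t _ _ (is_derive_cos _) d).
Qed.

(** Used with [e = 1] and [e = -1], on the two intervals where the tent is
    affine. *)
Lemma is_derive_tent (c e th x t : R) : x != 0 ->
  is_derive t (1 : R)
    (fun t : R => (c + t * e) * (sin (th + t * x) * x^-1) +
       e * (x ^- 2 * cos (th + t * x)))
    ((c + t * e) * cos (th + t * x)).
Proof.
move=> x0.
have da := is_derive_affine c e t.
have ds := is_derive_sin_affine th x t.
have dc := is_derive_cos_affine th x t.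
have ds' : is_derive t (1 : R) ((fun t : R => sin (th + t * x)) * cst x^-1)
  (sin (th + t * x) *: (0 : R) + x^-1 *: (cos (th + t * x) * x)).
  exact: is_deriveM.
have H : is_derive t (1 : R)
  ((fun t : R => c + t * e) * ((fun t : R => sin (th + t * x)) * cst x^-1) +
   (e * x ^- 2) \*: (fun t : R => cos (th + t * x)))
  (((c + t * e) *: (sin (th + t * x) *: (0 : R) + x^-1 *: (cos (th + t * x) * x))
    + (sin (th + t * x) * x^-1) *: e) +
   (e * x ^- 2) *: (- sin (th + t * x) * x)).
  by apply: is_deriveD; try exact: is_deriveM; exact: is_deriveZ.
have E : ((c + t * e) *: (sin (th + t * x) *: (0 : R) + x^-1 *: (cos (th + t * x) * x))
    + (sin (th + t * x) * x^-1) *: e) +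
   (e * x ^- 2) *: (- sin (th + t * x) * x) = (c + t * e) * cos (th + t * x).
  by rewrite /GRing.scale/=; field.
rewrite E in H; congr (is_derive _ _ _ _) : H.
by apply/funext => u; rewrite !fctE; congr (_ + _); rewrite /GRing.scale/= mulrA.
Qed.

Lemma continuous_affine_cos (c e th x : R) :
  continuous (fun t : R => (c + t * e) * cos (th + t * x)).
Proof.
move=> t.
have d1 : differentiable (fun t : R => c + t * e) t.
  by apply/derivable1_diffP; have [] := is_derive_affine c e t.
have d2 : differentiable (fun t : R => cos (th + t * x)) t.
  by apply/derivable1_diffP; have [] := is_derive_cos_affine th x t.
exact: (cvgM (differentiable_continuous d1) (differentiable_continuous d2)).
Qed.

Variable b : R.
Hypothesis b0 : 0 < b.

Definition tent (t : R) : R := Num.max 0 (b - `|t|).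

Lemma tent_ge0 t : 0 <= tent t.
Proof. by rewrite le_max lexx. Qed.

Lemma tent_le t : tent t <= b.
Proof. by rewrite ge_max ltW//= gerBl. Qed.

Lemma tent_out t : b <= `|t| -> tent t = 0.
Proof. by move=> bt; apply/max_idPl; rewrite subr_le0. Qed.

Lemma tent_ge t : `|t| <= b / 2 -> b / 2 <= tent t.
Proof. by move=> tb; rewrite le_max; apply/orP; right; lra. Qed.

Lemma measurable_tent : measurable_fun setT tent.
Proof.
by apply: measurable_maxr => //; exact: measurable_funB.
Qed.

(** The cosine transform of the tent, a Fejer kernel. *)
Definition ptent (x : R) : R := \int[mu]_t (tent t * cos (t * x)).

Lemma integrable_tentM (g : R -> R) : measurable_fun setT g ->
  (forall t, `|g t| <= 1) ->
  mu.-integrable setT (EFin \o (fun t => tent t * g t)).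
Proof.
move=> mg g1.
apply: (@le_integrable _ _ _ mu setT measurableT _
  (EFin \o (fun t => b * \1_(`[- b, b]%classic) t))).
- by apply/measurable_EFinP; apply: measurable_funM => //; exact: measurable_tent.
- move=> t _ /=; rewrite lee_fin normrM.
  rewrite [leRHS]ger0_norm; last by rewrite mulr_ge0// ltW.
  rewrite indicE; case: (boolP (t \in _)) => [_|].
    rewrite mulr1 -[leRHS]mulr1 ler_pM//.
    by rewrite ger0_norm ?tent_ge0// tent_le.
  rewrite notin_setE /= in_itv/= -ler_norml => /negP; rewrite -ltNge => /ltW bt.
  by rewrite tent_out// normr0 mul0r mulr0.
- by apply: integrableZ_EFin; exact: integrable_indic_itv.
Qed.

Lemma measurable_cosM (th x : R) : measurable_fun setT (fun t : R => cos (th + t * x)).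
Proof.
apply: (measurableT_comp (f := @cos R)).
  by apply: continuous_measurable_fun; exact: continuous_cos.
by apply: measurable_funD => //; apply: measurable_funM.
Qed.

Lemma ptent_FTC (th x : R) : x != 0 ->
  \int[mu]_t (tent t * cos (th + t * x)) =
  cos th * (2 * (1 - cos (b * x)) / x ^+ 2).
Proof.
move=> x0.
have ig : mu.-integrable setT (EFin \o (fun t => tent t * cos (th + t * x))).
  by apply: integrable_tentM => [|t]; [exact: measurable_cosM|exact: cos_max].
have itv0 : 0 \in `[- b, b] by rewrite in_itv/= oppr_le0 ltW//= ltW.
have -> : \int[mu]_t (tent t * cos (th + t * x)) =
    \int[mu]_(t in `[- b, b]) (tent t * cos (th + t * x)).
  rewrite [RHS]Rintegral_mkcond; apply: eq_Rintegral => t _.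
  rewrite patchE; case: ifPn => //; rewrite notin_setE /= in_itv/= -ler_norml.
  by move=> /negP; rewrite -ltNge => /ltW bt; rewrite tent_out// mul0r.
have ig' : mu.-integrable `[- b, b] (EFin \o (fun t => tent t * cos (th + t * x))).
  by apply: integrableS ig.
have := @Rintegral_itvB R (fun t => tent t * cos (th + t * x)) (BLeft (- b)) (BRight b) 0 ig'.
rewrite !bnd_simp oppr_le0 (ltW b0) => /(_ isT isT).
move=> /eqP; rewrite subr_eq => /eqP ->.
rewrite Rintegral_itv_obnd_cbnd; last first.
  by apply: integrableS ig' => //; apply: subset_itvr; rewrite bnd_simp oppr_le0 ltW.
have -> : \int[mu]_(t in `[0, b]) (tent t * cos (th + t * x)) =
    \int[mu]_(t in `[0, b]) ((b + t * -1) * cos (th + t * x)).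
  apply: eq_Rintegral => t; rewrite inE/= in_itv/= => /andP[t0 tb].
  by rewrite /tent ger0_norm// mulrN1 max_r// subr_ge0.
have -> : \int[mu]_(t in `[- b, 0]) (tent t * cos (th + t * x)) =
    \int[mu]_(t in `[- b, 0]) ((b + t * 1) * cos (th + t * x)).
  apply: eq_Rintegral => t; rewrite inE/= in_itv/= => /andP[t0 tb].
  by rewrite /tent ler0_norm// opprK mulr1 max_r// -lerBlDl sub0r.
rewrite (Rintegral_FTC b0 (fun t => is_derive_tent b (-1) th t x0)); last first.
  exact: continuous_affine_cos.
rewrite (@Rintegral_FTC _ _ (- b) 0 _ (fun t => is_derive_tent b 1 th t x0)); last 2 first.
- by rewrite oppr_lt0.
- exact: continuous_affine_cos.
rewrite !mul0r !addr0 !mulNr !cosD !sinD cosN sinN.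
by field.
Qed.

(** The tent is even, so its transform carries no phase. *)
Lemma ptent_phase (th x : R) :
  \int[mu]_t (tent t * cos (th + t * x)) = cos th * ptent x.
Proof.
have [->|x0] := eqVneq x 0.
  rewrite /ptent; under eq_Rintegral do rewrite mulr0 addr0 mulrC.
  under [in RHS]eq_Rintegral do rewrite mulr0 cos0.
  rewrite RintegralZl//.
    by congr (_ * _); apply: eq_Rintegral => t _; rewrite mulr1.
  have := @integrable_tentM (cst 1) (measurable_cst _) (fun=> _).
  under [X in _.-integrable _ (_ \o X)]eq_fun do rewrite /= mulr1.
  by apply => t; rewrite normr1.
rewrite ptent_FTC//; congr (_ * _); rewrite /ptent.
have := ptent_FTC 0 x0; rewrite cos0 mul1r => <-.
by apply: eq_Rintegral => t _; rewrite add0r.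
Qed.

Lemma tent_mass_gt0 : exists2 W : R, 0 < W & (\int[mu]_t (tent t)%:E = W%:E)%E.
Proof.
have i1 : mu.-integrable setT (EFin \o tent).
  have := @integrable_tentM (cst 1) (measurable_cst _).
  under [X in _.-integrable _ (_ \o X)]eq_fun do rewrite /= mulr1.
  by apply => t; rewrite normr1.
have fI := integrable_fin_num measurableT i1.
exists (fine (\int[mu]_t (tent t)%:E)%E); last by rewrite fineK.
rewrite -lte_fin fineK//.
apply: (@lt_le_trans _ _ (\int[mu]_t ((b / 2) * \1_(`[- (b / 2), b / 2]%classic) t)%:E)%E).
  under eq_integral do rewrite EFinM.
  rewrite ge0_integralZl_EFin//; last 2 first.
  - by apply/measurable_EFinP; apply: measurable_indic.
  - by rewrite divr_ge0// ltW.
  have hb : - (b / 2) < b / 2 by have := b0; lra.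
  rewrite integral_indic// setIT/= lebesgue_measure_itv/= lte_fin hb.
  by rewrite -EFinD -EFinM lte_fin mulr_gt0 ?divr_gt0// subr_gt0.
apply: ge0_le_integral => //.
- by move=> t _; rewrite lee_fin mulr_ge0// divr_ge0// ltW.
- by apply/measurable_EFinP; apply: measurable_funM => //; apply: measurable_indic.
- by apply/measurable_EFinP; exact: measurable_tent.
- move=> t _; rewrite lee_fin indicE.
  case: (boolP (t \in _)) => [|_]; last by rewrite mulr0 tent_ge0.
  rewrite inE /= in_itv/= -ler_norml mulr1; exact: tent_ge.
Qed.

Lemma ptent_ge0 x : 0 <= ptent x.
Proof.
have [->|x0] := eqVneq x 0.
  by apply: Rintegral_ge0 => t _; rewrite mulr0 cos0 mulr1 tent_ge0.
have := ptent_phase 0 x; rewrite cos0 mul1r ptent_FTC// cos0 mul1r => <-.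
by rewrite mulr_ge0 ?invr_ge0 ?sqr_ge0// mulr_ge0// subr_ge0 cos_le1.
Qed.

Lemma measurable_ptent : measurable_fun setT ptent.
Proof.
have [W W0 WE] := tent_mass_gt0.
pose F (p : measurableTypeR R * measurableTypeR R) : \bar R :=
  (tent p.2 * (1 + cos (p.2 * p.1)))%:E.
have F0 p : (0 <= F p)%E.
  by rewrite lee_fin mulr_ge0 ?tent_ge0// -lerBlDl sub0r cos_geN1.
have mF : measurable_fun setT F.
  apply/measurable_EFinP; apply: measurable_funM.
    exact: (measurableT_comp measurable_tent measurable_snd).
  apply: measurable_funD => //; apply: (measurableT_comp (f := @cos R)).
    by apply: continuous_measurable_fun; exact: continuous_cos.
  by apply: measurable_funM; [exact: measurable_snd|exact: measurable_fst].
have := measurable_fun_fubini_tonelli_F F mF F0 (m2 := mu).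
have i1 : mu.-integrable setT (EFin \o tent).
  apply/integrableP; split; first by apply/measurable_EFinP; exact: measurable_tent.
  by under eq_integral do rewrite /= ger0_norm ?tent_ge0//; rewrite WE ltry.
have ic x : mu.-integrable setT (EFin \o (fun t => tent t * cos (t * x))).
  apply: integrable_tentM => [|t]; last exact: cos_max.
  by have := measurable_cosM 0 x; under eq_fun do rewrite add0r.
have E x : (\int[mu]_t (tent t * (1 + cos (t * x)))%:E = (W + ptent x)%:E)%E.
  under eq_integral do rewrite mulrDr mulr1 EFinD.
  rewrite integralD//=; last exact: (ic x).
  rewrite WE EFinD /ptent /Rintegral fineK//.
  exact: integrable_fin_num (ic x).
rewrite /fubini_F /F /=; under eq_fun do rewrite E.
move=> /measurable_EFinP mW.
rewrite (_ : ptent = fun u => W + ptent u - W); first exact: measurable_funB.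
by apply/funext => u; rewrite addrC addKr.
Qed.

(** The transform is bounded and is at most [4 / x^2], hence dominated by a
    multiple of the Cauchy density. *)
Lemma ptent_integral_lty : (\int[mu]_x (ptent x)%:E < +oo)%E.
Proof.
have [W W0 WE] := tent_mass_gt0.
have WR : \int[mu]_t tent t = W by rewrite /Rintegral WE.
have i1 : mu.-integrable setT (EFin \o tent).
  apply/integrableP; split; first by apply/measurable_EFinP; exact: measurable_tent.
  by under eq_integral do rewrite /= ger0_norm ?tent_ge0//; rewrite WE ltry.
have pW x : ptent x <= W.
  rewrite -WR; apply: le_Rintegral => //.
  - apply: integrable_tentM => [|t]; last exact: cos_max.
    by have := measurable_cosM 0 x; under eq_fun do rewrite add0r.
  - by move=> t _; rewrite ler_piMr ?tent_ge0// cos_le1.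
have px x : ptent x <= (W + 4) * (oneDsqr x)^-1.
  rewrite ler_pdivlMr ?oneDsqr_gt0// /oneDsqr mulrDr mulr1 lerD//.
  have [->|x0] := eqVneq x 0; first by rewrite expr0n mulr0.
  have := ptent_phase 0 x; rewrite cos0 mul1r ptent_FTC// cos0 mul1r => <-.
  rewrite divfK ?sqrf_eq0//.
  by have := cos_geN1 (b * x); lra.
have m1 : measurable_fun [set: R] (fun x : R => (oneDsqr x)^-1).
  by apply: continuous_measurable_fun; exact: continuous_oneDsqrV.
apply: (@le_lt_trans _ _ (\int[mu]_x ((W + 4) * (oneDsqr x)^-1)%:E)%E).
  apply: ge0_le_integral => //.
  - by move=> x _; rewrite lee_fin ptent_ge0.
  - by apply/measurable_EFinP; exact: measurable_ptent.
  - by apply/measurable_EFinP; exact: measurable_funM.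
  - by move=> x _; rewrite lee_fin.
under eq_integral do rewrite EFinM.
rewrite ge0_integralZl_EFin//; last by rewrite addr_ge0// ltW.
apply: lte_mul_pinfty => //; first by rewrite lee_fin addr_ge0// ltW.
rewrite (ge0_symfun_integralT (f := fun x => (oneDsqr x)^-1)).
- rewrite (_ : [set x | _] = `[0, +oo[%classic); last first.
    by apply/seteqP; split => x/=; rewrite in_itv/= andbT.
  by rewrite integral0y_oneDsqr -EFinM ltry.
- by move=> x; rewrite invr_ge0 ltW// oneDsqr_gt0.
- exact: continuous_oneDsqrV.
- by move=> x /=; rewrite /oneDsqr sqrrN.
- exact/measurable_EFinP.
Qed.

End tent.

(** * Small frequencies *)

Section small_frequencies.
Context {R : realType} {d : nat}.
Notation E := 'rV[R]_d.
Local Notation leb := (@lebesgue_rV R d).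

Lemma dot_box (N M : R) (x y : E) : 0 <= N -> box N x -> box M y ->
  `|dot x y| <= d%:R * N * M.
Proof.
move=> N0 xN yM; apply: le_trans (ler_norm_sum _ _ _) _.
apply: (@le_trans _ _ (\sum_(i < d) N * M)).
  by apply: ler_sum => i _; rewrite normrM ler_pM.
by rewrite sumr_const card_ord -mulrA mulr_natl.
Qed.

Lemma near_cos1 (e : R) : 0 < e ->
  exists2 r : R, 0 < r & forall t, `|t| <= r -> 1 - e <= cos t.
Proof.
move=> e0; have /cvgrPdist_lt/(_ _ e0) := @continuous_cos R 0.
rewrite cos0 => /nbhs_ballP[r /= r0 H]; exists (r / 2); first exact: divr_gt0.
move=> t tr; have : ball (0 : R) r t.
  by rewrite /ball/= sub0r normrN (le_lt_trans tr)// ltr_pdivrMr// ltr_pMr// ltr1n.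
by move=> /H; rewrite /= ltr_distl => /andP[_ h]; lra.
Qed.

(** The window of frequencies is small enough for the characters to be almost
    constant on the bounded region where the test functions are compared. *)
Lemma frequency_window (N e r : R) : 0 < e -> 0 < r -> exists2 b : R, 0 < b &
  (forall xi x : E, box b xi -> box N x -> 1 - e <= cos (dot xi x)) /\
  (forall xi : E, box b xi -> eball r xi).
Proof.
move=> e0 r0; have [t t0 tP] := near_cos1 e0.
pose c := d%:R * (`|N| + 1) + 1 : R.
have c0 : 0 < c by rewrite ltr_wpDl// mulr_ge0// addr_ge0.
pose q := d%:R + 1 : R.
have q0 : 0 < q by rewrite ltr_wpDl.
exists (Num.min (t / c) (r / q)).
  by rewrite lt_min !divr_gt0.
set b := Num.min _ _; have bt : b <= t / c by rewrite ge_min lexx.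
have br : b <= r / q by rewrite ge_min lexx orbT.
have b0 : 0 < b by rewrite lt_min !divr_gt0.
split=> [xi x xib xN|xi xib].
  apply: tP; apply: le_trans (dot_box (ltW b0) xib xN) _.
  apply: (@le_trans _ _ (b * c)); last by rewrite -ler_pdivlMr.
  rewrite (mulrC d%:R) -mulrA ler_wpM2l ?ltW// /c.
  have dN : d%:R * N <= d%:R * `|N| by rewrite ler_wpM2l// ler_norm.
  have d0 : 0 <= d%:R :> R by [].
  by rewrite mulrDr mulr1; lra.
rewrite /eball/= -(ltr_pXn2r (n := 2))// ?nnegrE ?sqrtr_ge0 ?ltW//.
rewrite sqr_sqrtr; last by apply: sumr_ge0 => i _; rewrite -expr2 sqr_ge0.
have := dot_box (ltW b0) xib xib; rewrite ler_norml => /andP[_ le1].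
apply: le_lt_trans le1 _.
apply: (@lt_le_trans _ _ ((q * b) ^+ 2)).
  rewrite exprMn -mulrA -expr2 ltr_pM2r ?exprn_gt0// /q.
  have d0 : 0 <= d%:R :> R by [].
  by nra.
have bq : q * b <= r by rewrite mulrC -ler_pdivlMr.
by rewrite lerXn2r ?nnegrE ?mulr_ge0 ?(ltW q0) ?(ltW b0) ?(ltW r0).
Qed.

Lemma eball_sub_box (r : R) (x : E) : eball r x -> box r x.
Proof.
move=> xr i; apply/ltW; apply: le_lt_trans xr.
rewrite -[leLHS]sqrtr_sqr ler_wsqrtr// /dot (bigD1 i)//= -expr2 lerDl.
by apply: sumr_ge0 => j _; rewrite -expr2 sqr_ge0.
Qed.

End small_frequencies.

(** * Polynomial functions *)

Section polynomial_functions.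
Context {R : realType}.
Notation leb := (@lebesgue_rV R _).

(** Only two features of polynomial functions are needed: measurability and
    the fact that their restriction to any line is a polynomial.  This notion
    is stable under translations and affine sections. *)
Definition line_polynomial d (F : 'rV[R]_d -> R) : Prop :=
  measurable_fun setT F /\
  forall x v, exists p : {poly R}, forall s, F (x + s *: v) = p.[s].

Section closure.
Context {d : nat}.
Implicit Types F G : 'rV[R]_d -> R.

Lemma line_polynomial_cst c : line_polynomial (fun _ : 'rV[R]_d => c).
Proof. by split=> // x v; exists c%:P => s; rewrite hornerC. Qed.

Lemma line_polynomial_coord (i : 'I_d) :
  line_polynomial (fun x : 'rV[R]_d => x ord0 i).
Proof.
split=> [|x v]; first exact: measurable_coord.
exists ((x ord0 i)%:P + v ord0 i *: 'X) => s.
by rewrite !mxE hornerD hornerC hornerZ hornerX mulrC.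
Qed.

Lemma line_polynomialD F G : line_polynomial F -> line_polynomial G ->
  line_polynomial (fun x => F x + G x).
Proof.
move=> [mF pF] [mG pG]; split=> [|x v]; first exact: measurable_funD.
have [p pE] := pF x v; have [q qE] := pG x v.
by exists (p + q) => s; rewrite hornerD pE qE.
Qed.

Lemma line_polynomialM F G : line_polynomial F -> line_polynomial G ->
  line_polynomial (fun x => F x * G x).
Proof.
move=> [mF pF] [mG pG]; split=> [|x v]; first exact: measurable_funM.
have [p pE] := pF x v; have [q qE] := pG x v.
by exists (p * q) => s; rewrite hornerM pE qE.
Qed.

Lemma line_polynomialX F n : line_polynomial F -> line_polynomial (fun x => F x ^+ n).
Proof.
move=> pF; elim: n => [|n IHn]; first exact: line_polynomial_cst.
under eq_fun do rewrite exprS; exact: line_polynomialM.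
Qed.

Lemma line_polynomial_sum (I : Type) (r : seq I) (f : I -> 'rV[R]_d -> R) :
  (forall i, line_polynomial (f i)) ->
  line_polynomial (fun x => \sum_(i <- r) f i x).
Proof.
move=> pf; elim: r => [|i r IHr].
  by under eq_fun do rewrite big_nil; exact: line_polynomial_cst.
by under eq_fun do rewrite big_cons; exact: line_polynomialD.
Qed.

Lemma line_polynomial_prod (I : Type) (r : seq I) (f : I -> 'rV[R]_d -> R) :
  (forall i, line_polynomial (f i)) ->
  line_polynomial (fun x => \prod_(i <- r) f i x).
Proof.
move=> pf; elim: r => [|i r IHr].
  by under eq_fun do rewrite big_nil; exact: line_polynomial_cst.
by under eq_fun do rewrite big_cons; exact: line_polynomialM.
Qed.

Lemma line_polynomial_transl F w : line_polynomial F ->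
  line_polynomial (fun x => F (x + w)).
Proof.
move=> [mF pF]; split=> [|x v].
  exact: (measurableT_comp mF (measurable_funrVD (@measurable_id _ _ setT) (measurable_cst w))).
by have [p pE] := pF (x + w) v; exists p => s; rewrite addrAC pE.
Qed.

Lemma line_polynomialB F G : line_polynomial F -> line_polynomial G ->
  line_polynomial (fun x => F x - G x).
Proof.
move=> pF pG; under eq_fun do rewrite -mulN1r.
by apply: line_polynomialD => //; apply: line_polynomialM => //; exact: line_polynomial_cst.
Qed.

End closure.

Lemma rV_of_tuple_cons n (x : R) (t : n.-tuple (measurableTypeR R)) :
  rV_of_tuple [tuple of x :: t] =
  (row_mx (const_mx x : 'rV_1) (rV_of_tuple t) : 'rV[R]_n.+1).
Proof.
apply/rowP => i; rewrite !mxE; case: (@splitP 1 n i) => j ij; rewrite !mxE.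
  by rewrite (tnth_nth 0) ij ord1.
by rewrite !(tnth_nth 0) ij.
Qed.

Lemma countable_poly_roots (p : {poly R}) : p != 0 -> countable [set s | p.[s] = 0].
Proof.
move=> p0; apply: finite_set_countable.
apply: contrapT => inf.
have [B BS Bsz] := infinite_set_fset (size p) inf.
have := max_poly_roots p0 (rs := enum_fset B).
rewrite (_ : all _ _); last by apply/allP => s sB; apply/rootP; exact: BS.
by rewrite fset_uniq => /(_ isT isT); rewrite ltnNge Bsz.
Qed.

(** By Tonelli and induction on the dimension: all sections but finitely many
    in the first coordinate are again not identically zero. *)
Lemma null_zero_set d (F : 'rV[R]_d -> R) x0 :
  line_polynomial F -> F x0 != 0 -> leb [set x | F x = 0] = 0%E.
Proof.
elim: d F x0 => [|n IHn] F x0 [mF pF] Fx0.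
  rewrite (_ : [set x | _] = set0) ?measure0// -subset0 => x /= Fx.
  by move: Fx0; rewrite (thinmx0 x0) -(thinmx0 x) Fx eqxx.
pose Z := [set x | F x = 0].
have mZ : measurable Z.
  by rewrite -[Z]setTI; exact: (mF measurableT [set 0] (measurable_set1 0)).
rewrite -/Z -(setIT Z) -integral_indic//.
have m1Z : measurable_fun setT (fun x => (\1_Z x)%:E : \bar R).
  by apply/measurable_EFinP; exact: measurable_indic.
rewrite (ge0_integral_lebesgue_rV m1Z)//.
rewrite ge0_integral_tupleS//; last exact: (measurableT_comp m1Z (@measurable_rV_of_tuple R n.+1)).
pose G (x : R) (y : 'rV[R]_n) : R := F (row_mx (const_mx x : 'rV_1) y : 'rV[R]_n.+1).
pose a0 : 'rV[R]_1 := lsubmx (x0 : 'rV_(1 + n)).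
pose y0 : 'rV[R]_n := rsubmx (x0 : 'rV_(1 + n)).
have [p pE] := pF (row_mx (0 : 'rV_1) y0 : 'rV_n.+1) (row_mx (const_mx 1 : 'rV_1) 0 : 'rV_n.+1).
have GE x : G x y0 = p.[x].
  rewrite -pE /G; congr F.
  rewrite (_ : x *: _ = row_mx (const_mx x : 'rV_1) 0); last first.
    rewrite (@scale_row_mx _ 1 1 n x) scaler0; congr row_mx.
    by apply/rowP => i; rewrite !mxE mulr1.
  by rewrite (@add_row_mx _ 1 1 n) add0r addr0.
have p0 : p != 0.
  apply: contraNneq Fx0 => p0; have := GE (a0 ord0 ord0); rewrite p0 horner0 => <-.
  rewrite /G -[in X in X == _](hsubmxK (x0 : 'rV_(1 + n))).
  rewrite (_ : const_mx _ = a0)//.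
  by apply/rowP => i; rewrite mxE (ord1 i).
have mG x : line_polynomial (G x).
  split.
    apply: (measurableT_comp mF); apply: measurable_fun_rV => i.
    rewrite (_ : (fun _ => _) = fun y : 'rV[R]_n =>
      match @fintype.split 1 n i with inl j => x | inr j => y ord0 j end); last first.
      by apply/funext => y; rewrite mxE; case: (@fintype.split 1 n i) => j; rewrite ?mxE.
    by case: (@fintype.split 1 n i) => j; [exact: measurable_cst|exact: measurable_coord].
  move=> y v; have [q qE] := pF (row_mx (const_mx x : 'rV_1) y : 'rV_n.+1) (row_mx (0 : 'rV_1) v : 'rV_n.+1).
  exists q => s; rewrite -qE /G; congr F.
  by rewrite (@scale_row_mx _ 1 1 n s) scaler0 (@add_row_mx _ 1 1 n) addr0.
have secE x : (\int[tuple_measure (@lebesgue_measure R) n]_t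
    (\1_Z (rV_of_tuple [tuple of x :: t]))%:E = leb [set y | G x y = 0%R])%E.
  have mGx : measurable [set y | G x y = 0].
    rewrite -[X in measurable X]setTI.
    exact: ((mG x).1 measurableT [set 0] (measurable_set1 0)).
  rewrite -[in RHS](setIT [set y | _]) -integral_indic//.
  rewrite ge0_integral_lebesgue_rV//; last first.
    by apply/measurable_EFinP; exact: measurable_indic.
  by apply: eq_integral => t _; rewrite rV_of_tuple_cons !indicE.
under eq_integral do rewrite secE.
transitivity (\int[@lebesgue_measure R]_(x in [set s | (p.[s] = 0)%R]) leb [set y | G x y = 0%R])%E.
  rewrite [RHS]integral_mkcond; apply: eq_integral => x _; rewrite patchE.
  case: ifPn => // /negP; rewrite inE /= => px.
  by apply: (IHn _ y0) => //; rewrite GE; exact/eqP.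
have cp := countable_poly_roots p0.
apply: null_set_integral.
- exact: countable_measurable.
- rewrite (_ : (fun _ => _) = (fun x : R => \int[tuple_measure (@lebesgue_measure R) n]_t
    (\1_Z (rV_of_tuple [tuple of x :: t]))%:E)%E); last by apply/funext => x; rewrite secE.
  apply: measurable_funTS.
  apply: (measurable_fun_fubini_tonelli_F (fun q : R * n.-tuple (measurableTypeR R) =>
     (\1_Z (rV_of_tuple [tuple of q.1 :: q.2]))%:E)) => //.
  exact: (measurableT_comp (measurableT_comp m1Z (@measurable_rV_of_tuple R n.+1)) (@measurable_tuple_cons _ _ _)).
- exact: countable_lebesgue_measure0.
Qed.

End polynomial_functions.

Section polynomial_evaluation.
Import (canonicals, coercions) mpoly.
Context {R : realType} {d : nat}.
Notation E := 'rV[R]_d.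
Implicit Types (Q : mpoly.mpoly d R[i]) (x : E).

Lemma poly_evalE Q x : poly_eval Q x =
  \sum_(m <- mpoly.msupp Q) mpoly.mcoeff m Q *
    (\prod_(i < d) x ord0 i ^+ mpoly.fun_of_multinom m i)%:C.
Proof.
rewrite /poly_eval mpoly.mevalE; apply: eq_bigr => m _; congr (_ * _).
by rewrite rmorph_prod; apply: eq_bigr => i _; rewrite rmorphXn.
Qed.

Lemma Re_mul_real (z : R[i]) (r : R) : complex.Re (z * r%:C) = complex.Re z * r.
Proof. by case: z => a b /=; rewrite mulr0 subr0. Qed.

Lemma Im_mul_real (z : R[i]) (r : R) : complex.Im (z * r%:C) = complex.Im z * r.
Proof. by case: z => a b /=; rewrite mulr0 add0r. Qed.

Lemma line_polynomial_Re Q : line_polynomial (fun x => complex.Re (poly_eval Q x)).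
Proof.
under eq_fun do rewrite poly_evalE raddf_sum/=.
apply: line_polynomial_sum => m.
under eq_fun do rewrite Re_mul_real.
apply: line_polynomialM; first exact: line_polynomial_cst.
apply: line_polynomial_prod => i; apply: line_polynomialX.
exact: line_polynomial_coord.
Qed.

Lemma line_polynomial_Im Q : line_polynomial (fun x => complex.Im (poly_eval Q x)).
Proof.
under eq_fun do rewrite poly_evalE raddf_sum/=.
apply: line_polynomial_sum => m.
under eq_fun do rewrite Im_mul_real.
apply: line_polynomialM; first exact: line_polynomial_cst.
apply: line_polynomial_prod => i; apply: line_polynomialX.
exact: line_polynomial_coord.
Qed.

Lemma digits_inj (N n : nat) (f g : 'I_n -> nat) : (0 < N)%N ->
  (forall i, (f i < N)%N) -> (forall i, (g i < N)%N) ->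
  (\sum_(i < n) f i * N ^ i = \sum_(i < n) g i * N ^ i)%N -> f =1 g.
Proof.
move=> N0; elim: n f g => [|n IHn] f g fN gN; first by move=> _ [].
have shift (h : 'I_n.+1 -> nat) : (\sum_(i < n.+1) h i * N ^ i =
    (\sum_(i < n) h (lift ord0 i) * N ^ i) * N + h ord0)%N.
  rewrite big_ord_recl expn0 muln1 addnC big_distrl; congr addn.
  by apply: eq_bigr => i _; rewrite /= /bump/= add1n expnSr mulnA.
rewrite !shift => fg.
have f0 : f ord0 = g ord0.
  by have := congr1 (modn^~ N) fg; rewrite !modnMDl !modn_small.
have fS : (fun i => f (lift ord0 i)) =1 (fun i => g (lift ord0 i)).
  apply: IHn => //.
  by move: fg; rewrite f0 => /addIn /eqP; rewrite eqn_pmul2r// => /eqP.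
by move=> i; case: (unliftP ord0 i) => [j|] ->; [exact: fS|].
Qed.

(** Kronecker's substitution [x_i = s ^ (N ^ i)], with [N] larger than all the
    exponents, sends distinct monomials to distinct powers of [s]. *)
Lemma poly_eval_neq0 Q : Q != 0 -> exists x, poly_eval Q x != 0.
Proof.
move=> Q0; apply: contrapT => /forallNP Qx.
have [m mQ] : exists m, m \in mpoly.msupp Q.
  have := mpoly.msupp_eq0 Q; case: (mpoly.msupp Q) => [|m s].
    by rewrite eqxx (negbTE Q0).
  by exists m; rewrite mem_head.
pose e (m : mpoly.multinom d) i := mpoly.fun_of_multinom m i.
pose N := (\sum_(m <- mpoly.msupp Q) \sum_(i < d) e m i).+1.
have eN m' i : m' \in mpoly.msupp Q -> (e m' i < N)%N.
  move=> m'Q; rewrite ltnS (big_rem m')//= (bigD1 i)//=.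
  by rewrite -addnA leq_addr.
pose code m := (\sum_(i < d) e m i * N ^ i)%N.
pose p : {poly R[i]} := \sum_(m <- mpoly.msupp Q) mpoly.mcoeff m Q *: 'X^(code m).
have pE (s : R) : p.[s%:C] = 0.
  have /negP/negPn/eqP <- := Qx (\row_i s ^+ (N ^ i)).
  rewrite poly_evalE horner_sum; apply: eq_bigr => m' _.
  rewrite hornerZ hornerXn; congr (_ * _).
  rewrite -rmorphXn; congr (_%:C).
  rewrite /code -prodrXr; apply: eq_bigr => i _.
  by rewrite mxE mulnC exprM.
have p0 : p = 0.
  apply/eqP; apply: contraT => p_neq0.
  have := max_poly_roots p_neq0 (rs := [seq (n%:R : R)%:C | n <- iota 0 (size p)]).
  rewrite size_map size_iota ltnn; apply.
    by apply/allP => _ /mapP[n _ ->]; apply/rootP.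
  rewrite map_inj_uniq ?iota_uniq// => n n' /(@complexI R)/eqP.
  by rewrite eqr_nat => /eqP.
have := congr1 (fun q : {poly R[i]} => q`_(code m)) p0.
rewrite coef0 coef_sum (bigD1_seq m) ?mpoly.msupp_uniq//= big1_seq ?addr0.
  rewrite coefZ coefXn eqxx mulr1 => /eqP; apply/negP.
  by rewrite -mpoly.mcoeff_msupp.
move=> m' /andP[mm' m'Q]; rewrite coefZ coefXn.
case: eqP => [/digits_inj ee|_]; last by rewrite mulr0.
move/eqP: mm'; case; apply/mpoly.mnmP => i; apply/esym.
by apply: ee => // j; exact: eN.
Qed.

(** An exponent [k0] other than 0 makes [Q] a nonconstant function, for
    otherwise [Q - Q(0)] would vanish identically. *)
Lemma poly_eval_nonconstant Q (k0 : mpoly.multinom d) : k0 <> mpoly.mnm0 ->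
  mpoly.mcoeff k0 Q != 0 -> exists x, poly_eval Q x != poly_eval Q 0.
Proof.
move=> k00 Qk0; pose Q' := Q - mpoly.mpolyC d (poly_eval Q 0).
have Q'0 : Q' != 0.
  apply: contraNneq Qk0 => Q'0.
  have := mpoly.mcoeffB k0 Q (mpoly.mpolyC d (poly_eval Q 0)).
  rewrite -/Q' Q'0 mpoly.mcoeff0 mpoly.mcoeffC.
  have /negbTE -> : k0 != mpoly.mnm0 by exact/eqP.
  by rewrite mulr0 subr0 => <-.
have [x Q'x] := poly_eval_neq0 Q'0; exists x; rewrite -subr_eq0.
by move: Q'x; rewrite /Q' /poly_eval mpoly.mevalB mpoly.mevalC.
Qed.

End polynomial_evaluation.

Section positive_mass.
Context {R : realType} {d : nat}.
Notation E := 'rV[R]_d.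
Local Notation leb := (@lebesgue_rV R d).

Lemma ae_line_polynomial_neq0 (F : E -> R) x0 : line_polynomial F ->
  F x0 != 0 -> {ae leb, forall x, F x != 0}.
Proof.
move=> pF Fx0; exists [set x | F x = 0]; split.
- rewrite -[X in measurable X]setTI.
  exact: (pF.1 measurableT [set 0] (measurable_set1 0)).
- exact: (null_zero_set pF Fx0).
- by move=> x /= /negP/negPn/eqP.
Qed.

Lemma real_below (x : \bar R) : (0 < x)%E ->
  exists2 c : R, 0 < c & (c%:E <= x)%E.
Proof.
case: x => [t| |]//; first by rewrite lte_fin => t0; exists t.
by move=> _; exists 1 => //; rewrite leey.
Qed.

(** Otherwise [m * g = 0] almost everywhere, hence [m = 0] almost everywhere. *)
Lemma weighted_integral_gt0 (m : E -> R) (g : E -> \bar R) :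
  measurable_fun setT m -> (forall z, 0 <= m z) ->
  measurable_fun setT g -> (forall z, 0 <= g z)%E ->
  (0 < \int[leb]_z (m z)%:E)%E -> {ae leb, forall z, g z != 0%E} ->
  (0 < \int[leb]_z ((m z)%:E * g z))%E.
Proof.
move=> mm m0 mg g0 mpos gpos.
have mg0 z : (0 <= (m z)%:E * g z)%E by rewrite mule_ge0 ?lee_fin.
have mmE : measurable_fun setT (EFin \o m) by exact/measurable_EFinP.
have mmg : measurable_fun setT (fun z => (m z)%:E * g z)%E by exact: emeasurable_funM.
rewrite lt0e integral_ge0// andbT; apply/eqP => I0.
suff m_ae : (\int[leb]_z (m z)%:E = 0)%E by move: mpos; rewrite m_ae ltxx.
rewrite -[RHS](@integral0 _ _ _ leb setT).
apply: ge0_ae_eq_integral => // [z _|]; first by rewrite lee_fin.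
have : (\int[leb]_z `|(m z)%:E * g z| = 0)%E.
  by rewrite -[RHS]I0; apply: eq_integral => z _; rewrite gee0_abs.
move/(ae_eq_integral_abs leb measurableT mmg) => mg_ae.
apply: filterS2 gpos mg_ae => z gz /(_ I)/eqP; rewrite mule_eq0 (negbTE gz) orbF.
by move=> /eqP.
Qed.

(** Cutting the space into countably many cells of size [r], one of them must
    carry some of the mass of [k2]. *)
Lemma localize_mass (k2 : E -> R) (r : R) : 0 < r ->
  measurable_fun setT k2 -> (forall z, 0 <= k2 z) ->
  (0 < \int[leb]_z (k2 z)%:E)%E ->
  exists m : E -> R, [/\ measurable_fun setT m, (forall z, 0 <= m z <= k2 z),
    (0 < \int[leb]_z (m z)%:E)%E &
    (forall z z', m z != 0 -> m z' != 0 -> box r (z' - z))].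
Proof.
move=> r0 mk2 k2_ge0 k2pos.
pose cell (v : 'rV[int]_d) : set E := [set x | forall i,
  [set` `[(v ord0 i)%:~R * r, (v ord0 i)%:~R * r + r[] (x ord0 i)].
have mcell v : measurable (cell v).
  by apply: (measurable_forall_coord (B := fun i =>
    [set` `[(v ord0 i)%:~R * r, (v ord0 i)%:~R * r + r[])) => i; exact: measurable_itv.
pose c n : set E := if @choice.unpickle 'rV[int]_d n is Some v then cell v else set0.
have mc n : measurable (c n).
  by rewrite /c; case: (choice.unpickle n) => [v|]; [exact: mcell|exact: measurable0].
pose m n (z : E) := k2 z * \1_(c n) z.
have mm n : measurable_fun setT (m n).
  by apply: measurable_funM => //; exact: measurable_indic.
have m0 n z : 0 <= m n z by rewrite mulr_ge0.
have mE n : measurable_fun setT (EFin \o m n) by exact/measurable_EFinP.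
have [n mn] : exists n, (0 < \int[leb]_z (m n z)%:E)%E.
  apply: contrapT => /forallNP mn0.
  suff : (\int[leb]_z (k2 z)%:E = 0)%E by move: k2pos => /[swap] ->; rewrite ltxx.
  rewrite -[RHS](@integral0 _ _ _ leb setT).
  apply: ge0_ae_eq_integral => //.
  - exact/measurable_EFinP.
  - by move=> z _; rewrite lee_fin.
  have zero n : {ae leb, forall z, m n z = 0}.
    have I0 : (\int[leb]_z (m n z)%:E = 0)%E.
      apply/eqP; rewrite eq_le integral_ge0 ?andbT; last first.
        by move=> z _; rewrite lee_fin.
      by rewrite leNgt; apply/negP; exact: mn0.
    have : (\int[leb]_z `|(m n z)%:E| = 0)%E.
      by rewrite -[RHS]I0; apply: eq_integral => z _; rewrite gee0_abs// lee_fin.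
    move/(ae_eq_integral_abs leb measurableT (mE n)).
    by apply: filterS => z /(_ I) [].
  have := ae_foralln zero; apply: filterS => z mz _ /=.
  pose v : 'rV[int]_d := \row_i Num.floor (z ord0 i / r).
  have cz : c (choice.pickle v) z.
    rewrite /c choice.pickleK => i; rewrite /= in_itv/= mxE.
    rewrite -ler_pdivlMr// floor_le/=.
    have := floorD1_gt (z ord0 i / r).
    by rewrite intrD1 ltr_pdivrMr// mulrDl mul1r.
  by have := mz (choice.pickle v); rewrite /m indicE mem_set// mulr1 => ->.
exists (m n); split=> // [z|z z'].
  by rewrite m0/= /m ler_piMr// indicE lern1 leq_b1.
rewrite /m !indicE.
have [|] := boolP (z \in c n); last by rewrite mulr0 eqxx.
have [|] := boolP (z' \in c n); last by rewrite mulr0 eqxx.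
rewrite !inE /c; case: (choice.unpickle n) => [v|//] z'v zv _ _ i.
have := z'v i; have := zv i; rewrite /= !in_itv/= !mxE => /andP[a b] /andP[a' b'].
by rewrite ler_norml; apply/andP; split; lra.
Qed.

End positive_mass.

(** * Quadratic forms bounded below *)

Section quadratic_form.
Context {R : realType} {d : nat}.
Notation E := 'rV[R]_d.
Local Notation leb := (@lebesgue_rV R d).

(** The mean value theorem gives [sin x >= x / 2] near 0, and
    [1 - cos t = 2 sin(t / 2)^2]. *)
Lemma cos_le_quadratic : exists2 t0 : R, 0 < t0 &
  forall t, `|t| <= t0 -> t ^+ 2 / 8 <= 1 - cos t.
Proof.
have [t0 t00 cosP] := @near_cos1 R 2^-1 (ltac:(by rewrite invr_gt0)).
have sinP x : 0 <= x -> x <= t0 -> x / 2 <= sin x.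
  move=> x0 xt.
  have [|c] := @MVT_segment R sin cos 0 x x0.
    by apply: continuous_subspaceT; exact: continuous_sin.
  rewrite in_itv/= => /andP[c0 cx]; rewrite sin0 !subr0 => ->.
  have := cosP c; rewrite ger0_norm// => /(_ (le_trans cx xt)) c2.
  by rewrite mulrC ler_wpM2r//; lra.
exists t0 => // t tt0.
rewrite [in cos t](splitr t) cosD -!expr2.
have -> : t ^+ 2 = `|t| ^+ 2 by rewrite real_normK// num_real.
have := sinP (`|t| / 2); rewrite divr_ge0// => /(_ isT).
have h : `|t| / 2 <= t0 by apply: le_trans tt0; rewrite ler_pdivrMr// ler_peMr// ler1n.
move=> /(_ h) s2; have := cos2Dsin2 (t / 2).
have -> : sin (t / 2) ^+ 2 = sin (`|t| / 2) ^+ 2.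
  have [t_ge0|t_lt0] := lerP 0 t; first by rewrite ger0_norm.
  by rewrite ltr0_norm// mulNr sinN sqrrN.
have := normr_ge0 t; nra.
Qed.

Lemma second_moment_form (m : E -> R) (M : R) : measurable_fun setT m ->
  (forall z, 0 <= m z) -> leb.-integrable setT (EFin \o m) ->
  (forall z, m z != 0 -> box M z) ->
  exists S : 'I_d * 'I_d -> R, forall u,
  (\int[leb]_z ((dot u z) ^+ 2 * m z)%:E =
   (\sum_p u ord0 p.1 * u ord0 p.2 * S p)%:E)%E.
Proof.
move=> mm m0 im mM.
pose f (p : 'I_d * 'I_d) (z : E) := z ord0 p.1 * z ord0 p.2 * m z.
have If p : leb.-integrable setT (EFin \o f p).
  apply: (@le_integrable _ _ _ leb setT measurableT _ (EFin \o (fun z => M ^+ 2 * m z))).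
  - apply/measurable_EFinP; apply: measurable_funM => //.
    by apply: measurable_funM; exact: measurable_coord.
  - move=> z _ /=; rewrite lee_fin /f.
    have [->|/mM zM] := eqVneq (m z) 0; first by rewrite !mulr0.
    rewrite normrM [leRHS]normrM ler_wpM2r// normrM normrX expr2.
    by apply: ler_pM => //; apply: le_trans (zM _) (ler_norm _).
  - exact: integrableZ_EFin.
exists (fun p => \int[leb]_z f p z) => u.
pose F p z : \bar R := (u ord0 p.1 * u ord0 p.2 * f p z)%:E.
transitivity (\int[leb]_z \sum_p F p z)%E.
  apply: eq_integral => z _; rewrite /F sumEFin; congr EFin.
  rewrite expr2 /dot big_distrlr/= pair_big/= mulr_suml; apply: eq_bigr => p _.
  by rewrite /f; ring.
rewrite integral_sum//; last by move=> p; exact: integrableZ_EFin.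
rewrite -sumEFin; apply: eq_bigr => p _.
rewrite /F -[LHS]fineK; last by apply: integrable_fin_num => //; exact: integrableZ_EFin.
by rewrite -[fine _]/(\int[leb]_z _) RintegralZl.
Qed.

(** A positive definite quadratic form dominates the squared norm, by
    compactness of the unit sphere.  Definiteness holds because a hyperplane is
    a null set, so that it cannot carry all the mass of [m]. *)
Lemma second_moment_definite (m : E -> R) (M : R) : measurable_fun setT m ->
  (forall z, 0 <= m z) -> leb.-integrable setT (EFin \o m) ->
  (forall z, m z != 0 -> box M z) -> (0 < \int[leb]_z (m z)%:E)%E ->
  exists2 c : R, 0 < c & forall (u : E) i,
  ((c * u ord0 i ^+ 2)%:E <= \int[leb]_z ((dot u z) ^+ 2 * m z)%:E)%E.
Proof.
move=> mm m0 im mM mpos; have [S SE] := second_moment_form mm m0 im mM.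
pose q (u : E) := \sum_p u ord0 p.1 * u ord0 p.2 * S p.
have qZ a u : q (a *: u) = a ^+ 2 * q u.
  by rewrite /q mulr_sumr; apply: eq_bigr => p _; rewrite !mxE; ring.
have [ne|e] := pselect ([set u : E | `|u| = 1] !=set0); last first.
  exists 1 => // u i; suff -> : u ord0 i = 0.
    rewrite expr0n mulr0; apply: integral_ge0 => z _.
    by rewrite lee_fin mulr_ge0// sqr_ge0.
  have [u0|u0] := eqVneq u 0; first by rewrite u0 mxE.
  case: e; exists (`|u|^-1 *: u) => /=.
  by rewrite normrZ normfV normr_id mulVf// normr_eq0.
have cS : compact [set u : E | `|u| = 1].
  apply: bounded_closed_compact.
    exists 1; split; first exact: num_real.
    by move=> x x1 u /= ->; exact: ltW.
  rewrite (_ : [set u : E | _] = Num.norm @^-1` [set 1])//.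
  apply: preimage_closed; last exact: closed_eq.
  by move=> x _; exact: norm_continuous.
have cq : continuous q.
  apply: continuous_big => [|p _ u]; first exact: add_continuous.
  apply: (@continuousM _ _ (fun u : E => u ord0 p.1 * u ord0 p.2) (fun=> S p) u).
    apply: (@continuousM _ _ (fun u : E => u ord0 p.1) (fun u : E => u ord0 p.2) u);
      exact: coord_continuous.
  exact: cst_continuous.
have [u0 /set_mem /= u01 u0min] := EVT_min_rV ne cS (continuous_subspaceT cq).
have q0 : 0 < q u0.
  rewrite -lte_fin -SE.
  under eq_integral do rewrite mulrC EFinM.
  have pd : line_polynomial (fun z => dot u0 z ^+ 2).
    apply: line_polynomialX; apply: line_polynomial_sum => i.
    by apply: line_polynomialM; [exact: line_polynomial_cst|exact: line_polynomial_coord].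
  apply: weighted_integral_gt0 => //.
  - by apply/measurable_EFinP; exact: pd.1.
  - by move=> z; rewrite lee_fin sqr_ge0.
  have u0z : dot u0 u0 ^+ 2 != 0.
    rewrite sqrf_eq0 /dot psumr_eq0; last by move=> i _; rewrite -expr2 sqr_ge0.
    apply/negP => /allP u00; move: u01.
    suff -> : u0 = 0 by rewrite normr0 => /eqP; rewrite eq_sym oner_eq0.
    apply/rowP => i; have := u00 i; rewrite mem_index_enum => /(_ isT)/=.
    by rewrite -expr2 sqrf_eq0 mxE => /eqP.
  by apply: filterS (ae_line_polynomial_neq0 pd u0z) => z; rewrite eqe.
exists (q u0) => // u i; rewrite SE lee_fin -/(q u).
have [->|u_neq0] := eqVneq u 0.
  by have := qZ 0 0; rewrite scale0r expr0n mul0r => ->; rewrite mxE expr0n mulr0.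
have nu : 0 < `|u| by rewrite normr_gt0.
have uE : u = `|u| *: (`|u|^-1 *: u) by rewrite scalerA divff ?gt_eqF// scale1r.
rewrite uE qZ mulrC -uE; apply: ler_pM.
- exact: sqr_ge0.
- exact: ltW.
- rewrite -(real_normK (num_real (u ord0 i))) ler_sqr ?nnegrE//.
  exact: norm_coord_le.
apply: u0min; rewrite inE /=.
by rewrite normrZ normfV normr_id mulVf// gt_eqF.
Qed.

End quadratic_form.

(** * Complex linear statistics and rigidity *)

Section complex_statistics.
Context {R : realType} {d : nat}.
Notation E := 'rV[R]_d.
Context {disp : measure_display} {Om : measurableType disp}.
Variables (P : probability Om R) (Phi : Om -> set E).
Hypothesis Phi_spp : simple_point_process Phi.
Local Notation Var f := ('V_P[rstat Phi f])%E.
Implicit Types (Q : mpoly.mpoly d R[i]) (A : set E) (g h : E -> R[i]).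

Lemma complex_eq0 (z : R[i]) : complex.Re z = 0 -> complex.Im z = 0 -> z = 0.
Proof. by case: z => a b /= -> ->. Qed.

Definition complex_test_function g :=
  test_function (fun x => complex.Re (g x)) /\
  test_function (fun x => complex.Im (g x)).

Lemma complex_test_function_out g : complex_test_function g ->
  exists N, forall x, ~ box N x -> g x = 0.
Proof.
move=> [[_ _ [N gN]] [_ _ [N' gN']]]; exists (Num.max N N') => x Nx.
by apply: complex_eq0; [apply: gN|apply: gN'] => xN; apply: Nx;
  apply: box_subset xN; rewrite le_max lexx ?orbT.
Qed.

Lemma Re_linear_statistic g w : complex_test_function g ->
  complex.Re (linear_statistic Phi g w) = rstat Phi (fun x => complex.Re (g x)) w.
Proof.
move=> /complex_test_function_out[N gN].
rewrite /linear_statistic /rstat !(fsum_points Phi_spp (N := N))//.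
  by rewrite raddf_sum.
by move=> x /gN ->.
Qed.

Lemma Im_linear_statistic g w : complex_test_function g ->
  complex.Im (linear_statistic Phi g w) = rstat Phi (fun x => complex.Im (g x)) w.
Proof.
move=> /complex_test_function_out[N gN].
rewrite /linear_statistic /rstat !(fsum_points Phi_spp (N := N))//.
  by rewrite raddf_sum.
by move=> x /gN ->.
Qed.

Lemma Cvariance_linear_statistic g h :
  complex_test_function g -> complex_test_function h ->
  Cvariance P (fun w => linear_statistic Phi g w - linear_statistic Phi h w) =
  (Var (fun x => complex.Re (g x) - complex.Re (h x))%R +
   Var (fun x => complex.Im (g x) - complex.Im (h x))%R)%E.
Proof.
move=> tg th; have [tg1 tg2] := tg; have [th1 th2] := th.
congr (variance P _ + variance P _)%E; apply/funext => w.
  by rewrite rstatB// -!Re_linear_statistic// raddfB.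
by rewrite rstatB// -!Im_linear_statistic// raddfB.
Qed.

Lemma ler_Re_modulus (z : R[i]) : `|complex.Re z| <= modulus z.
Proof.
by case: z => a b; rewrite -sqrtr_sqr /modulus/= ler_wsqrtr// lerDl sqr_ge0.
Qed.

Lemma ler_Im_modulus (z : R[i]) : `|complex.Im z| <= modulus z.
Proof.
by case: z => a b; rewrite -sqrtr_sqr /modulus/= ler_wsqrtr// lerDr sqr_ge0.
Qed.

Lemma exterior_complex_test A h : exterior_test_function A h ->
  complex_test_function h.
Proof.
move=> [[m1 m2] [M hM] [C cC hC] _]; have [N _ CN] := compact_sub_box cC.
split; split => //.
- by exists M => x; apply: le_trans (ler_Re_modulus _) (hM x).
- by exists N => x Nx; rewrite hC// => /CN.
- by exists M => x; apply: le_trans (ler_Im_modulus _) (hM x).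
- by exists N => x Nx; rewrite hC// => /CN.
Qed.

Lemma continuous_monomial_sum (s : seq (mpoly.multinom d)) (c : mpoly.multinom d -> R) :
  continuous (fun x : E => \sum_(m <- s) c m *
    \prod_(i < d) x ord0 i ^+ mpoly.fun_of_multinom m i).
Proof.
apply: continuous_big => [|m _ x]; first exact: add_continuous.
apply: (@continuousM _ _ (fun=> c m) (fun x : E => \prod_(i < d) x ord0 i ^+ mpoly.fun_of_multinom m i) x).
  exact: cst_continuous.
apply: continuous_big => [|i _ y]; first exact: mul_continuous.
apply: (@continuous_comp _ _ _ (fun y : E => y ord0 i) (fun t : R => t ^+ _)).
  exact: coord_continuous.
exact: exprn_continuous.
Qed.

Lemma continuous_Re_poly Q : continuous (fun x : E => complex.Re (poly_eval Q x)).
Proof.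
rewrite (_ : (fun _ => _) = fun x : E => \sum_(m <- mpoly.msupp Q)
    complex.Re (mpoly.mcoeff m Q) *
    \prod_(i < d) x ord0 i ^+ mpoly.fun_of_multinom m i).
  exact: continuous_monomial_sum.
apply/funext => x; rewrite poly_evalE raddf_sum/=; apply: eq_bigr => m _.
exact: Re_mul_real.
Qed.

Lemma continuous_Im_poly Q : continuous (fun x : E => complex.Im (poly_eval Q x)).
Proof.
rewrite (_ : (fun _ => _) = fun x : E => \sum_(m <- mpoly.msupp Q)
    complex.Im (mpoly.mcoeff m Q) *
    \prod_(i < d) x ord0 i ^+ mpoly.fun_of_multinom m i).
  exact: continuous_monomial_sum.
apply/funext => x; rewrite poly_evalE raddf_sum/=; apply: eq_bigr => m _.
exact: Im_mul_real.
Qed.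

Lemma test_function_restrict (f : E -> R) A : compact A -> continuous f ->
  measurable_fun setT f -> test_function (fun x => \1_A x * f x).
Proof.
move=> cA cf mf; have mA := measurable_compact_rV cA.
have [N _ AN] := compact_sub_box cA.
split.
- by apply: measurable_funM => //; exact: measurable_indic.
- have [A0|A0] := pselect (A !=set0); last first.
    exists 0 => x; rewrite indicE memNset ?mul0r ?normr0// => Ax.
    by apply: A0; exists x.
  have cn : continuous (fun x => `|f x|).
    move=> x; apply: (@continuous_comp _ _ _ f Num.norm); first exact: cf.
    exact: norm_continuous.
  have [a _ aM] := EVT_max_rV A0 cA (continuous_subspaceT cn).
  exists `|f a| => x; rewrite indicE normrM.
  have [xA|_] := boolP (x \in A); last by rewrite normr0 mul0r.
  by rewrite normr1 mul1r aM.
- by exists N => x Nx; rewrite indicE memNset ?mul0r// => /AN.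
Qed.

Lemma restrict_poly_test Q A : compact A ->
  complex_test_function (patch (fun=> 0) A (poly_eval Q)).
Proof.
move=> cA; split.
  rewrite (_ : (fun _ => _) = fun x => \1_A x * complex.Re (poly_eval Q x)).
    apply: test_function_restrict => //; first exact: continuous_Re_poly.
    exact: (line_polynomial_Re Q).1.
  by apply/funext => x; rewrite /patch indicE; case: ifP => _; rewrite ?mul1r ?mul0r.
rewrite (_ : (fun _ => _) = fun x => \1_A x * complex.Im (poly_eval Q x)).
  apply: test_function_restrict => //; first exact: continuous_Im_poly.
  exact: (line_polynomial_Im Q).1.
by apply/funext => x; rewrite /patch indicE; case: ifP => _; rewrite ?mul1r ?mul0r.
Qed.

(** Competitors [h] vanish on [A], so that the real and imaginary parts of
    [Q 1_A - h] range over test functions that are prescribed on [A]. *)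
Lemma not_rigid_lower_bound Q A (c : R) : compact A -> 0 < c ->
  (forall f g : E -> R, test_function f -> test_function g ->
     (forall x, A x -> f x = complex.Re (poly_eval Q x)) ->
     (forall x, A x -> g x = complex.Im (poly_eval Q x)) ->
     (c%:E <= Var f + Var g)%E) ->
  ~ linearly_rigid P Phi Q A.
Proof.
move=> cA c0 cV; rewrite /linearly_rigid => inf0.
have : (c%:E <= 0 :> \bar R)%E.
  rewrite -inf0; apply: le_ereal_inf_tmp => _ [h hA <-].
  have [tr ti] := restrict_poly_test Q cA.
  have th := exterior_complex_test hA; have [thr thi] := th.
  rewrite Cvariance_linear_statistic//.
  have [_ _ _ h0] := hA.
  apply: cV; [exact: test_functionB|exact: test_functionB| |] => x Ax.
    by rewrite h0// subr0 /patch mem_set.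
  by rewrite h0// subr0 /patch mem_set.
by rewrite lee_fin leNgt c0.
Qed.

Lemma rigid_approx Q A : compact A ->
  (forall x, A x -> poly_eval Q x = 1) ->
  (forall e : R, 0 < e -> exists h : E -> R, [/\ test_function h,
    (forall x, A x -> h x = 0) &
    (Var (fun x => (\1_A x - h x)%R) <= e%:E)%E]) ->
  linearly_rigid P Phi Q A.
Proof.
move=> cA Q1 app; rewrite /linearly_rigid; apply/eqP; rewrite eq_le.
apply/andP; split; last first.
  by apply: le_ereal_inf_tmp => _ [h _ <-]; rewrite adde_ge0// variance_ge0.
apply/lee_addgt0Pr => e /app[h [th hA hV]]; rewrite add0e.
apply: le_trans hV.
have [mh [M hM] [N hN]] := th.
have t0 : test_function (fun _ : E => 0 : R).
  split=> //; first by exists 0 => x; rewrite normr0.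
  by exists 0.
have extA : exterior_test_function A (fun x => (h x)%:C).
  split.
  - by split=> //=; exact: measurable_cst.
  - exists M => x; apply: le_trans (hM x).
    by rewrite /modulus/= expr0n addr0 sqrtr_sqr.
  - by exists (box N); [exact: box_compact|move=> x /hN ->].
  - by move=> x /hA ->.
apply: (@le_trans _ _ (Cvariance P (fun w =>
    linear_statistic Phi (patch (fun=> 0) A (poly_eval Q)) w -
    linear_statistic Phi (fun x => (h x)%:C) w))).
  by apply: ereal_inf_lbound; exists (fun x => (h x)%:C).
rewrite Cvariance_linear_statistic; last 2 first.
- exact: restrict_poly_test.
- exact: (exterior_complex_test extA).
have pE x : patch (fun=> 0) A (poly_eval Q) x = (\1_A x)%:C.
  rewrite /patch indicE; case: ifPn => [|_]; last by [].
  by rewrite inE => /Q1.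
under [X in ('V_P[rstat Phi X] + _ <= _)%E]eq_fun do rewrite pE/=.
under [X in (_ + 'V_P[rstat Phi X] <= _)%E]eq_fun do rewrite pE/= subr0.
rewrite (_ : rstat Phi (fun=> 0) = cst 0).
  by rewrite variance_cst adde0.
by apply/funext => w; rewrite /rstat fsbig1.
Qed.

End complex_statistics.

Section determinantal_process.
Context {R : realType} {d : nat}.
Notation E := 'rV[R]_d.
Local Notation leb := (@lebesgue_rV R d).
Context {disp : measure_display} {Om : measurableType disp}.
Variables (P : probability Om R) (Phi : Om -> set E) (k2 : E -> R).
Hypothesis Phi_spp : simple_point_process Phi.
Hypotheses (rho1 : correlation_function P Phi (fun t : 1.-tuple E => 1))
  (rho2 : correlation_function P Phi
     (fun t : 2.-tuple E => 1 - k2 (tnth t ord_max - tnth t ord0))).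
Hypotheses (mk2 : measurable_fun setT k2) (k2_ge0 : forall z, 0 <= k2 z)
  (k2_le1 : forall z, k2 z <= 1).
Hypothesis k2_even : forall z, k2 (- z) = k2 z.
Local Notation Var f := ('V_P[rstat Phi f])%E.

(** * The variance as a Dirichlet form *)

Lemma measurable_k2B {disp'} {T : measurableType disp'} (f g : T -> E) :
  measurable_fun setT f -> measurable_fun setT g ->
  measurable_fun setT (fun x => k2 (f x - g x)).
Proof.
by move=> mf mg; apply: measurableT_comp => //; exact: measurable_funrVB.
Qed.

Lemma measurable_k2Br (x : E) : measurable_fun setT (fun y : E => k2 (y - x)).
Proof. exact: (measurable_k2B (@measurable_id _ _ setT) (measurable_cst x)). Qed.

Lemma measurable_k2Bl (y : E) : measurable_fun setT (fun x : E => k2 (y - x)).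
Proof. exact: (measurable_k2B (measurable_cst y) (@measurable_id _ _ setT)). Qed.

Section jump_energy.
Local Open Scope ereal_scope.

(** The measure [k2(y - x) dx dy] of the pairs of positions before and after a
    jump; all the quadratic expressions in [f] are integrals against it. *)
Definition energy (g : E * E -> R) : \bar R :=
  \int[leb \x leb]_p (g p * k2 (p.2 - p.1)%R)%:E.

Lemma measurable_k2_diff :
  measurable_fun setT (fun p : E * E => k2 (p.2 - p.1)%R).
Proof.
by apply: measurableT_comp => //;
  exact: (measurable_funrVB measurable_snd measurable_fst).
Qed.

Lemma measurable_energy_fun (g : E * E -> R) : measurable_fun setT g ->
  measurable_fun setT (fun p => (g p * k2 (p.2 - p.1)%R)%:E).
Proof.
by move=> mg; apply/measurable_EFinP; apply: measurable_funM => //;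
  exact: measurable_k2_diff.
Qed.

Lemma energyD (g h : E * E -> R) : measurable_fun setT g -> measurable_fun setT h ->
  (forall p, 0 <= g p)%R -> (forall p, 0 <= h p)%R ->
  energy (g \+ h)%R = energy g + energy h.
Proof.
move=> mg mh g0 h0; rewrite /energy -ge0_integralD//.
- by apply: eq_integral => p _; rewrite /= mulrDl EFinD.
- by move=> p _; rewrite lee_fin mulr_ge0.
- exact: measurable_energy_fun.
- by move=> p _; rewrite lee_fin mulr_ge0.
- exact: measurable_energy_fun.
Qed.

Lemma energyZ (c : R) (g : E * E -> R) : measurable_fun setT g ->
  (forall p, 0 <= g p)%R -> (0 <= c)%R ->
  energy (fun p => c * g p)%R = c%:E * energy g.
Proof.
move=> mg g0 c0; rewrite /energy -ge0_integralZl_EFin//.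
- by apply: eq_integral => p _; rewrite -EFinM mulrA.
- by move=> p _; rewrite lee_fin mulr_ge0.
- exact: measurable_energy_fun.
Qed.

Lemma energy_ge0 (g : E * E -> R) : (forall p, 0 <= g p)%R -> 0 <= energy g.
Proof. by move=> g0; apply: integral_ge0 => p _; rewrite lee_fin mulr_ge0. Qed.

Lemma le_energy (g h : E * E -> R) : measurable_fun setT g -> measurable_fun setT h ->
  (forall p, 0 <= g p)%R -> (forall p, g p <= h p)%R -> energy g <= energy h.
Proof.
move=> mg mh g0 gh; apply: ge0_le_integral => //.
- by move=> p _; rewrite lee_fin mulr_ge0.
- exact: measurable_energy_fun.
- exact: measurable_energy_fun.
- by move=> p _; rewrite lee_fin ler_wpM2r.
Qed.

Lemma energyE (g : E * E -> R) : measurable_fun setT g -> (forall p, 0 <= g p)%R ->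
  energy g = \int[leb]_x \int[leb]_y (g (x, y) * k2 (y - x)%R)%:E.
Proof.
move=> mg g0; rewrite /energy fubini_tonelli1//.
- exact: measurable_energy_fun.
- by move=> p; rewrite lee_fin mulr_ge0.
Qed.

Lemma energyE2 (g : E * E -> R) : measurable_fun setT g -> (forall p, 0 <= g p)%R ->
  energy g = \int[leb]_y \int[leb]_x (g (x, y) * k2 (y - x)%R)%:E.
Proof.
move=> mg g0; rewrite /energy fubini_tonelli2//.
- exact: measurable_energy_fun.
- by move=> p; rewrite lee_fin mulr_ge0.
Qed.

Lemma measurable_Ek2 : measurable_fun setT (EFin \o k2).
Proof. exact/measurable_EFinP. Qed.

Lemma energy_fst (f : E -> R) : measurable_fun setT f -> (forall x, 0 <= f x)%R ->
  energy (f \o fst) = (\int[leb]_z (k2 z)%:E) * \int[leb]_x (f x)%:E.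
Proof.
move=> mf f0; rewrite energyE => [|//|p]; last exact: f0.
  rewrite -ge0_integralZl//; last 3 first.
  - exact/measurable_EFinP.
  - by move=> x _; rewrite lee_fin.
  - by apply: integral_ge0 => z _; rewrite lee_fin.
  apply: eq_integral => x _ /=.
  under eq_integral do rewrite EFinM.
  rewrite ge0_integralZl_EFin//; last 2 first.
  - by move=> y _; rewrite lee_fin.
  - by apply/measurable_EFinP; exact: measurable_k2Br.
  rewrite (integral_rV_transl (- x) (F := EFin \o k2))//; last first.
    exact: measurable_Ek2.
  by rewrite muleC.
exact: (measurableT_comp mf measurable_fst).
Qed.

Lemma energy_snd (f : E -> R) : measurable_fun setT f -> (forall x, 0 <= f x)%R ->
  energy (f \o snd) = (\int[leb]_z (k2 z)%:E) * \int[leb]_x (f x)%:E.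
Proof.
move=> mf f0; rewrite energyE2 => [|//|p]; last exact: f0.
  rewrite -ge0_integralZl//; last 3 first.
  - exact/measurable_EFinP.
  - by move=> x _; rewrite lee_fin.
  - by apply: integral_ge0 => z _; rewrite lee_fin.
  apply: eq_integral => y _ /=.
  under eq_integral do rewrite EFinM.
  rewrite ge0_integralZl_EFin//; last 2 first.
  - by move=> x _; rewrite lee_fin.
  - by apply/measurable_EFinP; exact: measurable_k2Bl.
  rewrite (integral_rV_refl y (F := EFin \o k2))//; last first.
    exact: measurable_Ek2.
  by rewrite muleC.
exact: (measurableT_comp mf measurable_snd).
Qed.

End jump_energy.

Lemma expectation_rstat f : test_function f -> (forall x, 0 <= f x) ->
  (\int[P]_w (rstat Phi f w)%:E = \int[leb]_x (f x)%:E)%E.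
Proof.
move=> tf f0; have [mf _ _] := tf.
have mF : measurable_fun [set: 1.-tuple E] (fun t => (f (thead t))%:E).
  by apply/measurable_EFinP; apply: measurableT_comp => //; exact: measurable_tnth.
have := rho1.2 (fun t : 1.-tuple E => (f (thead t))%:E) mF
  (fun t => f0 _).
rewrite ge0_integral_tupleS; last 2 first.
- by under eq_fun do rewrite mule1.
- by move=> t; rewrite mule1 lee_fin.
under [in X in _ = X -> _]eq_integral => x _ do
  rewrite integral_tuple0 mule1 theadE.
move=> <-; apply: eq_integral => w _; rewrite -esum_rstat//.
apply/esym/(@reindex_esum _ _ _ _ _ (fun x : E => [tuple x])
  (fun t => (f (thead t))%:E)).
split.
- by move=> x Px; split => // i; rewrite (ord1 i).
- by move=> x y _ _ /= [].
- move=> t [_ Pt]; exists (thead t); first exact: (Pt ord0).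
  by rewrite [RHS]tuple_eta; apply: val_inj => /=; case: t {Pt} => -[|? []].
Qed.

(** The square of a statistic is a diagonal sum plus a sum over pairs of distinct
    points, to which the first two correlation functions apply. *)
Lemma expectation_rstat_sqr f : test_function f -> (forall x, 0 <= f x) ->
  (\int[P]_w (rstat Phi f w ^+ 2)%:E +
     \int[leb]_x \int[leb]_y (f x * f y * k2 (y - x))%:E =
   \int[leb]_x (f x ^+ 2)%:E + (\int[leb]_x (f x)%:E) ^+ 2)%E.
Proof.
move=> tf f0; have [mf _ _] := tf.
have tff := test_functionM tf tf.
have f0' x : 0 <= (f \* f) x by rewrite mulr_ge0.
have mff : measurable_fun [set: E * E] (fun p => f p.1 * f p.2).
  by apply: measurable_funM;
    [exact: (measurableT_comp mf measurable_fst)|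
     exact: (measurableT_comp mf measurable_snd)].
have mkk : measurable_fun [set: E * E] (fun p => k2 (p.2 - p.1)).
  exact: (measurable_k2B measurable_snd measurable_fst).
have ff0 x y : 0 <= f x * f y by rewrite mulr_ge0.
pose e w := (\esum_(t in [set t : 2.-tuple E | uniq t /\
  forall i, Phi w (tnth t i)]) (f (tnth t ord0) * f (tnth t ord_max))%:E)%E.
have Ee : (\int[P]_w e w =
    \int[leb]_x \int[leb]_y (f x * f y * (1 - k2 (y - x)))%:E)%E.
  rewrite /e.
  have mF : measurable_fun [set: 2.-tuple E]
      (fun t => (f (tnth t ord0) * f (tnth t ord_max))%:E).
    apply/measurable_EFinP; apply: measurable_funM;
    by apply: measurableT_comp => //; exact: measurable_tnth.
  rewrite (rho2.2 _ mF); last by move=> t; rewrite lee_fin.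
  rewrite ge0_integral_tupleS; last 2 first.
  - apply: emeasurable_funM => //; apply/measurable_EFinP.
    apply: measurable_funB => //.
    by apply: measurable_k2B; exact: measurable_tnth.
  - by move=> t; rewrite mule_ge0 ?lee_fin// subr_ge0.
  have mc : measurable_fun [set: E * 1.-tuple E]
      (fun p : E * 1.-tuple E => [tuple of p.1 :: p.2]).
    exact: measurable_tuple_cons.
  apply: eq_integral => x _; rewrite ge0_integral_tupleS; last 2 first.
  - have mcx := measurableT_comp mc (pair1_measurable x).
    apply: emeasurable_funM; first exact: (measurableT_comp mF mcx).
    apply/measurable_EFinP; apply: measurable_funB => //.
    apply: measurable_k2B; exact: (measurableT_comp (measurable_tnth _) mcx).
  - by move=> t; rewrite mule_ge0 ?lee_fin// subr_ge0.
  apply: eq_integral => y _; by rewrite integral_tuple0.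
have se w : ((rstat Phi f w ^+ 2)%:E = (rstat Phi (f \* f) w)%:E + e w)%E.
  exact: rstat_sqr.
have ms := measurable_rstat_ge0 Phi_spp tf f0.
have mss := measurable_rstat_ge0 Phi_spp tff f0'.
have me : measurable_fun setT e.
  rewrite (_ : e = fun w => (rstat Phi f w ^+ 2 - rstat Phi (f \* f) w)%:E).
    by apply/measurable_EFinP; apply: measurable_funB => //; exact: measurable_funX.
  by apply/funext => w; rewrite EFinB se addeAC subee// add0e.
under eq_integral do rewrite se.
rewrite ge0_integralD//=; last 3 first.
- by move=> w _; rewrite -esum_rstat//; apply: esum_ge0 => *; rewrite lee_fin.
- exact/measurable_EFinP.
- by move=> w _; apply: esum_ge0 => *; rewrite lee_fin.
rewrite expectation_rstat// Ee -addeA; congr (_ + _)%E.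
have sec (g : E * E -> R) x : measurable_fun setT g ->
    measurable_fun setT (fun y => (g (x, y))%:E).
  by move=> mg; apply/measurable_EFinP; exact: (measurableT_comp mg (pair1_measurable x)).
have mg1 : measurable_fun [set: E * E] (fun p => f p.1 * f p.2 * (1 - k2 (p.2 - p.1))).
  by apply: measurable_funM => //; exact: measurable_funB.
have mg2 : measurable_fun [set: E * E] (fun p => f p.1 * f p.2 * k2 (p.2 - p.1)).
  by apply: measurable_funM.
have g1 x y : (0 <= (f x * f y * (1 - k2 (y - x)))%:E)%E.
  by rewrite lee_fin mulr_ge0// subr_ge0.
have g2 x y : (0 <= (f x * f y * k2 (y - x))%:E)%E.
  by rewrite lee_fin mulr_ge0.
rewrite -ge0_integralD//=; last 4 first.
- by move=> x _; exact: integral_ge0.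
- by apply: (measurable_fun_fubini_tonelli_F (fun p : E * E => (f p.1 * f p.2 * (1 - k2 (p.2 - p.1)))%:E)) => [|p];
    [exact/measurable_EFinP|exact: g1].
- by move=> x _; exact: integral_ge0.
- by apply: (measurable_fun_fubini_tonelli_F (fun p : E * E => (f p.1 * f p.2 * k2 (p.2 - p.1))%:E)) => [|p];
    [exact/measurable_EFinP|exact: g2].
rewrite -ge0_integralZl//; last 3 first.
- exact/measurable_EFinP.
- by move=> x _; rewrite lee_fin.
- by apply: integral_ge0 => x _; rewrite lee_fin.
apply: eq_integral => x _.
rewrite -ge0_integralD//; last 2 first.
- exact: (sec _ x mg1).
- exact: (sec _ x mg2).
rewrite -ge0_integralZr//; last 3 first.
- exact/measurable_EFinP.
- by move=> y _; rewrite lee_fin.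
- by rewrite lee_fin.
apply: eq_integral => y _; rewrite -EFinD -EFinM; congr EFin; ring.
Qed.

Lemma integral_test_lty (f : E -> R) : test_function f ->
  (\int[leb]_x (`|f x|)%:E < +oo)%E.
Proof.
move=> [mf [M fM] [N fN]].
apply: (@le_lt_trans _ _ (\int[leb]_x (M%:E * (\1_(box N) x)%:E))%E).
  apply: ge0_le_integral => //.
  - by apply/measurable_EFinP; exact: measurableT_comp.
  - apply: emeasurable_funM => //; apply/measurable_EFinP.
    by apply: measurable_indic; exact: measurable_box.
  - move=> x _; rewrite -EFinM lee_fin indicE.
    have [xN|] := boolP (x \in box N); first by rewrite mulr1.
    by rewrite notin_setE => /fN ->; rewrite normr0 mulr0.
rewrite ge0_integralZl_EFin//=; last 2 first.
- by apply/measurable_EFinP; apply: measurable_indic; exact: measurable_box.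
- by apply: le_trans (fM 0).
rewrite integral_indic ?setIT//=; last exact: measurable_box.
apply: lte_mul_pinfty => //; last exact: lebesgue_box_lty.
by rewrite lee_fin; apply: le_trans (fM 0).
Qed.

Lemma integral_sqr_test (f : E -> R) : test_function f ->
  exists2 s : R, 0 <= s & (\int[leb]_x (f x ^+ 2)%:E = s%:E)%E.
Proof.
move=> tf; have s0 : (0 <= \int[leb]_x (f x ^+ 2)%:E)%E.
  by apply: integral_ge0 => x _; rewrite lee_fin sqr_ge0.
have := integral_test_lty (test_functionM tf tf).
under eq_integral do rewrite /= -expr2 ger0_norm ?sqr_ge0//.
move=> sy; exists (fine (\int[leb]_x (f x ^+ 2)%:E)%E); first exact: fine_ge0.
by rewrite fineK// ge0_fin_numE.
Qed.

Lemma measurable_fxfy (f : E -> R) : measurable_fun setT f ->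
  measurable_fun setT (fun p : E * E => f p.1 * f p.2).
Proof.
by move=> mf; apply: measurable_funM;
  [exact: (measurableT_comp mf measurable_fst)|
   exact: (measurableT_comp mf measurable_snd)].
Qed.

Lemma rstat_L2_ge0 (f : E -> R) : test_function f -> (forall x, 0 <= f x) ->
  rstat Phi f \in Lfun P 2%:E.
Proof.
move=> tf f0; apply: Lfun2_sqr; first exact: measurable_rstat_ge0.
have := expectation_rstat_sqr tf f0.
have [s _ ->] := integral_sqr_test tf.
have := integral_test_lty tf; under eq_integral do rewrite ger0_norm//.
move=> my H; have : (\int[P]_w (rstat Phi f w ^+ 2)%:E <=
    s%:E + (\int[leb]_x (f x)%:E) ^+ 2)%E.
  rewrite -H leeDl//; apply: integral_ge0 => x _; apply: integral_ge0 => y _.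
  by rewrite lee_fin !mulr_ge0.
move/le_lt_trans; apply; rewrite lte_add_pinfty ?ltry//.
have m0 : (0 <= \int[leb]_x (f x)%:E)%E.
  by apply: integral_ge0 => x _; rewrite lee_fin.
by apply: lte_mul_pinfty => //; rewrite ge0_fin_numE.
Qed.

Lemma variance_rstat_ge0 (f : E -> R) : test_function f -> (forall x, 0 <= f x) ->
  (Var f + energy (fun p => f p.1 * f p.2)%R = \int[leb]_x (f x ^+ 2)%:E)%E.
Proof.
move=> tf f0; have X2 := rstat_L2_ge0 tf f0; have [mf _ _] := tf.
have H := expectation_rstat_sqr tf f0.
rewrite varianceE// !unlock.
rewrite (expectation_rstat tf f0).
have m0 : (0 <= \int[leb]_x (f x)%:E)%E.
  by apply: integral_ge0 => x _; rewrite lee_fin.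
have [m mE] : exists m, (\int[leb]_x (f x)%:E = m%:E)%E.
  exists (fine (\int[leb]_x (f x)%:E))%E; rewrite fineK// ge0_fin_numE//.
  by have := integral_test_lty tf; under eq_integral do rewrite ger0_norm//.
rewrite energyE//=; last 2 first.
- exact: measurable_fxfy.
- by move=> p; rewrite mulr_ge0.
move: H; rewrite mE -EFin_expe => H.
rewrite addeAC; have -> : (\int[P]_w ((rstat Phi f ^+ 2) w)%:E =
    \int[P]_w (rstat Phi f w ^+ 2)%:E)%E by [].
by rewrite H addeK.
Qed.

Lemma rstat_split (f : E -> R) : test_function f ->
  exists a b, [/\ test_function a, test_function b,
    (forall x, 0 <= a x), (forall x, 0 <= b x) &
    forall x, [/\ f x = a x - b x, `|f x| = a x + b x & a x * b x = 0]].
Proof.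
move=> tf; have tn := test_function_norm tf.
exists (fun x => 2^-1 * (`|f x| + f x)), (fun x => 2^-1 * (`|f x| - f x)).
split.
- by apply: test_functionZ; exact: test_functionD.
- by apply: test_functionZ; exact: test_functionB.
- by move=> x; rewrite mulr_ge0// -lerBlDr sub0r ler_normr lexx orbT.
- by move=> x; rewrite mulr_ge0// subr_ge0 ler_norm.
- move=> x; split; [by field|by field|].
  transitivity (4^-1 * (`|f x| ^+ 2 - f x ^+ 2)); first by field.
  by rewrite real_normK ?num_real// subrr mulr0.
Qed.

Lemma rstat_L2 (f : E -> R) : test_function f -> rstat Phi f \in Lfun P 2%:E.
Proof.
move=> tf; have [a [b [ta tb a0 b0 ab]]] := rstat_split tf.
rewrite (_ : rstat Phi f = rstat Phi a - rstat Phi b); last first.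
  apply/funext => w; rewrite !fctE -rstatB//; congr rstat; apply/funext => x.
  by have [] := ab x.
by rewrite rpredB ?lee1n// => ?; exact: rstat_L2_ge0.
Qed.

Lemma test_function_box N : test_function (\1_(box N) : E -> R).
Proof.
split; first by apply: measurable_indic; exact: measurable_box.
- by exists 1 => x; rewrite ger0_norm// indicE lern1 leq_b1.
- by exists N => x xN; rewrite indicE memNset.
Qed.

(** The variance of the number of points in the cube of half side [n^2 + n] is
    nonnegative.  Each of its points with coordinates at most [n^2] sees the whole cube
    of half side [n] around it, which bounds the mass of [k2] in the latter by
    the ratio of two volumes. *)
Lemma k2_box_le (n : nat) : (0 < n)%N ->
  (\int[leb]_(z in box n%:R) (k2 z)%:E <= ((n.+1%:R / n%:R) ^+ d)%:E)%E.
Proof.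
move=> n0; pose N : R := n%:R ^+ 2 + n%:R.
have nR0 : 0 < n%:R :> R by rewrite ltr0n.
have tN := test_function_box N; have [mN _ _] := tN.
have N_ge0 (x : E) : 0 <= \1_(box N) x :> R by [].
have := variance_rstat_ge0 tN N_ge0.
have -> : (\int[leb]_x ((\1_(box N) x : R) ^+ 2)%:E = ((2 * N) ^+ d)%:E)%E.
  rewrite -lebesgue_box; last by rewrite addr_ge0 ?sqr_ge0// ltW.
  transitivity (\int[leb]_x (\1_(box N) x)%:E)%E.
    by apply: eq_integral => x _; rewrite indicE; case: (_ \in _);
      rewrite ?expr1n ?expr0n.
  by rewrite integral_indic ?setIT//; exact: measurable_box.
move=> VE.
have {VE} : (energy (fun p => \1_(box N) p.1 * \1_(box N) p.2)%R <=
    ((2 * N) ^+ d)%:E)%E.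
  by rewrite -VE leeDr// variance_ge0.
rewrite energyE//=; last exact: (measurable_fxfy mN).
set I := (\int[leb]_(z in box n%:R) (k2 z)%:E)%E.
have I0 : (0 <= I)%E by apply: integral_ge0 => z _; rewrite lee_fin.
move=> le2N.
have : (((2 * n%:R ^+ 2) ^+ d)%:E * I <= ((2 * N) ^+ d)%:E)%E.
  apply: le_trans le2N.
  rewrite -lebesgue_box ?sqr_ge0//.
  have mb2 := @measurable_box R d (n%:R ^+ 2).
  have -> : (leb (box (n%:R ^+ 2)) = \int[leb]_x (\1_(box (n%:R ^+ 2)) x)%:E)%E.
    by rewrite integral_indic ?setIT.
  rewrite -ge0_integralZr//; last first.
    by apply/measurable_EFinP; apply: measurable_indic.
  apply: ge0_le_integral => //.
  - by move=> x _; rewrite mule_ge0// lee_fin.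
  - by apply: emeasurable_funM => //; by apply/measurable_EFinP; apply: measurable_indic.
  - apply: (measurable_fun_fubini_tonelli_F (fun p : E * E =>
      (\1_(box N) p.1 * \1_(box N) p.2 * k2 (p.2 - p.1))%:E)) => [|p].
      by apply: measurable_energy_fun => //; exact: (measurable_fxfy mN).
    by rewrite lee_fin !mulr_ge0.
  move=> x _; pose F (z : E) := (\1_(box N) x * \1_(box N) (z + x)%R * k2 z)%:E.
  have mF : measurable_fun setT F.
    apply/measurable_EFinP; apply: measurable_funM => //.
    apply: measurable_funM => //.
    apply: (measurableT_comp mN).
    exact: (measurable_funrVD (@measurable_id _ _ setT) (measurable_cst x)).
  have F0 z : (0 <= F z)%E by rewrite lee_fin !mulr_ge0.
  rewrite (_ : (\int[leb]_y _)%E = (\int[leb]_z F z)%E); last first.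
    rewrite -(integral_rV_transl (- x) mF F0); apply: eq_integral => y _.
    by rewrite /F subrK.
  rewrite indicE; have [xn|] := boolP (x \in box _); last first.
    by move=> _; rewrite mul0e integral_ge0.
  rewrite mul1e /I integral_mkcond; apply: ge0_le_integral => //.
  - by move=> z _; apply: erestrict_ge0 => ? _; rewrite lee_fin.
  - apply/(measurable_restrictT _ _).1; first exact: measurable_box.
    by apply: measurable_funTS; exact/measurable_EFinP.
  move=> z _; rewrite patchE; case: ifPn => [zn|_]; last exact: F0.
  rewrite /F lee_fin !indicE !mem_set ?mul1r//.
    move=> i; rewrite mxE addrC; apply: le_trans (ler_normD _ _) _; apply: lerD.
      by move: xn; rewrite inE => /(_ i).
    by move: zn; rewrite inE => /(_ i).
  apply: (box_subset (N := n%:R ^+ 2)); first by rewrite lerDl ltW.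
  by rewrite inE in xn.
have n20 : 0 < (2 * n%:R ^+ 2) ^+ d :> R.
  by rewrite exprn_gt0// mulr_gt0// exprn_gt0.
rewrite -lee_pdivlMl//.
move/le_trans; apply; rewrite -EFinM lee_fin -exprVn -exprMn.
rewrite le_eqVlt; apply/orP; left; apply/eqP; congr (_ ^+ _).
rewrite /N -natr1; field.
by rewrite gt_eqF.
Qed.

Lemma k2_mass_le1 : (\int[leb]_z (k2 z)%:E <= 1%:E)%E.
Proof.
have cvI := cvg_integral_box mk2 k2_ge0.
have cvq : (n.+1%:R / n%:R : R) @[n --> \oo] --> (1 : R).
  rewrite -cvg_shiftS.
  rewrite [X in X @ _ --> _](_ : _ = fun n => 1 + (n.+1%:R : R)^-1); last first.
    by apply/funext => n /=; rewrite -[in LHS]natr1 mulrDl mul1r divff.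
  have : (fun n => 1 + (n.+1%:R : R)^-1) @ \oo --> (1 + 0 : R).
    by apply: cvgD; [exact: cvg_cst|exact: cvg_harmonic].
  by rewrite addr0.
have cv1 : ((n.+1%:R / n%:R : R) ^+ d)%:E @[n --> \oo] --> 1%:E.
  apply: cvg_EFin; first by near=> n.
  have := continuous_cvg _ (@exprn_continuous R d 1) cvq.
  by rewrite expr1n => H; exact: H.
apply: (lee_cvg_to cvI cv1).
near=> n; apply: k2_box_le.
by near: n; exact: nbhs_infty_gt.
Unshelve. all: by end_near. Qed.

Variable L : R.
Hypotheses (LE : (\int[leb]_z (k2 z)%:E = L%:E)%E) (L_le1 : L <= 1).

(** For [f >= 0] the formula is [variance_rstat_ge0] with the square expanded.
    A signed [f = a - b], with [a] and [b] its positive and negative parts, is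
    reached through the parallelogram law
    [Var (a - b) + Var (a + b) = 2 Var a + 2 Var b], as [a + b = |f|] is
    nonnegative. *)
Lemma variance_rstat (f : E -> R) : test_function f ->
  (2%:E * Var f + (2 * L)%:E * \int[leb]_x (f x ^+ 2)%:E =
   2%:E * \int[leb]_x (f x ^+ 2)%:E +
   energy (fun p => (f p.1 - f p.2) ^+ 2)%R)%E.
Proof.
move=> tf; have [a [b [ta tb a0 b0 ab]]] := rstat_split tf.
have [mf _ _] := tf; have [ma _ _] := ta; have [mb _ _] := tb.
have tn := test_function_norm tf.
have Xa := rstat_L2_ge0 ta a0; have Xb := rstat_L2_ge0 tb b0.
have Va := variance_rstat_ge0 ta a0; have Vb := variance_rstat_ge0 tb b0.
have Vn := variance_rstat_ge0 tn (fun x => normr_ge0 (f x)).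
have VD := varianceD Xa Xb; have VB := varianceB Xa Xb.
have -> : rstat Phi f = rstat Phi a \- rstat Phi b.
  apply/funext => w; rewrite /= -rstatB//; congr rstat; apply/funext => x.
  by have [] := ab x.
have nE : rstat Phi (fun x => `|f x|) = rstat Phi a \+ rstat Phi b.
  apply/funext => w; rewrite /= -rstatD//; congr rstat; apply/funext => x.
  by have [] := ab x.
rewrite nE in Vn.
have [s s0 sE] := integral_sqr_test tf.
have [sa sa0 saE] := integral_sqr_test ta.
have [sb sb0 sbE] := integral_sqr_test tb.
have snE : (\int[leb]_x (`|f x| ^+ 2)%:E = s%:E)%E.
  by rewrite -sE; apply: eq_integral => x _; rewrite real_normK ?num_real.
have sabE : s = sa + sb.
  apply: EFin_inj; rewrite EFinD -sE -saE -sbE -ge0_integralD//; last 4 first.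
  - by move=> x _; rewrite lee_fin sqr_ge0.
  - by apply/measurable_EFinP; exact: measurable_funX.
  - by move=> x _; rewrite lee_fin sqr_ge0.
  - by apply/measurable_EFinP; exact: measurable_funX.
  apply: eq_integral => x _; have [-> _ abx] := ab x.
  by rewrite -EFinD; congr EFin; rewrite sqrrB abx mul0rn subr0.
have fin_of (v e : \bar R) (t : R) : (0 <= v)%E -> (0 <= e)%E ->
    (v + e = t%:E)%E -> exists v' e', [/\ v = v'%:E, e = e'%:E & t = v' + e'].
  by case: v => [v| |]//; case: e => [e| |]//= _ _ [vt]; exists v, e.
have e_ge0 (g : E -> R) : (forall x, 0 <= g x) ->
    (0 <= energy (fun p => g p.1 * g p.2)%R)%E.
  by move=> g0; apply: energy_ge0 => // p; rewrite mulr_ge0.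
rewrite saE in Va; rewrite sbE in Vb; rewrite snE in Vn.
have [va [ea [vaE eaE saE']]] := fin_of _ _ _ (variance_ge0 _ _) (e_ge0 _ a0) Va.
have [vb [eb [vbE ebE sbE']]] := fin_of _ _ _ (variance_ge0 _ _) (e_ge0 _ b0) Vb.
have [vn [en [vnE enE snE']]] := fin_of _ _ _ (variance_ge0 _ _)
  (e_ge0 _ (fun x => normr_ge0 (f x))) Vn.
have covfin : covariance P (rstat Phi a) (rstat Phi b) \is a fin_num.
  by rewrite covariance_fin_num ?Lfun2_mul_Lfun1// Lfun_subset12 ?fin_num_measure.
move: VD VB; rewrite vaE vbE vnE -(fineK covfin) -!EFinM -!EFinD => -[VD] VB.
have mDf : measurable_fun setT (fun p : E * E => (f p.1 - f p.2) ^+ 2).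
  apply: measurable_funX; apply: measurable_funB;
  [exact: (measurableT_comp mf measurable_fst)|
   exact: (measurableT_comp mf measurable_snd)].
have msq (g : E -> R) : measurable_fun setT g ->
  measurable_fun setT (fun x => g x ^+ 2) by move=> mg; exact: measurable_funX.
have ED : (energy (fun p => (f p.1 - f p.2) ^+ 2)%R +
    ((4 * ea)%:E + (4 * eb)%:E) = (2 * L * s)%:E + (2 * en)%:E)%E.
  rewrite !EFinM -eaE -ebE -enE -!energyZ//; last 5 first.
  - by apply: (@measurable_fxfy (fun x => `|f x|)); exact: measurableT_comp.
  - exact: measurable_fxfy.
  - by move=> p; rewrite mulr_ge0.
  - exact: measurable_fxfy.
  - by move=> p; rewrite mulr_ge0.
  have -> : (2%:E * L%:E * s%:E = energy ((fun x => f x ^+ 2)%R \o fst) +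
      energy ((fun x => f x ^+ 2)%R \o snd))%E.
    rewrite (energy_fst (msq _ mf) (fun x => sqr_ge0 (f x))).
    rewrite (energy_snd (msq _ mf) (fun x => sqr_ge0 (f x))).
    by rewrite sE LE -!EFinM -EFinD; congr EFin; ring.
  have m1 := measurableT_comp (msq _ mf) (@measurable_fst _ _ E E).
  have m2 := measurableT_comp (msq _ mf) (@measurable_snd _ _ E E).
  have ma2 := measurable_fxfy ma; have mb2 := measurable_fxfy mb.
  have mn2 : measurable_fun setT (fun p : E * E => `|f p.1| * `|f p.2|).
    by apply: (@measurable_fxfy (fun x => `|f x|)); exact: measurableT_comp.
  have mZ (c : R) (g : E * E -> R) : measurable_fun setT g ->
    measurable_fun setT (fun p => c * g p) by move=> mg; exact: measurable_funM.
  have pZ (c : R) (g : E -> R) p : 0 <= c -> (forall x, 0 <= g x) ->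
    0 <= c * (g p.1 * g p.2) by move=> c0 g0; rewrite !mulr_ge0.
  have pa p : 0 <= 4 * (a p.1 * a p.2) by exact: pZ.
  have pb p : 0 <= 4 * (b p.1 * b p.2) by exact: pZ.
  have pn p : 0 <= 2 * (`|f p.1| * `|f p.2|) by apply: (pZ 2 (fun x => `|f x|)).
  rewrite -(energyD (mZ 4 _ ma2) (mZ 4 _ mb2) pa pb).
  rewrite -(energyD mDf
    (measurable_funD (mZ 4 _ ma2) (mZ 4 _ mb2))
    (fun p => sqr_ge0 _) (fun p => addr_ge0 (pa p) (pb p))).
  rewrite -(energyD m1 m2 (fun p => sqr_ge0 _) (fun p => sqr_ge0 _)).
  rewrite -(energyD (measurable_funD m1 m2) (mZ 2 _ mn2)
    (fun p => addr_ge0 (sqr_ge0 _) (sqr_ge0 _)) pn).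
  congr energy; apply/funext => -[x y] /=.
  by have [-> -> _] := ab x; have [-> -> _] := ab y; ring.
have [D DE] : exists D, (energy (fun p => (f p.1 - f p.2) ^+ 2)%R = D%:E)%E.
  move: ED; rewrite -!EFinD; case: (energy _) => [D| |]// _.
  by exists D.
rewrite sE DE VB -!EFinM -!EFinD; congr EFin.
move: ED; rewrite DE -!EFinD => -[ED].
lra.
Qed.

Lemma variance_fine (f : E -> R) : test_function f ->
  exists2 v : R, 0 <= v & (Var f = v%:E)%E.
Proof.
move=> tf; exists (fine (Var f)); first by rewrite fine_ge0// variance_ge0.
rewrite fineK//; apply: variance_fin_num.
exact: (rstat_L2).
Qed.

(** * The characteristic function of the jump law *)

Definition phi (u : E) : R := \int[leb]_z (cos (dot u z) * k2 z).

Lemma integrable_k2 : leb.-integrable setT (EFin \o k2).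
Proof.
apply/integrableP; split; first exact/measurable_EFinP.
by under eq_integral do rewrite /= ger0_norm//; rewrite LE ltry.
Qed.

Lemma integrable_bounded_k2 (g : E -> R) : measurable_fun setT g ->
  (forall x, `|g x| <= 1) -> leb.-integrable setT (EFin \o (fun z => g z * k2 z)).
Proof.
move=> mg g1; apply: le_integrable integrable_k2 => //.
  by apply/measurable_EFinP; exact: measurable_funM.
by move=> z _ /=; rewrite lee_fin normrM ler_piMl.
Qed.

Lemma jump_mass_ge0 : 0 <= L.
Proof.
by rewrite -lee_fin -LE; apply: integral_ge0 => z _; rewrite lee_fin.
Qed.

Lemma Rintegral_k2 : \int[leb]_z k2 z = L.
Proof. by rewrite /Rintegral LE. Qed.

Lemma integrable_cos_k2 u :
  leb.-integrable setT (EFin \o (fun z => cos (dot u z) * k2 z)).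
Proof.
apply: integrable_bounded_k2 => [|x]; last exact: cos_max.
by apply: measurable_cos_dot.
Qed.

Lemma integrable_sin_k2 u :
  leb.-integrable setT (EFin \o (fun z => sin (dot u z) * k2 z)).
Proof.
apply: integrable_bounded_k2 => [|x]; last exact: sin_max.
by apply: measurable_sin_dot.
Qed.

Lemma phi_normL u : `|phi u| <= L.
Proof.
rewrite -Rintegral_k2; apply: le_trans.
  by apply: le_normr_Rintegral => //; exact: integrable_cos_k2.
apply: le_Rintegral => //.
- apply: le_integrable (integrable_cos_k2 u) => //.
    apply/measurable_EFinP; apply: measurableT_comp => //.
    by apply: measurable_funM => //; exact: measurable_cos_dot.
  by move=> x _ /=; rewrite normr_id.
- exact: integrable_k2.
- by move=> x _; rewrite normrM (ger0_norm (k2_ge0 x)) ler_piMl// cos_max.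
Qed.

Lemma phi_norm u : `|phi u| <= 1.
Proof. exact: le_trans (phi_normL u) L_le1. Qed.

(** The nonnegative weights [1 + cos] and [1 - cos] give access to the results
    on nonnegative integrals: measurability of [phi] for the first one, lower
    bounds on the gap [1 - phi] for the second one. *)
Lemma integral_1Dcos u :
  (\int[leb]_z ((1 + cos (dot u z)) * k2 z)%:E = (L + phi u)%:E)%E.
Proof.
under eq_integral do rewrite mulrDl mul1r EFinD.
rewrite integralD//=; last 2 first.
- exact: integrable_k2.
- exact: integrable_cos_k2.
rewrite LE EFinD; congr (_ + _)%E; rewrite /phi /Rintegral fineK//.
exact: integrable_fin_num (integrable_cos_k2 u).
Qed.

Lemma integral_1Bcos u :
  (\int[leb]_z ((1 - cos (dot u z)) * k2 z)%:E = (L - phi u)%:E)%E.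
Proof.
under eq_integral do rewrite mulrBl mul1r EFinB.
rewrite integralB//=; last 2 first.
- exact: integrable_k2.
- exact: integrable_cos_k2.
rewrite LE EFinB; congr (_ - _)%E; rewrite /phi /Rintegral fineK//.
exact: integrable_fin_num (integrable_cos_k2 u).
Qed.

Lemma measurable_phi : measurable_fun setT phi.
Proof.
pose F (p : E * E) : \bar R := ((1 + cos (dot p.1 p.2)) * k2 p.2)%:E.
have F0 p : (0 <= F p)%E.
  by rewrite lee_fin mulr_ge0// -lerBlDl sub0r cos_geN1.
have mF : measurable_fun setT F.
  apply/measurable_EFinP; apply: measurable_funM.
    by apply: measurable_funD => //; apply: measurable_cos_dot.
  exact: (measurableT_comp mk2 measurable_snd).
have := measurable_fun_fubini_tonelli_F F mF F0 (m2 := leb).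
rewrite /fubini_F /F /=; under eq_fun do rewrite integral_1Dcos.
move=> /measurable_EFinP mL.
rewrite (_ : phi = fun u => L + phi u - L); first exact: measurable_funB.
by apply/funext => u; rewrite addrC addKr.
Qed.

Lemma Rintegral_sin_k2 u : \int[leb]_z (sin (dot u z) * k2 z) = 0.
Proof.
have ms : measurable_fun setT (fun z : E => sin (dot u z) * k2 z).
  by apply: measurable_funM => //; exact: measurable_sin_dot.
have := Rintegral_rVN ms.
under eq_Rintegral do rewrite dotNr sinN k2_even mulNr -mulN1r.
rewrite RintegralZl//; last exact: integrable_sin_k2.
by rewrite mulN1r => H; lra.
Qed.

Lemma Rintegral_cos_k2_transl u x :
  \int[leb]_y (cos (dot u y) * k2 (y - x)) = cos (dot u x) * phi u.
Proof.
have mc : measurable_fun setT (fun y : E => cos (dot u y) * k2 (y - x)).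
  apply: measurable_funM; first exact: measurable_cos_dot.
  exact: measurable_k2Br.
rewrite -(Rintegral_rV_transl x mc).
under eq_Rintegral do rewrite addrK dotDr cosD mulrBl [cos _ * cos _]mulrC
  -mulrA [sin _ * sin _]mulrC -mulrA.
rewrite RintegralB//; last 2 first.
- by apply: integrableZ_EFin; exact: integrable_cos_k2.
- by apply: integrableZ_EFin; exact: integrable_sin_k2.
rewrite RintegralZl//; last exact: integrable_cos_k2.
rewrite RintegralZl//; last exact: integrable_sin_k2.
by rewrite Rintegral_sin_k2 mulr0 subr0.
Qed.

Lemma gap_ge0 u : 0 <= 1 - phi u.
Proof. by rewrite subr_ge0 (le_trans (ler_norm _))// phi_norm. Qed.

Lemma measurable_gapV : measurable_fun setT (fun u => ((1 - phi u)%:E^-1)%E).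
Proof.
apply: measurable_inve_ge0 => [|u]; last exact: gap_ge0.
by apply: measurable_funB => //; exact: measurable_phi.
Qed.

(** * Iterated kernels and Green functions *)

(** The spectral multiplier of the partial sums [1 + T + ... + T^(n-1)] of the
    Green operator of the walk. *)
Definition gsum (n : nat) (t : R) : R := \sum_(j < n) t ^+ j.

Lemma gsum_ge0 n t : `|t| <= 1 -> 0 <= gsum n t.
Proof.
move=> t1; have [->|tN1] := eqVneq t 1.
  by apply: sumr_ge0 => j _; rewrite expr1n.
have t1' : t < 1 by rewrite lt_neqAle tN1 (le_trans (ler_norm t)).
have := subrX1 t n; rewrite -/(gsum n t) => H.
have : 0 <= (1 - t) * gsum n t.
  rewrite -opprB mulNr -H opprB subr_ge0.
  by rewrite (le_trans (ler_norm _))// normrX exprn_ile1.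
by rewrite pmulr_rge0// subr_gt0.
Qed.

(** The numerator [1 - t ^ n] is at most 2, as [t] may be close to -1. *)
Lemma gsum_le n t : `|t| <= 1 ->
  ((gsum n t)%:E <= 2%:E * ((1 - t)%:E)^-1)%E.
Proof.
move=> t1; have [->|tN1] := eqVneq t 1.
  by rewrite subrr inve0 gt0_muley ?leey// lte_fin.
have t1' : t < 1 by rewrite lt_neqAle tN1 (le_trans (ler_norm t)).
have s0 : 0 < 1 - t by rewrite subr_gt0.
rewrite inver gt_eqF// -EFinM lee_fin ler_pdivlMr// mulrC.
have := subrX1 t n; rewrite -/(gsum n t) => H.
rewrite -opprB mulNr -H opprB.
have : `|t ^+ n| <= 1 by rewrite normrX exprn_ile1.
by rewrite ler_norml => /andP[? ?]; lra.
Qed.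

(** The number [n] of terms is odd to have [t ^ n <= 0] for negative [t].  For
    positive [t], Bernoulli's inequality for [(2 - t) ^ n] and [t (2 - t) <= 1]
    bound [t ^ n] by [1 / (1 + n (1 - t))]. *)
Lemma gsum_ge (m : nat) t : `|t| <= 1 ->
  (1 - t + (m.*2.+1)%:R^-1)^-1 <= gsum m.*2.+1 t.
Proof.
set n := m.*2.+1 => t1.
have n0 : 0 < n%:R :> R by rewrite ltr0n.
have n0' : 0 < n%:R^-1 :> R by rewrite invr_gt0.
have [->|tN1] := eqVneq t 1.
  rewrite subrr add0r invrK /gsum; under eq_bigr do rewrite expr1n.
  by rewrite sumr_const card_ord.
have t1' : t < 1 by rewrite lt_neqAle tN1 (le_trans (ler_norm t)).
have s0 : 0 < 1 - t by rewrite subr_gt0.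
have := subrX1 t n; rewrite -/(gsum n t) => H.
have gE : gsum n t = (1 - t ^+ n) / (1 - t).
  by rewrite -[1 - t ^+ n]opprB H; field; rewrite ?subr_eq0 1?eq_sym.
rewrite gE ler_pdivlMr// mulrC ler_pdivrMr; last by rewrite addr_gt0.
have [t0|t0] := leP t 0.
  have : t ^+ n <= 0 by rewrite exprn_odd_le0 //= odd_double.
  move=> tn.
  apply: (@le_trans _ _ (1 * (1 - t + n%:R^-1))).
    by rewrite mul1r lerDl ltW.
  apply: ler_wpM2r; first by rewrite addr_ge0// ltW.
  by rewrite lerBrDl gerDr.
have B : 1 + n%:R * (1 - t) <= (1 + (1 - t)) ^+ n.
  elim: (n) => [|k IHk]; first by rewrite mul0r addr0 expr0.
  rewrite exprS; apply: (@le_trans _ _ ((1 + (1 - t)) * (1 + k%:R * (1 - t)))).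
    rewrite -[k.+1%:R]natr1 -subr_ge0.
    rewrite [X in 0 <= X](_ : _ = k%:R * (1 - t) ^+ 2); last by ring.
    by rewrite mulr_ge0 ?sqr_ge0.
  by rewrite ler_wpM2l// addr_ge0// ltW.
have tn0 : 0 <= t ^+ n by rewrite exprn_ge0// ltW.
have Bt : t ^+ n * (1 + n%:R * (1 - t)) <= 1.
  apply: le_trans (ler_wpM2l tn0 B) _; rewrite -exprMn.
  rewrite exprn_ile1//; first by rewrite mulr_ge0 ?ltW// addr_gt0.
  rewrite -subr_ge0 [X in 0 <= X](_ : _ = (1 - t) ^+ 2); last by ring.
  exact: sqr_ge0.
rewrite -(ler_pM2l n0).
have -> : n%:R * ((1 - t ^+ n) * (1 - t + n%:R^-1)) =
    (1 - t ^+ n) * (1 + n%:R * (1 - t)) by field; rewrite gt_eqF.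
by rewrite mulrBl mul1r; lra.
Qed.

Section iterated_kernel.
Variables (chi : E -> R) (X : R).
Hypotheses (mchi : measurable_fun setT chi) (chi_ge0 : forall xi, 0 <= chi xi)
  (chiX : (\int[leb]_xi (chi xi)%:E = X%:E)%E).

(** The [j]th step of the walk applied to the inverse Fourier transform of the
    window [chi]. *)
Definition kern (j : nat) (x : E) : R :=
  \int[leb]_xi (chi xi * phi xi ^+ j * cos (dot xi x)).

Hypothesis kern0_ge0 : forall x, 0 <= kern 0 x.

Let mphi := measurable_phi.
Let phi1 := phi_norm.

Lemma integrable_chi : leb.-integrable setT (EFin \o chi).
Proof.
apply/integrableP; split; first exact/measurable_EFinP.
by under eq_integral do rewrite /= ger0_norm//; rewrite chiX ltry.
Qed.

Lemma integrable_chiM (g : E -> R) : measurable_fun setT g ->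
  (forall xi, `|g xi| <= 1) ->
  leb.-integrable setT (EFin \o (fun xi => chi xi * g xi)).
Proof.
move=> mg g1; apply: le_integrable integrable_chi => //.
  by apply/measurable_EFinP; exact: measurable_funM.
by move=> z _ /=; rewrite lee_fin normrM ler_piMr.
Qed.

Lemma chi_weight_norm j xi x : `|phi xi ^+ j * cos (dot xi x)| <= 1.
Proof.
by rewrite normrM normrX mulr_ile1 ?exprn_ge0 ?exprn_ile1 ?cos_max.
Qed.

Lemma measurable_chi_weight j x :
  measurable_fun setT (fun xi => phi xi ^+ j * cos (dot xi x)).
Proof.
apply: measurable_funM; first exact: measurable_funX.
by apply: measurable_cos_dot.
Qed.

Lemma integrable_kern j x : leb.-integrable setT
  (EFin \o (fun xi => chi xi * phi xi ^+ j * cos (dot xi x))).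
Proof.
under [X in _.-integrable _ (_ \o X)]eq_fun do rewrite -mulrA.
apply: integrable_chiM; first exact: measurable_chi_weight.
by move=> xi; exact: chi_weight_norm.
Qed.

Lemma integral_chi_1D j x :
  (\int[leb]_xi (chi xi * (1 + phi xi ^+ j * cos (dot xi x)))%:E =
   (X + kern j x)%:E)%E.
Proof.
under eq_integral do rewrite mulrDr mulr1 EFinD mulrA.
rewrite integralD//=; last 2 first.
- exact: integrable_chi.
- exact: integrable_kern.
rewrite chiX EFinD; congr (_ + _)%E; rewrite /kern /Rintegral fineK//.
exact: integrable_fin_num (integrable_kern j x).
Qed.

Lemma measurable_kern j : measurable_fun setT (kern j).
Proof.
pose F (p : E * E) : \bar R :=
  (chi p.2 * (1 + phi p.2 ^+ j * cos (dot p.2 p.1)))%:E.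
have F0 p : (0 <= F p)%E.
  rewrite lee_fin mulr_ge0// -lerBlDl sub0r.
  by have := chi_weight_norm j p.2 p.1; rewrite ler_norml => /andP[].
have mF : measurable_fun setT F.
  apply/measurable_EFinP; apply: measurable_funM.
    exact: (measurableT_comp mchi measurable_snd).
  apply: measurable_funD => //; apply: measurable_funM; last first.
    by apply: measurable_cos_dot.
  by apply: measurable_funX; exact: (measurableT_comp mphi measurable_snd).
have := measurable_fun_fubini_tonelli_F F mF F0 (m2 := leb).
rewrite /fubini_F /F /=; under eq_fun do rewrite integral_chi_1D.
move=> /measurable_EFinP mX.
rewrite (_ : kern j = fun u => X + kern j u - X); first exact: measurable_funB.
by apply/funext => u; rewrite addrC addKr.
Qed.

Lemma window_mass_ge0 : 0 <= X.
Proof.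
by rewrite -lee_fin -chiX; apply: integral_ge0 => z _; rewrite lee_fin.
Qed.

Lemma kern_norm j x : `|kern j x| <= X.
Proof.
have -> : X = \int[leb]_xi chi xi by rewrite /Rintegral chiX.
apply: le_trans.
  by apply: le_normr_Rintegral => //; exact: integrable_kern.
apply: le_Rintegral => //.
- have /(integrable_norm (mu := leb)) := integrable_kern j x.
  by [].
- exact: integrable_chi.
- move=> xi _; rewrite -mulrA normrM (ger0_norm (chi_ge0 xi)) ler_piMr//.
  exact: chi_weight_norm.
Qed.

Lemma integral_k2_shift x : (\int[leb]_y (k2 (y - x))%:E = L%:E)%E.
Proof.
rewrite -LE (integral_rV_transl (- x) (F := EFin \o k2))//.
exact/measurable_EFinP.
Qed.

Lemma integrable_k2_shift (g : E -> R) x : measurable_fun setT g ->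
  (forall y, `|g y| <= 1) ->
  leb.-integrable setT (EFin \o (fun y => g y * k2 (y - x))).
Proof.
move=> mg g1; apply: (@le_integrable _ _ _ leb setT measurableT _
  (EFin \o (fun y => k2 (y - x)))).
- apply/measurable_EFinP; apply: measurable_funM => //.
  exact: measurable_k2Br.
- by move=> y _ /=; rewrite lee_fin normrM ler_piMl.
- apply/integrableP; split.
    by apply/measurable_EFinP; exact: measurable_k2Br.
  under eq_integral do rewrite /= ger0_norm//.
  by rewrite integral_k2_shift ltry.
Qed.

Lemma integrable_kern_k2 j x :
  leb.-integrable setT (EFin \o (fun y => kern j y * k2 (y - x))).
Proof.
have mk := measurable_k2Br x.
apply: (@le_integrable _ _ _ leb setT measurableT _
  (EFin \o (fun y => X * (1 * k2 (y - x))))).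
- by apply/measurable_EFinP; apply: measurable_funM => //; exact: measurable_kern.
- move=> y _ /=; rewrite lee_fin mul1r !normrM ler_wpM2r//.
  by rewrite (ger0_norm window_mass_ge0) kern_norm.
- apply: integrableZ_EFin; apply: (integrable_k2_shift x) => [//|y].
  by rewrite normr1.
Qed.

Let conv_density j x (p : E * E) :=
  chi p.2 * phi p.2 ^+ j * cos (dot p.2 p.1) * k2 (p.1 - x).

Let integrable_conv_density j x :
  (leb \x leb)%E.-integrable setT (EFin \o conv_density j x).
Proof.
have mk := measurable_k2Br x.
have mF : measurable_fun setT (EFin \o conv_density j x).
  apply/measurable_EFinP; apply: measurable_funM; last first.
    exact: (measurableT_comp mk measurable_fst).
  apply: measurable_funM; last by apply: measurable_cos_dot.
  apply: measurable_funM; first exact: (measurableT_comp mchi measurable_snd).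
  by apply: measurable_funX; exact: (measurableT_comp mphi measurable_snd).
apply/(integrable12ltyP _ _ mF).
apply: (@le_lt_trans _ _ (\int[leb]_y \int[leb]_xi (chi xi * k2 (y - x))%:E)%E).
  apply: ge0_le_integral => //.
  - by move=> y _; exact: integral_ge0.
  - apply: (measurable_fun_fubini_tonelli_F (abse \o (EFin \o conv_density j x))) => [|p].
      exact: measurableT_comp.
    exact: abse_ge0.
  - pose G (p : E * E) := (chi p.2 * k2 (p.1 - x))%:E.
    have G0 p : (0 <= G p)%E by rewrite lee_fin mulr_ge0.
    have mG : measurable_fun setT G.
      apply/measurable_EFinP; apply: measurable_funM.
        exact: (measurableT_comp mchi measurable_snd).
      exact: (measurableT_comp mk measurable_fst).
    exact: (measurable_fun_fubini_tonelli_F G mG G0).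
  move=> y _; apply: ge0_le_integral => //.
  - by apply: measurableT_comp => //; exact: (measurableT_comp mF (pair1_measurable y)).
  - by apply/measurable_EFinP; exact: measurable_funM.
  move=> xi _; rewrite /conv_density/= lee_fin normrM (ger0_norm (k2_ge0 _)) ler_wpM2r//.
  rewrite -mulrA normrM (ger0_norm (chi_ge0 xi)) ler_piMr//.
  exact: chi_weight_norm.
under eq_integral => y _.
  under eq_integral do rewrite mulrC EFinM.
  rewrite ge0_integralZl_EFin//; last 2 first.
  - by move=> xi _; rewrite lee_fin.
  - exact/measurable_EFinP.
  rewrite chiX muleC; over.
rewrite ge0_integralZl_EFin//; last 3 first.
- by move=> y _; rewrite lee_fin.
- exact/measurable_EFinP.
- exact: window_mass_ge0.
by rewrite integral_k2_shift ltry.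
Qed.

(** Fubini: since [k2] is even, convolution with it multiplies the character of
    frequency [xi] by [phi xi]. *)
Lemma kern_conv j x : \int[leb]_y (kern j y * k2 (y - x)) = kern j.+1 x.
Proof.
transitivity (fine (\int[leb]_y \int[leb]_xi (conv_density j x (y, xi))%:E)).
  congr fine; apply: eq_integral => y _.
  rewrite /kern -RintegralZr; [|exact: measurableT|exact: integrable_kern].
  rewrite /Rintegral fineK; first by [].
  apply: (@integrable_fin_num _ _ _ leb setT measurableT).
  have := integrableZ_EFin (k2 (y - x)) (integrable_kern j y).
  apply: eq_integrable; first exact: measurableT.
  by move=> xi _; rewrite /= mulrC.
have -> := Fubini (integrable_conv_density j x).
congr fine; apply: eq_integral => xi _.
have -> : chi xi * phi xi ^+ j.+1 * cos (dot xi x) =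
    chi xi * phi xi ^+ j * (cos (dot xi x) * phi xi) by rewrite exprSr; ring.
have ic : leb.-integrable setT (EFin \o (fun y => cos (dot xi y) * k2 (y - x))).
  apply: integrable_k2_shift => [|y]; last exact: cos_max.
  by apply: measurable_cos_dot.
rewrite -(Rintegral_cos_k2_transl) -RintegralZl//.
rewrite /Rintegral fineK.
  by apply: eq_integral => y _; rewrite /conv_density/=; congr EFin; ring.
apply: (@integrable_fin_num _ _ _ leb setT measurableT).
exact: (integrableZ_EFin (chi xi * phi xi ^+ j) ic).
Qed.

Lemma kern_ge0 j x : 0 <= kern j x.
Proof.
elim: j x => [|j IH] x; first exact: kern0_ge0.
by rewrite -kern_conv; apply: Rintegral_ge0 => y _; rewrite mulr_ge0.
Qed.

Lemma ekern_conv j x :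
  (\int[leb]_y (kern j y * k2 (y - x))%:E = (kern j.+1 x)%:E)%E.
Proof.
rewrite -kern_conv /Rintegral fineK//.
exact: integrable_fin_num (integrable_kern_k2 j x).
Qed.

Lemma integral_kern_le j :
  (\int[leb]_x (kern j x)%:E <= \int[leb]_x (kern 0 x)%:E)%E.
Proof.
elim: j => [|j IH]; first exact: lexx.
apply: le_trans IH; under eq_integral do rewrite -ekern_conv.
rewrite -(@energyE (kern j \o snd)); last 2 first.
- exact: (measurableT_comp (measurable_kern j) measurable_snd).
- by move=> p; exact: kern_ge0.
rewrite energy_snd//; last 2 first.
- exact: measurable_kern.
- by move=> x; exact: kern_ge0.
rewrite LE -[leRHS]mul1e lee_wpmul2r ?lee_fin//.
by apply: integral_ge0 => x _; rewrite lee_fin kern_ge0.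
Qed.

Definition green (n : nat) (x : E) : R := \sum_(j < n) kern j x.

Lemma measurable_green n : measurable_fun setT (green n).
Proof. by apply: measurable_sum => j; exact: measurable_kern. Qed.

Lemma green_ge0 n x : 0 <= green n x.
Proof. by apply: sumr_ge0 => j _; exact: kern_ge0. Qed.

(** A telescoping sum: [green n] is harmonic up to its first and last terms. *)
Lemma green_conv n x :
  (\int[leb]_y (green n y * k2 (y - x))%:E =
   (green n x - kern 0 x + kern n x)%:E)%E.
Proof.
transitivity (\sum_(j < n) kern j.+1 x)%:E.
  rewrite -sumEFin; under [RHS]eq_bigr do rewrite -ekern_conv.
  rewrite -ge0_integral_sum//.
  - by apply: eq_integral => y _; rewrite /green mulr_suml sumEFin.
  - move=> j; apply/measurable_EFinP; apply: measurable_funM.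
      exact: measurable_kern.
    exact: measurable_k2Br.
  - by move=> j y _; rewrite lee_fin mulr_ge0// kern_ge0.
congr EFin; rewrite /green.
have := @big_ord_recl _ 0 +%R n (fun j => kern j x).
rewrite big_ord_recr /= => H; apply: (addrI (kern 0 x)).
rewrite [LHS](_ : _ = kern 0 x + \sum_(i < n) kern (bump 0 i) x)//.
by rewrite -H; ring.
Qed.

Lemma integral_green_lty n : (\int[leb]_x (kern 0 x)%:E < +oo)%E ->
  (\int[leb]_x (green n x)%:E < +oo)%E.
Proof.
move=> p1; rewrite /green; under eq_integral do rewrite -sumEFin.
rewrite ge0_integral_sum//; last 2 first.
- by move=> j; apply/measurable_EFinP; exact: measurable_kern.
- by move=> j x _; rewrite lee_fin kern_ge0.
apply: lte_sum_pinfty => j _.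
exact: le_lt_trans (integral_kern_le j) p1.
Qed.

Lemma greenE n x :
  green n x = \int[leb]_xi (chi xi * gsum n (phi xi) * cos (dot xi x)).
Proof.
rewrite /green /kern /Rintegral.
transitivity (fine (\sum_(j < n) \int[leb]_xi
    (chi xi * phi xi ^+ j * cos (dot xi x))%:E)).
  rewrite sum_fine//.
  by move=> j _; exact: integrable_fin_num (integrable_kern j x).
congr fine; rewrite -integral_sum//; last by move=> j; exact: integrable_kern.
apply: eq_integral => xi _; rewrite sumEFin; congr EFin.
by rewrite /gsum mulr_sumr mulr_suml.
Qed.

Lemma integrable_green n y : leb.-integrable setT (EFin \o
  (fun xi => chi xi * gsum n (phi xi) * cos (dot xi y))).
Proof.
have mg : measurable_fun setT (fun xi => gsum n (phi xi)).
  by apply: measurable_sum => j; exact: measurable_funX.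
apply: (@le_integrable _ _ _ leb setT measurableT _ (EFin \o (fun xi => n%:R * chi xi))).
- apply/measurable_EFinP; apply: measurable_funM; first exact: measurable_funM.
  exact: measurable_cos_dot.
- move=> xi _; rewrite /= lee_fin !normrM ger0_norm//.
  rewrite (ger0_norm (ler0n _ _)) (mulrC n%:R) -[leRHS]mulr1.
  apply: ler_pM; rewrite ?mulr_ge0 ?cos_max//.
  rewrite ger0_norm ?gsum_ge0// ler_wpM2l// /gsum -[X in _ <= X%:R]card_ord -sumr_const.
  apply: ler_sum => j _; apply: le_trans (ler_norm _) _.
  by rewrite normrX exprn_ile1.
- by apply: integrableZ_EFin; exact: integrable_chi.
Qed.

(** Positive definiteness: the spectral weight of [green n] is nonnegative, and a
    cosine is at most 1. *)
Lemma green_le0 n x : green n x <= green n 0.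
Proof.
rewrite !greenE; apply: le_Rintegral; rewrite ?dot0r//; try exact: integrable_green.
by move=> xi _; rewrite dot0r cos0 mulr1 ler_piMr ?cos_le1// mulr_ge0// gsum_ge0.
Qed.

Lemma green0E n : ((green n 0)%:E = \int[leb]_xi (chi xi * gsum n (phi xi))%:E)%E.
Proof.
rewrite /green -sumEFin.
under eq_bigr => j _.
  rewrite /kern /Rintegral fineK; last first.
    exact: integrable_fin_num (integrable_kern j 0).
  under eq_integral do rewrite dot0r cos0 mulr1.
  over.
rewrite -integral_sum//; last first.
  move=> j; have := integrable_kern j 0.
  by under [X in _.-integrable _ (_ \o X) -> _]eq_fun do rewrite dot0r cos0 mulr1.
by apply: eq_integral => xi _; rewrite sumEFin /gsum mulr_sumr.
Qed.

End iterated_kernel.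

(** * A positive spectral window *)

Section tent_product.
Local Notation mu := (@lebesgue_measure R).
Variable b : R.
Hypothesis b0 : 0 < b.
Variable W : R.
Hypothesis WE : (\int[mu]_t (tent b t)%:E = W%:E)%E.

Lemma integrable_tent : mu.-integrable setT (EFin \o tent b).
Proof.
apply/integrableP; split; first by apply/measurable_EFinP; exact: measurable_tent.
by under eq_integral do rewrite /= ger0_norm ?tent_ge0//; rewrite WE ltry.
Qed.

(** Carrying a phase [th] makes the induction over the coordinates work: the
    first coordinate is absorbed in the phase of the remaining ones. *)
Lemma integral_tent_phase n (x : 'I_n -> R) (th : R) :
  (\int[tuple_measure mu n]_t
     ((\prod_(i < n) tent b (tnth t i)) *
      (1 + cos (th + \sum_(i < n) tnth t i * x i)))%:E =
   (W ^+ n + cos th * \prod_(i < n) ptent b (x i))%:E)%E.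
Proof.
elim: n x th => [|n IH] x th.
  by rewrite integral_tuple0 !big_ord0 addr0 mulr1 mul1r expr0.
have mS m (y : 'I_m -> R) c : measurable_fun setT (fun t : m.-tuple (measurableTypeR R) =>
    (\prod_(i < m) tent b (tnth t i)) * (1 + cos (c + \sum_(i < m) tnth t i * y i))).
  apply: measurable_funM.
    by apply: (@measurable_prod_tnth _ (measurableTypeR R) R m (tent b)); exact: measurable_tent.
  apply: measurable_funD => //; apply: (measurableT_comp (f := @cos R)).
    by apply: continuous_measurable_fun; exact: continuous_cos.
  apply: measurable_funD => //; apply: measurable_sum => i.
  by apply: measurable_funM => //; exact: measurable_tnth.
rewrite ge0_integral_tupleS; last 2 first.
- by apply/measurable_EFinP; exact: mS.
- move=> t; rewrite lee_fin mulr_ge0//.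
  by apply: prodr_ge0 => i _; exact: tent_ge0.
pose x' (i : 'I_n) := x (lift ord0 i).
have E1 (t0 : R) : (\int[tuple_measure mu n]_t
     ((\prod_(i < n.+1) tent b (tnth [tuple of t0 :: t] i)) *
      (1 + cos (th + \sum_(i < n.+1) tnth [tuple of t0 :: t] i * x i)))%:E =
   (W ^+ n * tent b t0 + (\prod_(i < n) ptent b (x' i)) *
     (tent b t0 * cos (th + t0 * x ord0)))%:E)%E.
  have := IH x' (th + t0 * x ord0) => IH'.
  transitivity ((tent b t0)%:E * (W ^+ n + cos (th + t0 * x ord0) *
     \prod_(i < n) ptent b (x' i))%:E)%E; last by rewrite -EFinM; congr EFin; ring.
  rewrite -IH' -ge0_integralZl_EFin//; last 3 first.
  - move=> t _; rewrite lee_fin mulr_ge0//.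
    by apply: prodr_ge0 => i _; exact: tent_ge0.
  - by apply/measurable_EFinP; exact: mS.
  - exact: tent_ge0.
  apply: eq_integral => t _; rewrite -EFinM; congr EFin.
  rewrite !big_ord_recl !tnth0 addrA -!mulrA; congr (_ * (_ * _)).
    by apply: eq_bigr => i _; rewrite tnthS.
  congr (1 + cos (_ + _)); apply: eq_bigr => i _; by rewrite tnthS.
under eq_integral do rewrite E1 EFinD.
have i1 := integrableZ_EFin (W ^+ n) integrable_tent.
have ic : mu.-integrable setT (EFin \o (fun t => tent b t * cos (th + t * x ord0))).
  apply: integrable_tentM => // [|t]; [exact: measurable_cosM|exact: cos_max].
have i2 := integrableZ_EFin (\prod_(i < n) ptent b (x' i)) ic.
rewrite integralD//=.
have -> : (\int[mu]_t (W ^+ n * tent b t)%:E = (W ^+ n * W)%:E)%E.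
  under eq_integral do rewrite EFinM.
  rewrite integralZl//; last exact: integrable_tent.
  by rewrite WE.
rewrite -[X in (_ + X)%E]fineK; last exact: integrable_fin_num i2.
rewrite -EFinD; congr EFin; rewrite exprSr; congr (_ + _).
rewrite -/(Rintegral mu setT _) RintegralZl// ptent_phase//.
by rewrite [in RHS]big_ord_recl; ring.
Qed.


Definition chi (xi : E) : R := \prod_(i < d) tent b (xi ord0 i).

Lemma chi_ge0 xi : 0 <= chi xi.
Proof. by apply: prodr_ge0 => i _; exact: tent_ge0. Qed.

Lemma measurable_chi : measurable_fun setT chi.
Proof.
apply: measurable_prod => i _.
exact: (measurableT_comp (measurable_tent b) (@measurable_coord R d i)).
Qed.

Lemma chi_mass : (\int[leb]_xi (chi xi)%:E = (W ^+ d)%:E)%E.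
Proof.
rewrite integral_lebesgue_rV_prod ?WE ?EFin_expe//; first exact: measurable_tent.
exact: tent_ge0.
Qed.

Lemma chi_out xi : ~ box b xi -> chi xi = 0.
Proof.
move=> /existsNP[i /negP]; rewrite -ltNge => /ltW bi.
by rewrite /chi (bigD1 i)//= tent_out// mul0r.
Qed.

Lemma chi_ge xi : box (b / 2) xi -> (b / 2) ^+ d <= chi xi.
Proof.
move=> bxi; rewrite -[X in _ ^+ X]card_ord -prodr_const.
apply: ler_prod => i _; rewrite divr_ge0 ?(ltW b0)//=.
by apply: tent_ge => //; exact: bxi.
Qed.

Lemma chi_le xi : chi xi <= b ^+ d.
Proof.
rewrite -[X in _ ^+ X]card_ord -prodr_const.
by apply: ler_prod => i _; rewrite tent_ge0 tent_le.
Qed.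

Lemma integral_chi_cos (x : E) :
  (\int[leb]_xi (chi xi * (1 + cos (dot xi x)))%:E =
   (W ^+ d + \prod_(i < d) ptent b (x ord0 i))%:E)%E.
Proof.
rewrite ge0_integral_lebesgue_rV.
- have := integral_tent_phase (fun i : 'I_d => x ord0 i) 0.
  rewrite cos0 mul1r => <-; apply: eq_integral => t _; congr EFin.
  rewrite add0r /chi; congr (_ * (1 + cos _)).
    by apply: eq_bigr => i _; rewrite mxE.
  by rewrite /dot; apply: eq_bigr => i _; rewrite mxE.
- apply/measurable_EFinP; apply: measurable_funM; first exact: measurable_chi.
  by apply: measurable_funD => //; exact: measurable_cos_dot.
- by move=> xi; rewrite lee_fin mulr_ge0 ?chi_ge0.
Qed.


Lemma kern0E x : kern chi 0 x = \prod_(i < d) ptent b (x ord0 i).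
Proof.
have := integral_chi_1D measurable_chi chi_ge0 chi_mass 0 x.
under eq_integral do rewrite expr0 mul1r.
by rewrite integral_chi_cos => -[] /addrI.
Qed.

Lemma kern0_ge0 x : 0 <= kern chi 0 x.
Proof. by rewrite kern0E; apply: prodr_ge0 => i _; exact: ptent_ge0. Qed.

Lemma kern0_integral_lty : (\int[leb]_x (kern chi 0 x)%:E < +oo)%E.
Proof.
under eq_integral do rewrite kern0E.
rewrite integral_lebesgue_rV_prod; last 2 first.
- exact: measurable_ptent.
- by move=> x; exact: ptent_ge0.
have p0 : (0 <= \int[mu]_x (ptent b x)%:E)%E.
  by apply: integral_ge0 => x _; rewrite lee_fin ptent_ge0.
rewrite -ge0_fin_numE; last exact: expe_ge0.
rewrite fin_numX// ge0_fin_numE//; exact: ptent_integral_lty.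
Qed.


End tent_product.

(** * Tolerance when the inverse spectral gap is integrable *)

(** The ground state inequality.  For [H > 0] with image [TH] under the walk,
    [2 f(x) f(y) <= f(x)^2 H(y) / H(x) + f(y)^2 H(x) / H(y)], because the
    difference is [(f(x) H(y) - f(y) H(x))^2 / (H(x) H(y))].  Integrating against
    [k2 (y - x)] bounds the correlation part of the variance. *)
Lemma ground_state (f H TH : E -> R) : test_function f ->
  measurable_fun setT H -> measurable_fun setT TH -> (forall x, 0 < H x) ->
  (forall x, 0 <= TH x) ->
  (forall x, (\int[leb]_y (H y * k2 (y - x))%:E = (TH x)%:E)%E) ->
  (forall y, (\int[leb]_x (H x * k2 (y - x))%:E = (TH y)%:E)%E) ->
  (\int[leb]_x (f x ^+ 2)%:E <=
     Var f + \int[leb]_x (f x ^+ 2 * (TH x / H x))%:E)%E.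
Proof.
move=> tf mH mTH H0 TH0 HTH HTH'; have [mf _ _] := tf.
have H0' x : 0 <= H x by exact: ltW.
have VV := variance_rstat tf.
have [s s0 sE] := integral_sqr_test tf.
have [v v0 vE] := variance_fine tf.
have mV : measurable_fun setT (fun x => (H x)^-1).
  by apply: measurable_funV_ge0.
have mf1 := measurableT_comp mf (@measurable_fst _ _ E E).
have mf2 := measurableT_comp mf (@measurable_snd _ _ E E).
have mH1 := measurableT_comp mH (@measurable_fst _ _ E E).
have mH2 := measurableT_comp mH (@measurable_snd _ _ E E).
have mV1 := measurableT_comp mV (@measurable_fst _ _ E E).
have mV2 := measurableT_comp mV (@measurable_snd _ _ E E).
pose g1 (p : E * E) := f p.1 ^+ 2 / H p.1 * H p.2.
pose g2 (p : E * E) := f p.2 ^+ 2 / H p.2 * H p.1.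
have g10 p : 0 <= g1 p by rewrite mulr_ge0// divr_ge0// sqr_ge0.
have g20 p : 0 <= g2 p by rewrite mulr_ge0// divr_ge0// sqr_ge0.
have mg1 : measurable_fun setT g1.
  by apply: measurable_funM => //; apply: measurable_funM => //; exact: measurable_funX.
have mg2 : measurable_fun setT g2.
  by apply: measurable_funM => //; apply: measurable_funM => //; exact: measurable_funX.
set I := (\int[leb]_x (f x ^+ 2 * (TH x / H x))%:E)%E.
have kx := measurable_k2Br; have ky := measurable_k2Bl.
have E1 : energy g1 = I.
  rewrite energyE//; apply: eq_integral => x _.
  under eq_integral do rewrite /g1/= -mulrA EFinM.
  rewrite ge0_integralZl_EFin//; last 3 first.
  - by move=> y _; rewrite lee_fin mulr_ge0.
  - by apply/measurable_EFinP; exact: measurable_funM.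
  - by rewrite divr_ge0// sqr_ge0.
  by rewrite HTH -EFinM; congr EFin; ring.
have E2 : energy g2 = I.
  rewrite energyE2//; apply: eq_integral => y _.
  under eq_integral do rewrite /g2/= -mulrA EFinM.
  rewrite ge0_integralZl_EFin//; last 3 first.
  - by move=> x _; rewrite lee_fin mulr_ge0.
  - by apply/measurable_EFinP; exact: measurable_funM.
  - by rewrite divr_ge0// sqr_ge0.
  by rewrite HTH' -EFinM; congr EFin; ring.
have mD : measurable_fun setT (fun p : E * E => (f p.1 - f p.2) ^+ 2).
  by apply: measurable_funX; exact: measurable_funB.
have D0 (p : E * E) : 0 <= (f p.1 - f p.2) ^+ 2 by exact: sqr_ge0.
have msq : measurable_fun setT (fun x : E => f x ^+ 2) by exact: measurable_funX.
have sq0 (x : E) : 0 <= f x ^+ 2 by exact: sqr_ge0.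
have msq1 := measurableT_comp msq (@measurable_fst _ _ E E).
have msq2 := measurableT_comp msq (@measurable_snd _ _ E E).
have le1 : ((2 * L * s)%:E <= energy (fun p => (f p.1 - f p.2) ^+ 2)%R + (I + I))%E.
  rewrite -{1}E1 -E2 -energyD// -energyD//; last 2 first.
  - exact: measurable_funD.
  - by move=> p; rewrite addr_ge0.
  have -> : ((2 * L * s)%:E = energy (((fun x => f x ^+ 2) \o fst) \+
      ((fun x => f x ^+ 2) \o snd))%R)%E.
    rewrite (energyD msq1 msq2 (fun p => sq0 _) (fun p => sq0 _)).
    rewrite (energy_fst msq sq0) (energy_snd msq sq0).
    by rewrite sE LE -!EFinM -EFinD; congr EFin; ring.
  apply: le_energy => //.
  - exact: measurable_funD.
  - by apply: measurable_funD => //; exact: measurable_funD.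
  - by move=> p; rewrite /= addr_ge0.
  move=> [x y]; rewrite /g1 /g2 /=.
  have Hx := H0 x; have Hy := H0 y.
  rewrite -subr_ge0 [X in 0 <= X](_ : _ =
    (f x * H y - f y * H x) ^+ 2 / (H x * H y)).
    by rewrite divr_ge0 ?sqr_ge0// mulr_ge0.
  by field; rewrite !gt_eqF.
have [D DE] : exists D, energy (fun p => (f p.1 - f p.2) ^+ 2) = D%:E.
  have e0 : (0 <= energy (fun p => (f p.1 - f p.2) ^+ 2)%R)%E by exact: energy_ge0.
  move: VV e0; rewrite sE vE -!EFinM -EFinD; case: (energy _) => [D| |]// _ _.
  by exists D.
have I0 : (0 <= I)%E.
  by apply: integral_ge0 => x _; rewrite lee_fin mulr_ge0// divr_ge0.
move: VV le1 I0; rewrite sE vE DE; case: I {E1 E2} => [i| |]//; last first.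
  by move=> _ _ _; rewrite leey.
rewrite -!EFinM -!EFinD !lee_fin => -[VV] le1 _.
lra.
Qed.

(** The ground state inequality with [H = green n + 1] reads [A <= v + B n],
    where [v] is the variance, [B n] the integral of [f^2 kern n], and [A] that
    of [f^2 kern 0 / (M + 1)] for a bound [M] of all the [green n].  As the sum
    of the [B n] is at most [M] times the integral of [f^2], the error [B n]
    cannot stay away from 0, whence [A <= v].  And [kern 0] is bounded below on
    the given cube because the characters vary little there. *)
Lemma variance_lower_bound (r N : R) : 0 < r ->
  (\int[leb]_(u in eball r) ((1 - phi u)%:E)^-1 < +oo)%E ->
  exists2 c : R, 0 < c & forall f, test_function f ->
    (c%:E * \int[leb]_(x in box N) (f x ^+ 2)%:E <= Var f)%E.
Proof.
move=> r0 fin_r.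
have half0 : 0 < 2^-1 :> R by rewrite invr_gt0.
(* the window [box b] lies in the ball where 1 / (1 - phi) is integrable *)
have [b b0 [bN br]] := @frequency_window R d N 2^-1 r half0 r0.
have [W W0 WE] := tent_mass_gt0 b0.
pose c := chi b.
have mc : measurable_fun setT c by exact: measurable_chi.
have c0 : forall xi, 0 <= c xi by exact: chi_ge0.
have cX : (\int[leb]_xi (c xi)%:E = (W ^+ d)%:E)%E by exact: chi_mass.
pose X := W ^+ d; have X0 : 0 < X by rewrite exprn_gt0.
have p0 : forall x, 0 <= kern c 0 x by exact: (kern0_ge0 b0 WE).
have mphi := measurable_phi.
have phi1 := phi_norm.
pose ss (u : E) : \bar R := ((1 - phi u)%:E)^-1%E.
have ss0 u : (0 <= ss u)%E by rewrite /ss inve_ge0 lee_fin gap_ge0.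
have mss : measurable_fun setT ss by exact: measurable_gapV.
have mer : measurable (eball r : set E) by exact: measurable_eball.
have mssr : measurable_fun setT (ss \_ (eball r)).
  exact: ((measurable_restrictT _ mer).1 (measurable_funTS mss)).
pose J := (\int[leb]_(u in eball r) ss u)%E.
have J0 : (0 <= J)%E by exact: integral_ge0.
have Jfin : J \is a fin_num by rewrite ge0_fin_numE.
pose M := 2 * b ^+ d * fine J.
have M0 : 0 <= M by rewrite mulr_ge0 ?fine_ge0// mulr_ge0// exprn_ge0// ltW.
pose G n := green c n.
have G0 n x : 0 <= G n x by exact: (green_ge0 mc c0 cX p0).
have mG n : measurable_fun setT (G n) by exact: (measurable_green mc c0 cX).
have mk j : measurable_fun setT (kern c j) by exact: (measurable_kern mc c0 cX).
have k0 j x : 0 <= kern c j x by exact: (kern_ge0 mc c0 cX p0).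
have mgs n : measurable_fun setT (fun xi => c xi * gsum n (phi xi)).
  apply: measurable_funM => //; apply: measurable_sum => j; exact: measurable_funX.
have GM0 n : G n 0 <= M.
  rewrite -lee_fin (green0E mc c0 cX).
  apply: (@le_trans _ _ (\int[leb]_xi ((2 * b ^+ d)%:E * (ss \_ (eball r)) xi))%E).
    apply: ge0_le_integral => //.
    - by move=> xi _; rewrite lee_fin mulr_ge0// gsum_ge0.
    - exact/measurable_EFinP.
    - exact: emeasurable_funM.
    - move=> xi _; have [bxi|nbxi] := pselect (box b xi); last first.
        rewrite /c chi_out// mul0r mule_ge0 ?lee_fin ?mulr_ge0 ?exprn_ge0 ?(ltW b0)//.
        exact: erestrict_ge0.
      rewrite patchE mem_set; last exact: br.
      rewrite mulrC EFinM (mulrC 2) EFinM -muleA muleC.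
      apply: lee_pmul => //.
      + by rewrite lee_fin.
      + by rewrite lee_fin gsum_ge0.
      + by rewrite lee_fin; exact: chi_le.
      + exact: gsum_le.
  rewrite ge0_integralZl_EFin//; last 2 first.
  - by move=> x _; exact: erestrict_ge0.
  - by rewrite mulr_ge0// exprn_ge0// ltW.
  by rewrite -integral_mkcond -/J -(fineK Jfin) -EFinM.
have GM n x : G n x <= M.
  by apply: le_trans (GM0 n); exact: (green_le0 mc c0 cX).
have pN x : box N x -> X / 2 <= kern c 0 x.
  move=> xN; have -> : X / 2 = \int[leb]_xi (2^-1 * c xi).
    rewrite RintegralZl//; last exact: (integrable_chi mc c0 cX).
    by rewrite /Rintegral cX mulrC.
  apply: le_Rintegral => //.
  - by apply: integrableZ_EFin; exact: (integrable_chi mc c0 cX).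
  - exact: (integrable_kern mc c0 cX).
  - move=> xi _; rewrite expr0 mulr1 mulrC.
    have [bxi|nbxi] := pselect (box b xi); last by rewrite /c chi_out// !mul0r.
    by rewrite ler_wpM2l//; have := bN _ _ bxi xN; lra.
exists (X / 2 / (M + 1)); first by rewrite !divr_gt0// ltr_wpDl.
move=> f tf; have [mf _ _] := tf.
have [s s0 sE] := integral_sqr_test tf.
have [v v0 vE] := variance_fine tf.
have msq : measurable_fun setT (fun x : E => f x ^+ 2) by exact: measurable_funX.
have sq0 (x : E) : 0 <= f x ^+ 2 by exact: sqr_ge0.
pose A := (\int[leb]_x (f x ^+ 2 * (kern c 0 x / (M + 1)))%:E)%E.
pose B n := (\int[leb]_x (f x ^+ 2 * kern c n x)%:E)%E.
have A0 : (0 <= A)%E.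
  by apply: integral_ge0 => x _; rewrite lee_fin mulr_ge0// divr_ge0// addr_ge0.
have B0 n : (0 <= B n)%E by apply: integral_ge0 => x _; rewrite lee_fin mulr_ge0.
have mB n : measurable_fun setT (fun x => (f x ^+ 2 * kern c n x)%:E).
  by apply/measurable_EFinP; exact: measurable_funM.
have sumB n : (\sum_(j < n) B j <= (M * s)%:E)%E.
  rewrite /B -ge0_integral_sum//; last by move=> j x _; rewrite lee_fin mulr_ge0.
  rewrite EFinM -sE -ge0_integralZl_EFin//; last 2 first.
  - by move=> x _; rewrite lee_fin.
  - exact/measurable_EFinP.
  apply: ge0_le_integral => //.
  - by move=> x _; apply: sume_ge0 => j _; rewrite lee_fin mulr_ge0.
  - exact: emeasurable_sum.
  - by apply: emeasurable_funM => //; exact/measurable_EFinP.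
  - move=> x _; rewrite sumEFin -EFinM lee_fin -mulr_sumr mulrC ler_wpM2r//.
    exact: GM.
have step n : (A <= v%:E + B n)%E.
  (* adding 1 keeps [H] away from 0, and [T 1 = L] is at most 1 *)
  pose H x := G n x + 1; pose TH x := G n x - kern c 0 x + kern c n x + L.
  have mk2y := measurable_k2Br; have mk2x := measurable_k2Bl.
  have mH : measurable_fun setT H by exact: measurable_funD.
  have mTH : measurable_fun setT TH.
    by apply: measurable_funD => //; apply: measurable_funD => //; exact: measurable_funB.
  have H0 x : 0 < H x by rewrite ltr_wpDl.
  have HTH x : (\int[leb]_y (H y * k2 (y - x))%:E = (TH x)%:E)%E.
    under eq_integral do rewrite mulrDl mul1r EFinD.
    rewrite ge0_integralD//; last 4 first.
    - by move=> y _; rewrite lee_fin mulr_ge0.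
    - by apply/measurable_EFinP; exact: measurable_funM.
    - by move=> y _; rewrite lee_fin.
    - exact/measurable_EFinP.
    rewrite (green_conv mc c0 cX p0).
    rewrite (integral_rV_transl (- x) (F := EFin \o k2)) ?LE//.
    exact/measurable_EFinP.
  have HTH' y : (\int[leb]_x (H x * k2 (y - x))%:E = (TH y)%:E)%E.
    by rewrite -HTH; apply: eq_integral => x _; rewrite -k2_even opprB.
  have TH0 x : 0 <= TH x.
    rewrite -lee_fin -HTH; apply: integral_ge0 => y _.
    by rewrite lee_fin mulr_ge0// ltW.
  have := ground_state tf mH mTH H0 TH0 HTH HTH'; rewrite sE vE => GS.
  set I := (\int[leb]_x (f x ^+ 2 * (TH x / H x))%:E)%E in GS.
  have IAB : (I + A <= s%:E + B n)%E.
    rewrite -sE /I /A /B.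
    have mT : measurable_fun setT (fun x => f x ^+ 2 * (TH x / H x)).
      apply: measurable_funM => //; apply: measurable_funM => //.
      by apply: measurable_funV_ge0 => // x; exact: ltW.
    have mA : measurable_fun setT (fun x => f x ^+ 2 * (kern c 0 x / (M + 1))).
      by apply: measurable_funM => //; exact: measurable_funM.
    have T0 x : (0 <= (f x ^+ 2 * (TH x / H x))%:E)%E.
      by rewrite lee_fin mulr_ge0// divr_ge0// ltW.
    have A0' x : (0 <= (f x ^+ 2 * (kern c 0 x / (M + 1)))%:E)%E.
      by rewrite lee_fin mulr_ge0// divr_ge0// addr_ge0.
    have B0' x : (0 <= (f x ^+ 2 * kern c n x)%:E)%E by rewrite lee_fin mulr_ge0.
    rewrite -ge0_integralD//; last 2 first.
    - exact/measurable_EFinP.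
    - exact/measurable_EFinP.
    rewrite -ge0_integralD//; last 2 first.
    - by move=> x _; rewrite lee_fin.
    - exact/measurable_EFinP.
    apply: ge0_le_integral => //.
    - by move=> x _; rewrite adde_ge0.
    - by apply: emeasurable_funD; exact/measurable_EFinP.
    - by apply: emeasurable_funD => //; exact/measurable_EFinP.
    move=> x _; rewrite -!EFinD lee_fin -mulrDr -[X in _ <= X + _]mulr1 -mulrDr.
    apply: ler_wpM2l => //.
    have Hx := H0 x; have Gx := GM n x; have Gx0 := G0 n x.
    have M1 : 0 < M + 1 by rewrite ltr_wpDl.
    have HM : H x <= M + 1 by rewrite lerD2r.
    have H1 : 1 <= H x by rewrite lerDr.
    have pH : kern c 0 x / (M + 1) <= kern c 0 x / H x.
      by rewrite ler_wpM2l// lef_pV2.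
    apply: le_trans (lerD (lexx _) pH) _.
    rewrite -mulrDl ler_pdivrMr// mulrDl mul1r.
    have kH : kern c n x <= kern c n x * H x by rewrite ler_peMr.
    rewrite {1}/TH {1}/H; have := L_le1; move: kH; rewrite /H; lra.
  have Ifin : (exists i, I = i%:E) \/ I = +oo%E.
    have : (0 <= I)%E.
      by apply: integral_ge0 => x _; rewrite lee_fin mulr_ge0// divr_ge0// ltW.
    by case: (I) => [i| |]// _; [left; exists i|right].
  move: GS IAB; case: Ifin => [[i ->]|->]; last first.
    rewrite addye ?gt_eqF ?(lt_le_trans (ltNyr 0))// => _.
    rewrite leye_eq => /eqP BE; rewrite (_ : B n = +oo%E) ?addey ?leey//.
    by move: BE; case: (B n) (B0 n).
  case: A A0 => [a| |]// _; case: (B n) (B0 n) => [bn| |]//= _.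
  - by rewrite -!EFinD !lee_fin; lra.
  - by move=> _ _; rewrite leey.
have Afin : exists2 a, 0 <= a & A = a%:E.
  have := step 0%N; have : (B 0%N <= (M * s)%:E)%E.
    by have := sumB 1%N; rewrite big_ord_recl big_ord0 adde0.
  case: (B 0%N) (B0 0%N) => [b1| |]// _ _.
  by case: (A) A0 => [a| |]// a0 _; exists a.
have [a a0 aE] := Afin.
have av : a <= v.
  have Bfin j : exists2 bj, 0 <= bj & B j = bj%:E.
    have : (B j <= (M * s)%:E)%E.
      apply: le_trans (sumB j.+1); rewrite big_ord_recr/= leeDr//.
      exact: sume_ge0.
    by case: (B j) (B0 j) => [bj| |]// bj0 _; exists bj.
  (* summing [a <= v + B j] over [j < n] *)
  have nle (n : nat) : n%:R * (a - v) <= M * s.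
    rewrite -lee_fin; apply: le_trans (sumB n).
    rewrite -[n in X in (X <= _)%E]card_ord mulr_natl -sumr_const -sumEFin.
    apply: lee_sum => j _; have := step j.
    have [bj _ ->] := Bfin j.
    by rewrite aE -EFinD !lee_fin; lra.
  rewrite leNgt; apply/negP => va.
  have av0 : 0 < a - v by rewrite subr_gt0.
  have := nle (Num.truncn (M * s / (a - v))).+1.
  rewrite leNgt => /negP; apply; rewrite -ltr_pdivrMr//.
  exact: truncnS_gt.
rewrite vE; apply: (@le_trans _ _ A); last by rewrite aE lee_fin.
rewrite integral_mkcond -ge0_integralZl_EFin//; last 3 first.
- by move=> x _; apply: erestrict_ge0 => y _; rewrite lee_fin.
- apply/(measurable_restrictT _ _).1; first exact: measurable_box.
  by apply: measurable_funTS; exact/measurable_EFinP.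
- by rewrite !divr_ge0 ?(ltW X0)// addr_ge0.
apply: ge0_le_integral => //.
- move=> x _; rewrite mule_ge0 ?lee_fin ?divr_ge0 ?(ltW X0) ?addr_ge0//.
  by apply: erestrict_ge0 => y _; rewrite lee_fin.
- apply: emeasurable_funM => //.
  apply/(measurable_restrictT _ _).1; first exact: measurable_box.
  by apply: measurable_funTS; exact/measurable_EFinP.
- by apply/measurable_EFinP; apply: measurable_funM => //; exact: measurable_funM.
move=> x _; rewrite patchE; case: ifPn => [|_]; last first.
  by rewrite mule0 lee_fin mulr_ge0// divr_ge0// addr_ge0.
rewrite inE => xN; rewrite -EFinM lee_fin mulrC ler_wpM2l//.
by rewrite ler_wpM2r ?invr_ge0 ?addr_ge0// pN.
Qed.

(** * Rigidity when the inverse spectral gap is not integrable *)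

Section spectral_pole_bound.
Hypothesis pole0 : forall r : R, 0 < r ->
  (\int[leb]_(u in eball r) ((1 - phi u)%:E)^-1 = +oo)%E.

Let mphi := measurable_phi.
Let phi1 := phi_norm.

(** Along odd [n] the geometric sums dominate the regularized inverses
    [1 / (1 - phi + 1/n)] ([gsum_ge]), which increase to the non integrable
    [1 / (1 - phi)]. *)
Lemma green_unbounded (b W C : R) : 0 < b ->
  (\int[lebesgue_measure]_t (tent b t)%:E = W%:E)%E ->
  exists n, C < green (chi b) n 0.
Proof.
move=> b0 WE; pose c := chi b.
have mc : measurable_fun setT c by exact: measurable_chi.
have c0 : forall xi, 0 <= c xi by exact: chi_ge0.
have cX : (\int[leb]_xi (c xi)%:E = (W ^+ d)%:E)%E by exact: chi_mass.
pose u n (xi : E) : \bar R := (c xi * (1 - phi xi + n.+1%:R^-1)^-1)%:E.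
have u0 n xi : (0 <= u n xi)%E.
  by rewrite lee_fin mulr_ge0// invr_ge0 addr_ge0// gap_ge0.
have mu n : measurable_fun setT (u n).
  apply/measurable_EFinP; apply: measurable_funM => //.
  apply: measurable_funV_ge0 => [|xi]; last by rewrite addr_ge0// gap_ge0.
  by apply: measurable_funD => //; exact: measurable_funB.
have umono xi : {homo u^~ xi : m n / (m <= n)%N >-> (m <= n)%E}.
  move=> m n mn; rewrite lee_fin ler_wpM2l// lef_pV2 ?posrE ?ltr_wpDl ?gap_ge0//.
  by rewrite lerD2l lef_pV2 ?posrE// ler_nat.
pose s1 (xi : E) : \bar R := (((1 - phi xi)%:E)^-1)%E.
have s10 xi : (0 <= s1 xi)%E by rewrite inve_ge0 lee_fin gap_ge0.
have ms1 : measurable_fun setT s1 by exact: measurable_gapV.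
have ucvg xi : u n xi @[n --> \oo] --> ((c xi)%:E * s1 xi)%E.
  rewrite /u; under eq_fun do rewrite EFinM.
  by apply: cvgeZl => //; exact: cvg_inve_reg (gap_ge0 xi).
have big : (\int[leb]_xi ((c xi)%:E * s1 xi) = +oo)%E.
  apply/eqP; rewrite -leye_eq.
  have b20 : 0 < b / 2 by rewrite divr_gt0.
  have mb : measurable (eball (b / 2) : set E) by exact: measurable_eball.
  have mr : measurable_fun setT (s1 \_ (eball (b / 2))).
    exact: ((measurable_restrictT _ mb).1 (measurable_funTS ms1)).
  apply: (@le_trans _ _ (\int[leb]_xi (((b / 2) ^+ d)%:E * (s1 \_ (eball (b / 2))) xi))%E).
    rewrite ge0_integralZl_EFin//; last 2 first.
    - by move=> x _; exact: erestrict_ge0.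
    - by rewrite exprn_ge0// ltW.
    by rewrite -integral_mkcond pole0// gt0_muley// lte_fin exprn_gt0.
  apply: ge0_le_integral => //.
  - move=> x _; rewrite mule_ge0 ?lee_fin ?exprn_ge0 ?(ltW b20)//;
    exact: erestrict_ge0.
  - exact: emeasurable_funM.
  - by apply: emeasurable_funM => //; exact/measurable_EFinP.
  move=> xi _; rewrite patchE; case: ifPn => [|_]; last by rewrite mule0 mule_ge0 ?lee_fin.
  rewrite inE => /eball_sub_box xib; apply: lee_wpmul2r => //.
  by rewrite lee_fin; exact: chi_ge.
have := @cvg_monotone_convergence _ _ _ leb setT measurableT u
  (fun n => mu n) (fun n x _ => u0 n x) (fun x _ => umono x).
rewrite (_ : (fun x => limn (u^~ x)) = fun xi => ((c xi)%:E * s1 xi)%E); last first.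
  by apply/funext => xi; apply: cvg_lim => //; exact: ucvg.
rewrite big => /cvgeyPge/(_ (C + 1)) [n _ /(_ n (leqnn n)) /= Cn].
exists n.*2.+1; rewrite -lte_fin (green0E mc c0 cX).
apply: (@lt_le_trans _ _ (\int[leb]_x u n x)%E).
  by apply: lt_le_trans Cn; rewrite lte_fin ltrDl.
apply: ge0_le_integral => //.
- apply/measurable_EFinP; apply: measurable_funM => //.
  by apply: measurable_sum => j; exact: measurable_funX.
move=> xi _; apply: (@le_trans _ _ (u n.*2 xi)).
  by apply: umono; rewrite -addnn leq_addr.
by rewrite lee_fin ler_wpM2l// gsum_ge.
Qed.

(** With [F = green n / green n 0] cut off outside a large cube, the function
    [f] equal to 1 on [A] and to [F] elsewhere has a variance of at most
    [\int f^2 - \int\int F F k2], where [F] is almost harmonic.  The three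
    errors, each at most [e / 3], come from replacing [F] by 1 on [A], where [F]
    is at least [1 - q], from the cutoff, and from the defect
    [kern 0 / green n 0] of harmonicity. *)
Lemma variance_small (A : set E) (e : R) : compact A -> 0 < e ->
  exists h : E -> R, [/\ test_function h, (forall x, A x -> h x = 0) &
    (Var (fun x => (\1_A x - h x)%R) <= e%:E)%E].
Proof.
move=> cA e0.
have mA := measurable_compact_rV cA.
have Afin := lebesgue_compact_lty cA.
have [N0 N00 AN0] := compact_sub_box cA.
pose vA := fine (leb A).
have vAE : leb A = vA%:E by rewrite fineK// ge0_fin_numE.
have vA0 : 0 <= vA by rewrite fine_ge0.
(* on A the function F is within q of 1, which costs at most 2 q |A| *)
pose q := Num.min 2^-1 (e / (6 * (vA + 1))).
have q0 : 0 < q by rewrite lt_min invr_gt0/= ltr0n/= divr_gt0// mulr_gt0// ltr_wpDl.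
have q1 : q <= 2^-1 by rewrite ge_min lexx.
have qA : 2 * q * vA <= e / 3.
  have : q <= e / (6 * (vA + 1)) by rewrite ge_min lexx orbT.
  rewrite ler_pdivlMr; last by rewrite mulr_gt0// ltr_wpDl.
  by have := mulr_ge0 (ltW q0) vA0; have := q0; lra.
have [b b0 [bN _]] := @frequency_window R d N0 q 1 q0 ltr01.
have [W W0 WE] := tent_mass_gt0 b0.
pose c := chi b.
have mc : measurable_fun setT c by exact: measurable_chi.
have c0 : forall xi, 0 <= c xi by exact: chi_ge0.
have cX : (\int[leb]_xi (c xi)%:E = (W ^+ d)%:E)%E by exact: chi_mass.
have p0 : forall x, 0 <= kern c 0 x by exact: (kern0_ge0 b0 WE).
pose p := kern c 0.
have mk j : measurable_fun setT (kern c j) by exact: (measurable_kern mc c0 cX).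
have k0 j x : 0 <= kern c j x by exact: (kern_ge0 mc c0 cX p0).
have pfin : (\int[leb]_x (p x)%:E < +oo)%E by exact: (kern0_integral_lty b0 WE).
pose Ip := fine (\int[leb]_x (p x)%:E)%E.
have Ip0 : 0 <= Ip by rewrite fine_ge0// integral_ge0// => x _; rewrite lee_fin p0.
have IpE : (\int[leb]_x (p x)%:E = Ip%:E)%E.
  by rewrite fineK// ge0_fin_numE// integral_ge0// => x _; rewrite lee_fin p0.
(* this makes the mass of [kern 0 / green n 0] at most [e / 3] *)
have [n Cn] := green_unbounded (3 * Ip / e) b0 WE.
pose G := green c n; pose G0 := G 0.
have G00 : 0 < G0.
  by apply: le_lt_trans Cn; rewrite divr_ge0 ?(ltW e0)// mulr_ge0.
have IpG : Ip / G0 <= e / 3.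
  rewrite ler_pdivrMr// mulrAC ler_pdivlMr//.
  by move: Cn => /ltW; rewrite ler_pdivrMr// mulrC (mulrC e).
have Gge0 x : 0 <= G x by exact: (green_ge0 mc c0 cX p0).
have mG : measurable_fun setT G by exact: (measurable_green mc c0 cX).
have ig y := integrable_green mc c0 cX n y.
have GG0 x : G x <= G0 := green_le0 mc c0 cX n x.
have gs0 xi : 0 <= c xi * gsum n (phi xi) by rewrite mulr_ge0// gsum_ge0.
have GA x : A x -> (1 - q) * G0 <= G x.
  move=> Ax; rewrite /G0 /G !(greenE mc c0 cX).
  rewrite -RintegralZl//; apply: le_Rintegral => //.
    exact: integrableZ_EFin.
  move=> xi _; rewrite dot0r cos0 mulr1 mulrC.
  have [bxi|nbxi] := pselect (box b xi); last by rewrite /c chi_out// !mul0r.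
  by rewrite ler_wpM2l//; apply: bN => //; exact: AN0.
pose F x := G x / G0.
have F0 x : 0 <= F x by rewrite divr_ge0// ltW.
have F1 x : F x <= 1 by rewrite ler_pdivrMr// mul1r.
have FA x : A x -> 1 - q <= F x by move=> /GA; rewrite -ler_pdivlMr.
have mF : measurable_fun setT F by exact: measurable_funM.
have Ffin : (\int[leb]_x (F x)%:E < +oo)%E.
  rewrite /F; under eq_integral do rewrite mulrC EFinM.
  rewrite ge0_integralZl_EFin//; last 3 first.
  - by move=> x _; rewrite lee_fin.
  - exact/measurable_EFinP.
  - by rewrite invr_ge0 ltW.
  apply: lte_mul_pinfty => //; first by rewrite lee_fin invr_ge0 ltW.
  exact: (integral_green_lty mc c0 cX p0).
pose IF := fine (\int[leb]_x (F x)%:E)%E.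
have IFE : (\int[leb]_x (F x)%:E = IF%:E)%E.
  by rewrite fineK// ge0_fin_numE// integral_ge0// => x _; rewrite lee_fin.
have [N NN0 NF] : exists2 N, N0 <= N &
    ((IF - e / 3)%:E <= \int[leb]_(x in box N) (F x)%:E)%E.
  have cvI := cvg_integral_box mF F0.
  move: cvI; rewrite IFE => /fine_cvgP[fin_near].
  move=> /cvgrPdist_le/(_ (e / 3)); rewrite divr_gt0// => /(_ isT) near_e.
  have [m [mN mfin me]] : exists m : nat, [/\ N0 <= m%:R,
      (\int[leb]_(x in box m%:R) (F x)%:E)%E \is a fin_num &
      `|IF - fine (\int[leb]_(x in box m%:R) (F x)%:E)%E| <= e / 3].
    have : \forall m \near \oo, N0 <= m%:R :> R /\
        ((\int[leb]_(x in box m%:R) (F x)%:E)%E \is a fin_num /\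
      `|IF - fine (\int[leb]_(x in box m%:R) (F x)%:E)%E| <= e / 3).
      near=> m; split; first by near: m; exact: nbhs_infty_ger.
      by split; near: m.
    by case=> m _ /(_ m (leqnn m)) [? [? ?]]; exists m.
  exists m%:R => //; rewrite -(fineK mfin) lee_fin.
  by move: me; rewrite ler_norml => /andP[_]; lra.
pose B := box N : set E.
have mB : measurable B by exact: measurable_box.
have AB : A `<=` B by apply: subset_trans AN0 _; exact: box_subset.
have m1B : measurable_fun setT (\1_B : E -> R) by exact: measurable_indic.
have m1A : measurable_fun setT (\1_A : E -> R) by exact: measurable_indic.
(* [f] below is 1 on [A] and [FN] outside of it *)
pose FN x := \1_B x * F x.
have mFN : measurable_fun setT FN by exact: measurable_funM.
have FN0 x : 0 <= FN x by rewrite mulr_ge0.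
have FNF x : FN x <= F x.
  by rewrite /FN ler_piMl// indicE lern1 leq_b1.
pose h x := - ((1 - \1_A x) * FN x).
have tFN : test_function FN.
  split => //.
    by exists 1 => x; rewrite ger0_norm//; apply: le_trans (FNF x) (F1 x).
  by exists N => x xN; rewrite /FN indicE memNset// mul0r.
have t1A : test_function (\1_A : E -> R).
  split => //; first by exists 1 => x; rewrite ger0_norm// indicE lern1 leq_b1.
  by exists N0 => x xN; rewrite indicE memNset// => /AN0.
have th : test_function h.
  apply: test_functionN; rewrite (_ : (fun _ => _) = fun x => FN x - \1_A x * FN x).
    by apply: test_functionB => //; exact: test_functionM.
  by apply/funext => x; rewrite mulrBl mul1r.
exists h; split=> // [x Ax|]; first by rewrite /h indicE mem_set// subrr mul0r oppr0.
set f := fun x => \1_A x - h x.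
have tf : test_function f by exact: test_functionB.
have mf : measurable_fun setT f by have [] := tf.
have fE x : f x = FN x + \1_A x * (1 - FN x) by rewrite /f /h; ring.
have FNA x : A x -> FN x = F x.
  by move=> Ax; rewrite /FN indicE mem_set ?mul1r//; exact: AB.
have FN1 x : FN x <= 1 by exact: le_trans (FNF x) (F1 x).
have f0 x : 0 <= f x by rewrite fE addr_ge0// mulr_ge0// subr_ge0.
have FNf x : FN x <= f x by rewrite fE lerDl mulr_ge0// subr_ge0.
have VV := variance_rstat_ge0 tf f0.
have VN := variance_rstat_ge0 tFN FN0.
have [s s0 sE] := integral_sqr_test tf.
have [sN sN0 sNE] := integral_sqr_test tFN.
rewrite sE in VV; rewrite sNE in VN.
have sq (g : E -> R) : measurable_fun setT g ->
  measurable_fun setT (fun x => (g x ^+ 2)%:E).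
  by move=> mg; apply/measurable_EFinP; exact: measurable_funX.
have ssN : s <= sN + e / 3.
  rewrite -lee_fin -sE.
  apply: (@le_trans _ _ (\int[leb]_x ((FN x ^+ 2)%:E + (2 * q)%:E * (\1_A x)%:E))%E).
    apply: ge0_le_integral => //.
    - by move=> x _; rewrite lee_fin sqr_ge0.
    - exact: sq.
    - apply: emeasurable_funD; first exact: sq.
      by apply: emeasurable_funM => //; exact/measurable_EFinP.
    move=> x _; rewrite -EFinM -EFinD lee_fin fE indicE.
    have [|] := boolP (x \in A); last by rewrite mul0r mulr0 !addr0.
    rewrite inE => Ax; rewrite mul1r addrC subrK expr1n mulr1 FNA//.
    by have := FA _ Ax; have := F1 x; nra.
  rewrite ge0_integralD//; last 4 first.
  - by move=> x _; rewrite lee_fin sqr_ge0.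
  - exact: sq.
  - by move=> x _; rewrite -EFinM lee_fin mulr_ge0// mulr_ge0// ltW.
  - by apply: emeasurable_funM => //; exact/measurable_EFinP.
  rewrite sNE ge0_integralZl_EFin//; last 2 first.
  - exact/measurable_EFinP.
  - by rewrite mulr_ge0// ltW.
  by rewrite integral_indic// setIT/= vAE -EFinM -EFinD lee_fin lerD2l.
have mxy (g g' : E -> R) : measurable_fun setT g -> measurable_fun setT g' ->
  measurable_fun setT (fun p : E * E => g p.1 * g' p.2).
  move=> mg mg'; apply: measurable_funM;
    [exact: (measurableT_comp mg measurable_fst)|
     exact: (measurableT_comp mg' measurable_snd)].
have eNf : (energy (fun p => FN p.1 * FN p.2)%R <= energy (fun p => f p.1 * f p.2)%R)%E.
  apply: le_energy => //.
  - exact: mxy.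
  - exact: mxy.
  - by move=> y; rewrite mulr_ge0.
  - by move=> y; apply: ler_pM.
have mF' : measurable_fun setT (fun x => F x - FN x) by exact: measurable_funB.
have F'0 x : 0 <= F x - FN x by rewrite subr_ge0.
have tail : (\int[leb]_x (F x - FN x)%:E <= (e / 3)%:E)%E.
  have : (\int[leb]_x (F x - FN x)%:E + \int[leb]_(x in B) (F x)%:E = IF%:E)%E.
    rewrite [X in (_ + X)%E]integral_mkcond -IFE -ge0_integralD//.
    - apply: eq_integral => x _; rewrite patchE /FN indicE; case: ifPn => _.
        by rewrite mul1r subrr add0e.
      by rewrite mul0r subr0 adde0.
    - by move=> x _; rewrite lee_fin.
    - exact/measurable_EFinP.
    - by move=> x _; apply: erestrict_ge0 => y _; rewrite lee_fin.
    - apply: ((measurable_restrictT _ mB).1); apply: measurable_funTS.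
      exact/measurable_EFinP.
  have : (0 <= \int[leb]_x (F x - FN x)%:E)%E.
    by apply: integral_ge0 => x _; rewrite lee_fin.
  move: NF; rewrite -/B; case: (\int[leb]_(x in B) _)%E => [i| |]//.
  - case: (\int[leb]_x _)%E => [t| |]//; rewrite -EFinD !lee_fin => ? _ [].
    by lra.
  - by case: (\int[leb]_x _)%E.
have key : (sN%:E <= energy (fun p => FN p.1 * FN p.2)%R + (e / 3 + e / 3)%:E)%E.
  have TF x : (\int[leb]_y (F y * k2 (y - x))%:E = ((G x - p x + kern c n x) / G0)%:E)%E.
    transitivity (\int[leb]_y ((G0^-1)%:E * (G y * k2 (y - x))%:E))%E.
      by apply: eq_integral => y _; rewrite -EFinM; congr EFin; rewrite /F; ring.
    rewrite ge0_integralZl_EFin//; last 3 first.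
    - by move=> y _; rewrite lee_fin mulr_ge0.
    - apply/measurable_EFinP; apply: measurable_funM => //.
      exact: measurable_k2Br.
    - by rewrite invr_ge0 ltW.
    rewrite (green_conv mc c0 cX p0).
    by rewrite -EFinM mulrC.
  have e1 : (sN%:E <= energy (fun y => FN y.1 * F y.2)%R + (e / 3)%:E)%E.
    apply: (@le_trans _ _ (energy (fun y => FN y.1 * F y.2)%R + (Ip / G0)%:E)%E); last first.
      by rewrite leeD2l// lee_fin.
    rewrite -sNE energyE//; last 2 first.
    - exact: mxy.
    - by move=> y; rewrite mulr_ge0.
    have -> : ((Ip / G0)%:E = \int[leb]_x (p x / G0)%:E)%E.
      under eq_integral do rewrite mulrC EFinM.
      rewrite ge0_integralZl_EFin//; last 3 first.
      - by move=> x _; rewrite lee_fin p0.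
      - by apply/measurable_EFinP; exact: mk.
      - by rewrite invr_ge0 ltW.
      by rewrite IpE -EFinM mulrC.
    have mGp : measurable_fun setT (fun x => (G x - p x + kern c n x) / G0).
      apply: measurable_funM => //; apply: measurable_funD; last exact: mk.
      by apply: measurable_funB => //; exact: mk.
    have E1 : (fun x => \int[leb]_y (FN x * F y * k2 (y - x))%:E)%E =
        (fun x => (FN x * ((G x - p x + kern c n x) / G0))%:E).
      apply/funext => x; under eq_integral do rewrite -mulrA EFinM.
      rewrite ge0_integralZl_EFin//; last 2 first.
      - by move=> y _; rewrite lee_fin mulr_ge0.
      - apply/measurable_EFinP; apply: measurable_funM => //.
        exact: measurable_k2Br.
      by rewrite TF -EFinM.
    rewrite /= E1 -ge0_integralD//; last 4 first.
    - move=> x _; move/(congr1 (fun g => g x)) : E1 => /= <-.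
      by apply: integral_ge0 => y _; rewrite lee_fin (mulr_ge0 (mulr_ge0 (FN0 x) (F0 y)) (k2_ge0 _)).
    - by apply/measurable_EFinP; exact: measurable_funM.
    - by move=> x _; rewrite lee_fin divr_ge0// ltW.
    - by apply/measurable_EFinP; apply: measurable_funM => //; exact: mk.
    apply: ge0_le_integral => //.
    - by move=> x _; rewrite lee_fin sqr_ge0.
    - exact: sq.
    - apply: emeasurable_funD; apply/measurable_EFinP.
        exact: measurable_funM.
      by apply: measurable_funM => //; exact: mk.
    move=> x _; rewrite -EFinD lee_fin.
    have kk := k0 n x; have px := p0 x; have FNx := FN0 x; have FN1x := FN1 x.
    have step1 : FN x ^+ 2 <= FN x * F x by rewrite expr2 ler_wpM2l.
    apply: le_trans step1 _.
    have FE : F x = (G x - p x + kern c n x) / G0 + (p x / G0 - kern c n x / G0).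
      by rewrite /F; field; rewrite gt_eqF.
    rewrite {1}FE mulrDr lerD2l mulrBr.
    apply: (@le_trans _ _ (FN x * (p x / G0))).
      by rewrite gerBl mulr_ge0// divr_ge0// ltW.
    by rewrite ler_piMl// divr_ge0// ltW.
  have e2 : (energy (fun y => FN y.1 * F y.2)%R <=
      energy (fun p => FN p.1 * FN p.2)%R + (e / 3)%:E)%E.
    have -> : energy (fun y => FN y.1 * F y.2)%R =
        (energy ((fun p => FN p.1 * FN p.2)%R \+ (fun p => FN p.1 * (F p.2 - FN p.2)))%R)%E.
      by congr energy; apply/funext => y /=; rewrite -mulrDr addrC subrK.
    rewrite energyD//; last 4 first.
    - exact: mxy.
    - exact: (mxy FN (fun x => F x - FN x)).
    - by move=> y; rewrite mulr_ge0.
    - by move=> y; rewrite mulr_ge0.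
    rewrite leeD2l//; apply: le_trans tail.
    apply: (@le_trans _ _ (energy ((fun x => F x - FN x) \o snd))).
      apply: le_energy => //.
      - exact: (mxy FN (fun x => F x - FN x)).
      - exact: (measurableT_comp mF' measurable_snd).
      - by move=> y; rewrite mulr_ge0.
      - by move=> y /=; rewrite ler_piMl.
    rewrite energy_snd// LE -[leRHS]mul1e lee_wpmul2r ?lee_fin//.
    by apply: integral_ge0 => x _; rewrite lee_fin.
  apply: le_trans e1 _; rewrite EFinD addeA leeD2r//.
have [v v0 vE] := variance_fine tf.
move: VV VN key eNf; rewrite vE.
have ef0 : (0 <= energy (fun p => f p.1 * f p.2)%R)%E.
  by apply: energy_ge0 => // y; rewrite mulr_ge0.
have eN0 : (0 <= energy (fun p => FN p.1 * FN p.2)%R)%E.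
  by apply: energy_ge0 => // y; rewrite mulr_ge0.
move: ef0 eN0; case: (energy (fun p => f p.1 * f p.2)%R) => [ef| |]// _.
case: (energy _) => [eN| |]// _.
rewrite -!EFinD => -[VV] _; rewrite !lee_fin => key eNf.
lra.
Unshelve. all: by end_near. Qed.

End spectral_pole_bound.

(** * Nonconstant polynomials *)

Definition dirichlet (f : E -> R) (z : E) : \bar R :=
  (\int[leb]_x ((f x - f (x + z)) ^+ 2)%:E)%E.

Lemma dirichlet_ge0 f z : (0 <= dirichlet f z)%E.
Proof. by apply: integral_ge0 => x _; rewrite lee_fin sqr_ge0. Qed.

Lemma measurable_increment (f : E -> R) : measurable_fun setT f ->
  measurable_fun setT (fun p : E * E => (f p.1 - f (p.1 + p.2)%R) ^+ 2).
Proof.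
move=> mf; apply: measurable_funX; apply: measurable_funB.
  exact: (measurableT_comp mf measurable_fst).
exact: (measurableT_comp mf (measurable_funrVD measurable_fst measurable_snd)).
Qed.

Lemma measurable_increment_at (f : E -> R) w : measurable_fun setT f ->
  measurable_fun setT (fun x => (f x - f (x + w)) ^+ 2).
Proof.
move=> mf; apply: measurable_funX; apply: measurable_funB => //.
exact: (measurableT_comp mf (measurable_funrVD (@measurable_id _ _ setT) (measurable_cst w))).
Qed.

Lemma measurable_dirichlet f : measurable_fun setT f ->
  measurable_fun setT (dirichlet f).
Proof.
move=> mf; apply: (measurable_fun_fubini_tonelli_G
  (fun p : E * E => ((f p.1 - f (p.1 + p.2)%R) ^+ 2)%:E)) => [|p].
  by apply/measurable_EFinP; exact: measurable_increment.
by rewrite lee_fin sqr_ge0.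
Qed.

(** [f(x) - f(x + z' - z)] is, up to a translation, the difference of the
    increments along [z'] and [z]. *)
Lemma dirichlet_sub f z z' : measurable_fun setT f ->
  (dirichlet f (z' - z) <= 2%:E * dirichlet f z + 2%:E * dirichlet f z')%E.
Proof.
move=> mf.
have mE w : measurable_fun setT (fun x => ((f x - f (x + w)) ^+ 2)%:E).
  by apply/measurable_EFinP; exact: measurable_increment_at.
rewrite /dirichlet -(integral_rV_transl z (mE _)); last first.
  by move=> x; rewrite lee_fin sqr_ge0.
rewrite -!ge0_integralZl_EFin//; try by move=> x _; rewrite lee_fin sqr_ge0.
rewrite -ge0_integralD//; last 4 first.
- by move=> x _; rewrite -EFinM lee_fin mulr_ge0// sqr_ge0.
- exact: emeasurable_funM.
- by move=> x _; rewrite -EFinM lee_fin mulr_ge0// sqr_ge0.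
- exact: emeasurable_funM.
apply: ge0_le_integral => //.
- by move=> x _; rewrite lee_fin sqr_ge0.
- exact: (measurableT_comp (mE _) (measurable_funrVD (@measurable_id _ _ setT) (measurable_cst z))).
- by apply: emeasurable_funD; exact: emeasurable_funM.
move=> x _; rewrite -!EFinM -EFinD lee_fin -addrA (addrC z) subrK.
by have := sqr_ge0 (f x - f (x + z) + (f x - f (x + z'))); lra.
Qed.

Lemma dirichlet_le_variance f : test_function f ->
  (\int[leb]_z ((k2 z)%:E * dirichlet f z) <= 2%:E * Var f)%E.
Proof.
move=> tf; have [mf _ _] := tf.
have -> : (\int[leb]_z ((k2 z)%:E * dirichlet f z) =
    energy (fun p => (f p.1 - f p.2) ^+ 2)%R)%E.
  rewrite energyE//; last 2 first.
  - apply: measurable_funX; apply: measurable_funB.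
      exact: (measurableT_comp mf measurable_fst).
    exact: (measurableT_comp mf measurable_snd).
  - by move=> p; exact: sqr_ge0.
  transitivity (\int[leb]_z \int[leb]_x ((f x - f (x + z)%R) ^+ 2 * k2 z)%:E)%E.
    apply: eq_integral => z _; rewrite /dirichlet -ge0_integralZl_EFin//.
    - by apply: eq_integral => x _; rewrite mulrC.
    - by move=> x _; rewrite lee_fin sqr_ge0.
    - apply/measurable_EFinP.
      exact: (measurable_increment_at z mf).
  rewrite -(@fubini_tonelli _ _ _ _ _ leb leb
    (fun p : E * E => ((f p.1 - f (p.1 + p.2)%R) ^+ 2 * k2 p.2)%:E)) => [||p]; last 2 first.
  - apply/measurable_EFinP; apply: measurable_funM; first exact: measurable_increment.
    exact: (measurableT_comp mk2 measurable_snd).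
  - by rewrite lee_fin mulr_ge0// sqr_ge0.
  apply: eq_integral => x _ /=.
  rewrite -[RHS](integral_rV_transl x).
  - by apply: eq_integral => z _; rewrite (addrC z) addrAC subrr add0r.
  - apply/measurable_EFinP; apply: measurable_funM.
      by apply: measurable_funX; apply: measurable_funB.
    exact: (measurableT_comp mk2 (measurable_funrVB (@measurable_id _ _ setT) (measurable_cst x))).
  - by move=> y; rewrite lee_fin mulr_ge0// sqr_ge0.
have := variance_rstat tf.
have [s s0 ->] := integral_sqr_test tf.
have [v v0 ->] := variance_fine tf.
case: (energy _) => [t| |]//; rewrite -!EFinM -!EFinD => -[].
by rewrite lee_fin; have := ler_wpM2r s0 L_le1; lra.
Qed.

(** The increments along two nearby vectors [z] and [z'] charged by [k2] control
    the increment along the short vector [z' - z], which for [f] is that of [F]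
    within a cube contained in [A].  The resulting lower bound [c1] depends on
    [F] only; it is positive since an increment of [F] is a polynomial in the
    base point, and in the vector a polynomial which is not identically zero. *)
Lemma variance_lower_nonconstant (F : E -> R) (A : set E) (x1 : E) :
  line_polynomial F -> F x1 != F 0 -> (interior A) !=set0 -> 0 < L ->
  exists2 c : R, 0 < c & forall f, test_function f ->
    (forall x, A x -> f x = F x) -> (c%:E <= Var f)%E.
Proof.
move=> pF Fx1 /interior_sub_cube[a [r r0 BA]] L0.
have mF := pF.1.
(* a point of the cube of half side r / 2 moved by less than r / 2 stays in A *)
pose rho := r / 2; have rho0 : 0 < rho by rewrite divr_gt0.
pose B : set E := [set x | box rho (x - a)].
have mB : measurable B by exact: measurable_cube.
have m1B : measurable_fun setT (\1_B : E -> R) by exact: measurable_indic.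
have [m [mm mk mpos mbox]] : exists m : E -> R, [/\ measurable_fun setT m,
    (forall z, 0 <= m z <= k2 z), (0 < \int[leb]_z (m z)%:E)%E &
    (forall z z', m z != 0 -> m z' != 0 -> box rho (z' - z))].
  by apply: localize_mass => //; rewrite LE lte_fin.
have m0 z : 0 <= m z by case/andP: (mk z).
have mmE : measurable_fun setT (EFin \o m) by exact/measurable_EFinP.
pose J w := (\int[leb]_y ((\1_B y)%:E * ((F y - F (y + w)) ^+ 2)%:E))%E.
have J0 w : (0 <= J w)%E.
  by apply: integral_ge0 => y _; rewrite -EFinM lee_fin mulr_ge0// sqr_ge0.
have mJ : measurable_fun setT J.
  apply: (measurable_fun_fubini_tonelli_G (fun p : E * E =>
    ((\1_B p.1)%:E * ((F p.1 - F (p.1 + p.2)%R) ^+ 2)%:E)%E)) => [|p].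
    apply: emeasurable_funM; apply/measurable_EFinP.
      exact: (measurableT_comp m1B measurable_fst).
    exact: measurable_increment.
  by rewrite -EFinM lee_fin mulr_ge0// sqr_ge0.
have mFz w := measurable_increment_at w mF.
have Jpos w : F w != F 0 -> (0 < J w)%E.
  move=> Fw; apply: weighted_integral_gt0 => //.
  - exact/measurable_EFinP.
  - by move=> y; rewrite lee_fin sqr_ge0.
  - by rewrite integral_indic// setIT; exact: lebesgue_cube_gt0.
  have pG : line_polynomial (fun y => F y - F (y + w)).
    by apply: line_polynomialB => //; exact: line_polynomial_transl.
  apply: filterS (ae_line_polynomial_neq0 (x0 := 0) pG _) => [y Gy|].
    by rewrite eqe sqrf_eq0.
  by rewrite add0r subr_eq0 eq_sym.
pose g z := (\int[leb]_z' ((m z')%:E * J (z' - z)%R))%E.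
have mdiff : measurable_fun setT (fun p : E * E => J (p.2 - p.1)).
  exact: (measurableT_comp mJ (measurable_funrVB measurable_snd measurable_fst)).
have mJz (z : E) : measurable_fun setT (fun z' : E => J (z' - z)).
  exact: (measurableT_comp mJ (measurable_funrVB (@measurable_id _ _ setT) (measurable_cst z))).
have g0 z : (0 <= g z)%E by apply: integral_ge0 => z' _; rewrite mule_ge0 ?lee_fin.
have mg : measurable_fun setT g.
  apply: (measurable_fun_fubini_tonelli_F (fun p : E * E =>
    ((m p.2)%:E * J (p.2 - p.1)%R)%E)) => [|p].
    apply: emeasurable_funM => //.
    exact: (measurableT_comp mmE measurable_snd).
  by rewrite mule_ge0 ?lee_fin.
have gpos z : (0 < g z)%E.
  apply: weighted_integral_gt0 => //.
  have pG : line_polynomial (fun y => F (y - z) - F 0).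
    by apply: line_polynomialB; [exact: line_polynomial_transl|exact: line_polynomial_cst].
  apply: filterS (ae_line_polynomial_neq0 (x0 := x1 + z) pG _) => [y|]; last by rewrite addrK subr_eq0.
  by rewrite subr_eq0 => /Jpos; rewrite lt0e => /andP[].
pose c1 := (\int[leb]_z ((m z)%:E * g z))%E.
have c1pos : (0 < c1)%E.
  apply: weighted_integral_gt0 => //.
  by apply: filterE => z; have := gpos z; rewrite lt0e => /andP[].
have [c c0 cc1] := real_below c1pos.
exists (c / 8); first by rewrite divr_gt0.
move=> f tf fF; have [mf _ _] := tf.
have D0 := dirichlet_ge0 f; have mD := measurable_dirichlet mf.
have mass : (\int[leb]_z (m z)%:E <= 1)%E.
  apply: (@le_trans _ _ L%:E); last by rewrite lee_fin.
  rewrite -LE; apply: ge0_le_integral => //.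
  - by move=> z _; rewrite lee_fin.
  - exact/measurable_EFinP.
  - by move=> z _; rewrite lee_fin; case/andP: (mk z).
have JD w : box rho w -> (J w <= dirichlet f w)%E.
  move=> bw; apply: ge0_le_integral => //.
  - by move=> y _; rewrite -EFinM lee_fin mulr_ge0// sqr_ge0.
  - by apply: emeasurable_funM; exact/measurable_EFinP.
  - apply/measurable_EFinP.
    exact: (measurable_increment_at w mf).
  move=> y _; rewrite -EFinM lee_fin indicE.
  have [|_] := boolP (y \in B); last by rewrite mul0r sqr_ge0.
  rewrite inE => yB; rewrite mul1r !fF//; apply: BA => i.
    rewrite !mxE; have := bw i; have := yB i; rewrite !mxE.
    rewrite !ler_norml /rho => /andP[? ?] /andP[? ?]; apply/andP; split; lra.
  by apply: le_trans (yB i) _; rewrite /rho; lra.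
pose X := (\int[leb]_z ((m z)%:E * dirichlet f z))%E.
have mX : measurable_fun setT (fun z => (m z)%:E * dirichlet f z)%E.
  exact: emeasurable_funM.
have mD0 z : (0 <= (m z)%:E * dirichlet f z)%E by rewrite mule_ge0 ?lee_fin.
have X0 : (0 <= X)%E by exact: integral_ge0.
have XV : (X <= 2%:E * Var f)%E.
  apply: le_trans (dirichlet_le_variance tf); apply: ge0_le_integral => //.
  - by apply: emeasurable_funM => //; exact/measurable_EFinP.
  - by move=> z _; rewrite lee_wpmul2r// lee_fin; case/andP: (mk z).
have gX z : m z != 0 -> (g z <= 2%:E * dirichlet f z + 2%:E * X)%E.
  move=> mz; apply: (@le_trans _ _ (\int[leb]_z' ((2%:E * dirichlet f z) * (m z')%:E +
      2%:E * ((m z')%:E * dirichlet f z')))%E).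
    apply: ge0_le_integral => //.
    - by move=> z' _; rewrite mule_ge0 ?lee_fin.
    - exact: emeasurable_funM.
    - apply: emeasurable_funD; exact: emeasurable_funM.
    move=> z' _; have [->|mz'] := eqVneq (m z') 0; first by rewrite mule0 !mul0e mule0 adde0.
    rewrite muleCA (muleC _ (m z')%:E) -ge0_muleDr ?mule_ge0//.
    rewrite lee_wpmul2l ?lee_fin//; apply: le_trans (JD _ (mbox _ _ mz mz')) _.
    exact: dirichlet_sub.
  rewrite ge0_integralD//; last 4 first.
  - by move=> z' _; rewrite !mule_ge0 ?lee_fin.
  - exact: emeasurable_funM.
  - by move=> z' _; rewrite mule_ge0.
  - exact: emeasurable_funM.
  rewrite !ge0_integralZl//; last 2 first.
  - by move=> z' _; rewrite lee_fin.
  - by rewrite mule_ge0.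
  by rewrite leeD2r// -[leRHS]mule1 lee_wpmul2l ?mule_ge0.
have c1X : (c1 <= 4%:E * X)%E.
  apply: (@le_trans _ _ (\int[leb]_z (2%:E * ((m z)%:E * dirichlet f z) + (2%:E * X) * (m z)%:E))%E).
    apply: ge0_le_integral => //.
    - by move=> z _; apply: mule_ge0; [rewrite lee_fin|exact: g0].
    - exact: emeasurable_funM.
    - apply: emeasurable_funD; exact: emeasurable_funM.
    move=> z _; have [->|mz] := eqVneq (m z) 0; first by rewrite !mul0e !mule0 adde0.
    rewrite muleCA (muleC _ (m z)%:E) -ge0_muleDr ?mule_ge0//.
    by rewrite lee_wpmul2l ?lee_fin//; exact: gX.
  rewrite ge0_integralD//; last 4 first.
  - by move=> z' _; rewrite mule_ge0.
  - exact: emeasurable_funM.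
  - by move=> z' _; rewrite !mule_ge0 ?lee_fin.
  - exact: emeasurable_funM.
  rewrite !ge0_integralZl//; last 2 first.
  - by move=> z' _; rewrite lee_fin.
  - by rewrite mule_ge0.
  have -> : (4%:E = 2%:E + 2%:E :> \bar R)%E by rewrite -EFinD; congr EFin; lra.
  rewrite ge0_muleDl// leeD2l//.
  by rewrite -[leRHS]mule1 lee_wpmul2l ?mule_ge0.
have [v v0 vE] := variance_fine tf.
have : (c%:E <= 4%:E * (2%:E * v%:E))%E.
  apply: le_trans cc1 _; apply: le_trans c1X _.
  by rewrite lee_wpmul2l// -vE.
by rewrite vE -!EFinM !lee_fin; lra.
Qed.

(** * The spectral gap near the origin *)

(** [1 - phi] is at least the integral of [(1 - cos<u, z>) k2(z)].  Restricting
    [k2] to a bounded part [m] of its mass keeps [<u, z>] in the range where the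
    cosine is controlled by its quadratic approximation. *)
Lemma gap_quadratic : 0 < L -> exists r c : R, [/\ 0 < r, 0 < c &
  forall (u : E) i, box r u -> c * u ord0 i ^+ 2 <= 1 - phi u].
Proof.
move=> L0.
have [m [mm mk mpos mbox]] : exists m : E -> R, [/\ measurable_fun setT m,
    (forall z, 0 <= m z <= k2 z), (0 < \int[leb]_z (m z)%:E)%E &
    (forall z z', m z != 0 -> m z' != 0 -> box 1 (z' - z))].
  by apply: localize_mass => //; rewrite LE lte_fin.
have m0 z : 0 <= m z by case/andP: (mk z).
have [z1 mz1] : exists z1, m z1 != 0.
  apply: contrapT => /forallNP m_eq0; move: mpos.
  rewrite integral0_eq ?ltxx// => z _; congr EFin.
  by apply/eqP/negPn/negP; exact: m_eq0.
pose M := `|z1| + 1.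
have mM z : m z != 0 -> box M z.
  move=> mz i; have := mbox _ _ mz1 mz i; rewrite !mxE => h.
  rewrite -(subrK (z1 ord0 i) (z ord0 i)); apply: le_trans (ler_normD _ _) _.
  by rewrite /M addrC lerD// norm_coord_le.
have im : leb.-integrable setT (EFin \o m).
  apply: le_integrable (integrable_k2) => //.
    exact/measurable_EFinP.
  by move=> z _; rewrite /= lee_fin !ger0_norm//; case/andP: (mk z).
have [c c0 cP] := second_moment_definite mm m0 im mM mpos.
have [t0 t00 cosP] := @cos_le_quadratic R.
have M0 : 0 < M by rewrite ltr_wpDl.
pose r := t0 / ((d%:R + 1) * M).
have d1 : 0 < d%:R + 1 :> R by rewrite ltr_wpDl.
have r0 : 0 < r by rewrite divr_gt0// mulr_gt0.
exists r, (c / 8); split => //; first by rewrite divr_gt0.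
move=> u i ur; apply: (@le_trans _ _ (L - phi u)); last by rewrite lerD2r.
rewrite -lee_fin -(integral_1Bcos).
rewrite (mulrC c) -mulrA EFinM.
apply: (@le_trans _ _ ((8^-1)%:E * \int[leb]_z ((dot u z) ^+ 2 * m z)%:E)%E).
  by rewrite lee_wpmul2l// ?lee_fin ?invr_ge0//.
have mdot : measurable_fun setT (dot u).
  exact: (measurable_fun_dot (measurable_cst u) (@measurable_id _ _ setT)).
rewrite -ge0_integralZl_EFin//; last 2 first.
- by move=> z _; rewrite lee_fin mulr_ge0// sqr_ge0.
- apply/measurable_EFinP; apply: measurable_funM => //.
  exact: measurable_funX.
apply: ge0_le_integral => //.
- by move=> z _; rewrite -EFinM lee_fin mulr_ge0 ?invr_ge0// mulr_ge0// sqr_ge0.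
- apply: emeasurable_funM => //; apply/measurable_EFinP; apply: measurable_funM => //.
  exact: measurable_funX.
- apply/measurable_EFinP; apply: measurable_funM => //; apply: measurable_funB => //.
  exact: (measurable_cos_dot (measurable_cst u) (@measurable_id _ _ setT)).
move=> z _; rewrite -EFinM lee_fin mulrA (mulrC 8^-1).
have [->|mz] := eqVneq (m z) 0.
  by rewrite mulr0 mulr_ge0// subr_ge0 cos_le1.
apply: ler_pM => //.
- by rewrite divr_ge0// sqr_ge0.
- apply: cosP; apply: le_trans (dot_box (ltW r0) ur (mM _ mz)) _.
  have -> : d%:R * r * M = d%:R * t0 / (d%:R + 1).
    by rewrite /r; field; rewrite !gt_eqF.
  by rewrite ler_pdivrMr// mulrC ler_wpM2l ?(ltW t00)// lerDl.
- by case/andP: (mk z).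
Qed.

(** No monomial other than 1 creates a pole: it vanishes at 0 at least as fast
    as one of the coordinates, hence its square is at most of the order of
    [1 - phi]. *)
Lemma gap_weighted_lty (w : E -> R) (i : 'I_d) : 0 < L ->
  measurable_fun setT w -> (forall u, 0 <= w u) ->
  (forall u, box 1 u -> w u <= u ord0 i ^+ 2) ->
  exists2 e : R, 0 < e &
  (\int[leb]_(u in eball e) ((w u)%:E * ((1 - phi u)%:E)^-1) < +oo)%E.
Proof.
move=> L0 mw w0 wi; have [r [c [r0 c0 rP]]] := gap_quadratic L0.
pose e := Num.min r 1.
have e0 : 0 < e by rewrite lt_min r0 ltr01.
exists e => //.
have me : measurable (eball e : set E) by exact: measurable_eball.
have gap0 u : 0 <= 1 - phi u.
  by rewrite subr_ge0 (le_trans (ler_norm _))// (phi_norm).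
have sub : (eball e : set E) `<=` box e by move=> u; exact: eball_sub_box.
apply: (@le_lt_trans _ _ (\int[leb]_(u in eball e) (c^-1)%:E)%E); last first.
  rewrite integral_cst// lte_mul_pinfty ?lee_fin ?invr_ge0 ?(ltW c0)//.
  apply: le_lt_trans (lebesgue_box_lty e).
  by apply: le_measure => //; rewrite inE//; exact: measurable_box.
apply: ge0_le_integral => //.
- by move=> u _; rewrite mule_ge0 ?lee_fin// inve_ge0 lee_fin.
- apply: measurable_funTS; apply: emeasurable_funM; first exact/measurable_EFinP.
  apply: measurable_inve_ge0 => //; apply: measurable_funB => //.
  exact: (measurable_phi).
move=> u /sub ue.
have wu : w u <= u ord0 i ^+ 2.
  by apply: wi; apply: box_subset ue; rewrite ge_min lexx orbT.
have cu : c * u ord0 i ^+ 2 <= 1 - phi u.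
  by apply: rP; apply: box_subset ue; rewrite ge_min lexx.
have [->|wpos] := eqVneq (w u) 0; first by rewrite mul0e lee_fin invr_ge0 ltW.
have {}wpos : 0 < w u by rewrite lt_neqAle eq_sym wpos w0.
have gpos : 0 < 1 - phi u.
  by apply: lt_le_trans cu; rewrite mulr_gt0// (lt_le_trans wpos).
rewrite inver gt_eqF// -EFinM lee_fin ler_pdivrMr// mulrC ler_pdivlMr//.
by rewrite mulrC; apply: le_trans cu; rewrite ler_wpM2l// ltW.
Qed.

(** * The dichotomy *)

Section rigidity.
Import (canonicals, coercions) mpoly.
Variable A : set E.
Hypothesis A_body : convex_body A.
Local Notation s := (fun u => 1 - phi u).
Implicit Types (Q : mpoly.mpoly d R[i]) (k : mpoly.multinom d).

Let cA : compact A. Proof. by case: A_body. Qed.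
Let iA : (interior A) !=set0. Proof. by case: A_body. Qed.

Lemma not_rigid_integrable Q (r : R) : Q != 0 -> 0 < r ->
  (\int[leb]_(u in eball r) ((s u)%:E)^-1 < +oo)%E ->
  ~ linearly_rigid P Phi Q A.
Proof.
move=> Q0 r0 fin_r.
have [x0 Qx0] := poly_eval_neq0 Q0.
have [N _ AN] := compact_sub_box cA.
have [c c0 cV] := variance_lower_bound N r0 fin_r.
have [a [rho rho0 BA]] := interior_sub_cube iA.
pose B : set E := [set x | box rho (x - a)].
have mB : measurable B by exact: measurable_cube.
have key (F : E -> R) : line_polynomial F -> F x0 != 0 ->
  exists2 e : R, 0 < e & forall f : E -> R, test_function f ->
    (forall x, A x -> f x = F x) -> (e%:E <= 'V_P[rstat Phi f])%E.
  move=> pF Fx0; have mF := pF.1.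
  pose J := (\int[leb]_x ((\1_B x)%:E * (F x ^+ 2)%:E))%E.
  have m1B : measurable_fun setT (\1_B : E -> R) by exact: measurable_indic.
  have mF2 : measurable_fun setT (fun x => (F x ^+ 2)%:E).
    by apply/measurable_EFinP; exact: measurable_funX.
  have J0 : (0 < J)%E.
    apply: weighted_integral_gt0 => //.
    - by move=> x; rewrite lee_fin sqr_ge0.
    - by rewrite integral_indic// setIT; exact: lebesgue_cube_gt0.
    by apply: filterS (ae_line_polynomial_neq0 pF Fx0) => x; rewrite eqe sqrf_eq0.
  have [e e0 eJ] := real_below J0.
  exists (c * e); first exact: mulr_gt0.
  move=> f tf fF; apply: le_trans (cV _ tf).
  rewrite EFinM lee_wpmul2l ?lee_fin ?(ltW c0)//; apply: le_trans eJ _.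
  have [mf _ _] := tf.
  have mBox : measurable (box N : set E) by exact: measurable_box.
  have mf2 : measurable_fun setT (fun x => (f x ^+ 2)%:E).
    by apply/measurable_EFinP; exact: measurable_funX.
  rewrite [leRHS]integral_mkcond; apply: ge0_le_integral => //.
  - by move=> x _; rewrite -EFinM lee_fin mulr_ge0// sqr_ge0.
  - by apply: emeasurable_funM => //; exact/measurable_EFinP.
  - exact: ((measurable_restrictT _ mBox).1 (measurable_funTS mf2)).
  move=> x _; rewrite -EFinM indicE patchE.
  have [|_] := boolP (x \in B); last first.
    by rewrite mul0r; case: ifP => _; rewrite lee_fin ?sqr_ge0.
  rewrite inE => /BA Ax; rewrite mul1r mem_set ?fF//.
  exact: AN.
have V0 f : (0 <= 'V_P[rstat Phi f])%E by exact: variance_ge0.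
have [Re0|Re0] := eqVneq (complex.Re (poly_eval Q x0)) 0.
  have Im0 : complex.Im (poly_eval Q x0) != 0.
    by apply: contraNneq Qx0 => Im0; rewrite (complex_eq0 Re0 Im0).
  have [e e0 eV] := key _ (line_polynomial_Im Q) Im0.
  apply: (not_rigid_lower_bound Phi_spp cA e0) => f g _ tg _ gA.
  by rewrite -[leLHS]add0e leeD// eV.
have [e e0 eV] := key _ (line_polynomial_Re Q) Re0.
apply: (not_rigid_lower_bound Phi_spp cA e0) => f g tf _ fA _.
by rewrite -[leLHS]adde0 leeD// eV.
Qed.

Lemma phi_eq0 u : L = 0 -> phi u = 0.
Proof.
move=> L0; apply/eqP; rewrite -normr_le0 -L0.
exact: (phi_normL).
Qed.

Lemma lebesgue_eball_lty (r : R) : 0 < r -> (leb (eball r) < +oo)%E.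
Proof.
move=> r0; apply: le_lt_trans (lebesgue_box_lty r); apply: le_measure.
- by rewrite inE; exact: measurable_eball.
- by rewrite inE; exact: measurable_box.
- by move=> x; exact: eball_sub_box.
Qed.

(** One of the real and imaginary parts of [Q] is a nonconstant function.  When
    [L = 0] the spectral gap is identically 1, so that its inverse is
    integrable. *)
Lemma not_rigid_nonconstant Q k : k <> mpoly.mnm0 -> mpoly.mcoeff k Q != 0 ->
  ~ linearly_rigid P Phi Q A.
Proof.
move=> k0 Qk.
have [L0|L0] := eqVneq L 0.
  apply: (@not_rigid_integrable Q 1) => //.
    by apply: contraNneq Qk => ->; rewrite mpoly.mcoeff0.
  under eq_integral do rewrite phi_eq0// subr0 inver oner_eq0 invr1.
  rewrite integral_cst ?mul1e; last exact: measurable_eball.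
  exact: lebesgue_eball_lty.
have {}L0 : 0 < L by rewrite lt_neqAle eq_sym L0 (jump_mass_ge0).
have [x1 Qx1] := poly_eval_nonconstant k0 Qk.
have V0 f : (0 <= 'V_P[rstat Phi f])%E by exact: variance_ge0.
have key F := @variance_lower_nonconstant F A x1.
have [Re0|Re0] := eqVneq (complex.Re (poly_eval Q x1)) (complex.Re (poly_eval Q 0)).
  have Im0 : complex.Im (poly_eval Q x1) != complex.Im (poly_eval Q 0).
    apply: contraNneq Qx1; move: Re0.
    by case: (poly_eval Q x1) => a b; case: (poly_eval Q 0) => a' b' /= -> ->.
  have [e e0 eV] := key _ (line_polynomial_Im Q) Im0 iA L0.
  apply: (not_rigid_lower_bound Phi_spp cA e0) => f g _ tg _ gA.
  by rewrite -[leLHS]add0e leeD// eV.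
have [e e0 eV] := key _ (line_polynomial_Re Q) Re0 iA L0.
apply: (not_rigid_lower_bound Phi_spp cA e0) => f g tf _ fA _.
by rewrite -[leLHS]adde0 leeD// eV.
Qed.

Lemma measurable_modulus_sqr Q :
  measurable_fun setT (fun u : E => modulus (poly_eval Q u) ^+ 2).
Proof.
under eq_fun do rewrite modulus_sqr.
by apply: measurable_funD; apply: measurable_funX;
  [exact: (line_polynomial_Re Q).1|exact: (line_polynomial_Im Q).1].
Qed.

Lemma poly_eval_monomial k (u : E) : poly_eval (mpoly.mpolyX R[i] k) u =
  (\prod_(i < d) u ord0 i ^+ mpoly.fun_of_multinom k i)%:C.
Proof.
rewrite /poly_eval mpoly.mevalX rmorph_prod; apply: eq_bigr => i _.
by rewrite rmorphXn.
Qed.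

Lemma monomial_le_coord k (i : 'I_d) (u : E) :
  (0 < mpoly.fun_of_multinom k i)%N -> box 1 u ->
  modulus (poly_eval (mpoly.mpolyX R[i] k) u) ^+ 2 <= u ord0 i ^+ 2.
Proof.
move=> ki u1; rewrite poly_eval_monomial modulus_sqr/= expr0n addr0.
have sqN (x : R) : x ^+ 2 = `|x| ^+ 2 by rewrite real_normK// num_real.
rewrite [leLHS]sqN [leRHS]sqN ler_sqr ?nnegrE//.
rewrite (bigD1 i)//= normrM -[leRHS]mulr1; apply: ler_pM => //.
  rewrite normrX -(prednK ki) exprS -[leRHS]mulr1 ler_wpM2l//.
  by apply: exprn_ile1 => //; exact: u1.
rewrite normr_prod; apply: prodr_ile1 => j _; rewrite normr_ge0/= normrX.
by apply: exprn_ile1 => //; exact: u1.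
Qed.

Lemma no_pole k : k <> mpoly.mnm0 -> ~ inv_pole_of_order s k.
Proof.
move=> k0 /(_ (mpoly.mpolyX R[i] k)) pole.
have [i ki] : exists i, (0 < mpoly.fun_of_multinom k i)%N.
  apply: contrapT => /forallNP ki; apply: k0; apply/mpoly.mnmP => i.
  by rewrite mpoly.mnm0E; have := ki i; case: (mpoly.fun_of_multinom k i).
suff : mpoly.mcoeff k (mpoly.mpolyX R[i] k) = 0.
  by rewrite mpoly.mcoeffX eqxx => /eqP; rewrite oner_eq0.
apply: pole.
have mw := measurable_modulus_sqr (mpoly.mpolyX R[i] k).
have wi u := @monomial_le_coord k i u ki.
have [L0|L0] := eqVneq L 0; last first.
  have {}L0 : 0 < L by rewrite lt_neqAle eq_sym L0 (jump_mass_ge0).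
  apply: (gap_weighted_lty L0 mw _ wi) => u.
  exact: sqr_ge0.
exists 1 => //; apply: le_lt_trans (lebesgue_eball_lty ltr01).
have m1 : measurable (eball 1 : set E) by exact: measurable_eball.
rewrite -[leRHS]mul1e -(integral_cst leb m1 1%E).
apply: ge0_le_integral => //.
- move=> u _; rewrite mule_ge0 ?lee_fin ?sqr_ge0//.
  by rewrite inve_ge0 lee_fin phi_eq0// subr0.
- apply: measurable_funTS; apply: emeasurable_funM; first exact/measurable_EFinP.
  apply: measurable_inve_ge0 => [|u]; last by rewrite phi_eq0// subr0.
  by apply: measurable_funB => //; exact: (measurable_phi).
move=> u /eball_sub_box u1; rewrite phi_eq0// subr0 inver oner_eq0 invr1 mule1.
rewrite lee_fin; apply: le_trans (wi _ u1) _.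
by rewrite -(real_normK (num_real _)) exprn_ile1//; exact: u1.
Qed.

(** The value at 0 is the coefficient tested by a pole of order 0. *)
Lemma poly_eval0 Q : poly_eval Q 0 = mpoly.mcoeff mpoly.mnm0 Q.
Proof.
rewrite poly_evalE.
have E0 m : (\prod_(i < d) (0 : E) ord0 i ^+ mpoly.fun_of_multinom m i)%:C =
    (m == mpoly.mnm0)%:R :> R[i].
  case: eqP => [->|m0].
    by rewrite big1// => i _; rewrite mpoly.mnm0E expr0.
  have [i mi] : exists i, (0 < mpoly.fun_of_multinom m i)%N.
    apply: contrapT => /forallNP mi; apply: m0; apply/mpoly.mnmP => i.
    by rewrite mpoly.mnm0E; have := mi i; case: (mpoly.fun_of_multinom m i).
  by rewrite (bigD1 i)//= mxE expr0n gtn_eqF// mul0r.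
under eq_bigr do rewrite E0.
have [m0Q|m0Q] := boolP (mpoly.mnm0 \in mpoly.msupp Q).
  rewrite (bigD1_seq mpoly.mnm0) ?mpoly.msupp_uniq//= eqxx mulr1 big1 ?addr0//.
  by move=> m /negbTE ->; rewrite mulr0.
rewrite (mpoly.memN_msupp_eq0 m0Q) big_seq big1// => m mQ.
by case: eqP => [mE|]; [move: m0Q; rewrite -mE mQ|rewrite mulr0].
Qed.

(** If [|Q|^2 / s] is integrable near 0 and [Q 0 <> 0], then [1/s] is integrable
    near 0, since [Q] stays away from 0 there. *)
Lemma pole0P : inv_pole_of_order s mpoly.mnm0 <->
  forall r : R, 0 < r -> (\int[leb]_(u in eball r) ((s u)%:E)^-1 = +oo)%E.
Proof.
split=> [pole r r0|div Q [e e0 fin_e]].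
  apply/eqP; apply: contraT => fin_r; exfalso.
  suff : mpoly.mcoeff mpoly.mnm0 (mpoly.mpolyX R[i] (@mpoly.mnm0 d)) = 0.
    by rewrite mpoly.mcoeffX eqxx => /eqP; rewrite oner_eq0.
  apply: pole; exists r => //; rewrite ltey; apply: contraNneq fin_r => <-.
  apply/eqP; apply: eq_integral => u _.
  rewrite poly_eval_monomial big1 => [|i _]; last by rewrite mpoly.mnm0E expr0.
  by rewrite modulus_sqr/= expr0n addr0 expr1n mul1e.
have gap0 := gap_ge0; have ms := measurable_gapV.
have half (p q : R) : p - q < p / 2 -> p / 2 <= q by lra.
apply/eqP; apply: contraT => Q0; exfalso.
pose w (u : E) := modulus (poly_eval Q u) ^+ 2.
have cw : continuous w.
  rewrite /w; under eq_fun do rewrite modulus_sqr.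
  have c2 (f : E -> R) : continuous f -> continuous (fun x => f x ^+ 2).
    move=> cf x; apply: (@continuous_comp _ _ _ f (fun t : R => t ^+ 2)).
      exact: cf.
    exact: exprn_continuous.
  move=> x; apply: (@continuousD _ _ _ (fun x => complex.Re (poly_eval Q x) ^+ 2)).
    by apply: c2; exact: continuous_Re_poly.
  by apply: c2; exact: continuous_Im_poly.
have w0 : 0 < w 0.
  rewrite /w lt_neqAle sqr_ge0 andbT eq_sym modulus_sqr.
  rewrite paddr_eq0 ?sqr_ge0// !sqrf_eq0; apply: contraNN Q0 => /andP[/eqP a /eqP b].
  by rewrite -poly_eval0 (complex_eq0 a b).
have w20 : 0 < w 0 / 2 by rewrite divr_gt0.
have [rho rho0 wrho] : exists2 rho : R, 0 < rho &
    forall u, box rho u -> w 0 / 2 <= w u.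
  have /cvgrPdist_lt/(_ _ w20)/nbhs_ballP[r /= r0 H] := cw 0.
  exists (r / 2); first by rewrite divr_gt0.
  move=> u ur; have /H : ball 0 r u.
    split => // i j; rewrite (ord1 i) /ball/= mxE sub0r normrN.
    by apply: le_lt_trans (ur j) _; rewrite ltr_pdivrMr// ltr_pMr// ltr1n.
  by rewrite ltr_norml => /andP[_]; exact: half.
pose r := Num.min e rho; have r0 : 0 < r by rewrite lt_min e0.
have mr : measurable (eball r : set E) by exact: measurable_eball.
have me : measurable (eball e : set E) by exact: measurable_eball.
have mws : measurable_fun setT (fun u => ((w u)%:E * ((s u)%:E)^-1)%E).
  by apply: emeasurable_funM => //; apply/measurable_EFinP; exact: measurable_modulus_sqr.
have ws0 u : (0 <= (w u)%:E * ((s u)%:E)^-1)%E.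
  by rewrite mule_ge0 ?lee_fin ?sqr_ge0// inve_ge0 lee_fin.
suff : (+oo <= \int[leb]_(u in eball e) ((w u)%:E * ((s u)%:E)^-1))%E.
  by rewrite leye_eq => /eqP inf; move: fin_e; rewrite -/w inf ltxx.
apply: (@le_trans _ _ (\int[leb]_(u in eball r) ((w u)%:E * ((s u)%:E)^-1))%E); last first.
  apply: ge0_subset_integral => //; first exact: measurable_funTS.
  by move=> u; rewrite /eball/= => /lt_le_trans; apply; rewrite ge_min lexx.
apply: (@le_trans _ _ (\int[leb]_(u in eball r) ((w 0 / 2)%:E * ((s u)%:E)^-1))%E).
  rewrite ge0_integralZl_EFin//; last 3 first.
  - by move=> u _; rewrite inve_ge0 lee_fin.
  - exact: measurable_funTS.
  - exact: ltW.
  by rewrite div// gt0_muley// lte_fin.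
apply: ge0_le_integral => //.
- by move=> u _; rewrite mule_ge0 ?lee_fin ?(ltW w20)// inve_ge0 lee_fin.
- by apply: measurable_funTS; exact: emeasurable_funM.
- exact: measurable_funTS.
move=> u /eball_sub_box ur; apply: lee_wpmul2r.
  by rewrite inve_ge0 lee_fin; exact: gap0.
by rewrite lee_fin; apply: wrho; apply: box_subset ur; rewrite ge_min lexx orbT.
Qed.

Lemma rigidity_pole k :
  (linearly_k_rigid P Phi k A <-> inv_pole_of_order s k) /\
  (~ inv_pole_of_order s k -> forall Q, k_polynomial k Q ->
     ~ linearly_rigid P Phi Q A).
Proof.
have XkP k' : mpoly.mcoeff k' (mpoly.mpolyX R[i] k') != 0.
  by rewrite mpoly.mcoeffX eqxx oner_eq0.
have [k0|/eqP k0] := eqVneq k mpoly.mnm0; last first.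
  have nr Q : k_polynomial k Q -> ~ linearly_rigid P Phi Q A.
    move=> [k1 [kk1 Qk1 _]]; apply: not_rigid_nonconstant Qk1 => k10; apply: k0.
    apply/mpoly.mnmP => i; apply/eqP; rewrite mpoly.mnm0E -leqn0.
    by have := mpoly.mnm_lepP kk1 i; rewrite k10 mpoly.mnm0E.
  split=> // ; split=> [rig|/(no_pole k0)//].
  exfalso; exact: (not_rigid_nonconstant k0 (XkP k)).
rewrite k0.
have fin_nr : ~ inv_pole_of_order s mpoly.mnm0 -> forall Q (k1 : mpoly.multinom d),
    mpoly.mcoeff k1 Q != 0 -> ~ linearly_rigid P Phi Q A.
  move=> /pole0P /existsNP[r /not_implyP[r0 fin_r]] Q k1 Qk1.
  apply: (not_rigid_integrable _ r0); last by rewrite ltey; exact/eqP.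
  by apply: contraNneq Qk1 => ->; rewrite mpoly.mcoeff0.
split; last first.
  by move=> np Q [k1 [_ Qk1 _]]; exact: fin_nr Qk1.
split=> [rig|/pole0P div].
  apply: contrapT => /fin_nr np; exact: (np _ _ (XkP mpoly.mnm0) rig).
apply: rigid_approx => // [x Ax|e e0].
  by rewrite poly_eval_monomial big1// => i _; rewrite mpoly.mnm0E expr0.
exact: (variance_small div cA e0).
Qed.

End rigidity.

End determinantal_process.

Lemma one_minus_fourierE (R : realType) (d : nat)
    (K : 'rV[R]_d -> 'rV[R]_d -> R[i]) :
  one_minus_fourier_kappa2 K = fun u => 1 - phi (fun z => kappa K z ^+ 2) u.
Proof.
apply/funext => u; rewrite /one_minus_fourier_kappa2 /fourier /=.
congr (_ - _); apply: eq_Rintegral => z _.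
by rewrite /= cosN mulr0 subr0.
Qed.

Theorem corollary2 (R : realType) (d : nat) (d_gt0 : (0 < d)%N)
    (disp : measure_display) (Om : measurableType disp) (P : probability Om R)
    (Phi : Om -> set 'rV[R]_d) (K : 'rV[R]_d -> 'rV[R]_d -> R[i])
    (Phi_spp : simple_point_process Phi)
    (Phi_stationary : stationary P Phi)
    (Phi_dpp : determinantal P Phi K)
    (K_inv : translation_invariant_correlations K)
    (K_hermitian : hermitian_kernel K)
    (K_pos : positive_definite_kernel K)
    (K00 : K 0 0 = 1)
    (kappa_L2 : kappa K \in Lfun (@lebesgue_rV R d) 2%:E)
    (A : set 'rV[R]_d) (A_body : convex_body A) (k : mpoly.multinom d) :
  (linearly_k_rigid P Phi k A <->
     inv_pole_of_order (one_minus_fourier_kappa2 K) k) /\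
  (~ inv_pole_of_order (one_minus_fourier_kappa2 K) k ->
   forall Q : mpoly.mpoly d R[i],
     k_polynomial k Q -> ~ linearly_rigid P Phi Q A).
Proof.
rewrite one_minus_fourierE; set k2 := fun z => kappa K z ^+ 2.
have rho1 : correlation_function P Phi (fun t : 1.-tuple 'rV[R]_d => 1).
  have [_] := Phi_dpp 1%N isT; congr correlation_function; apply/funext => t.
  rewrite -(Re_det_kernel1 K_inv K00 (thead t)); congr (complex.Re (det_kernel K _)).
  by apply/val_inj; case: t => -[|x [|]].
have rho2 : correlation_function P Phi
    (fun t : 2.-tuple 'rV[R]_d => 1 - k2 (tnth t ord_max - tnth t ord0)).
  have [_] := Phi_dpp 2%N isT; congr correlation_function; apply/funext => t.
  rewrite /k2 -(Re_det_kernel2 K_inv K_hermitian K00); congr (complex.Re (det_kernel K _)).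
  by apply/val_inj; case: t => -[|x [|y [|]]].
have mk2 : measurable_fun setT k2.
  by apply: measurable_funX; move: kappa_L2; rewrite inE => /andP[]; rewrite inE.
have k2_ge0 z : 0 <= k2 z by exact: sqr_ge0.
have k2_le1 z : k2 z <= 1.
  have [] := Phi_dpp 2%N isT; move=> /(_ [tuple 0; z]) + _.
  rewrite (det_kernel2 K_inv K_hermitian K00) lecR subr_ge0.
  by rewrite (modulus_kernel K_inv K_hermitian K00) subr0.
have k2_even z : k2 (- z) = k2 z by exact: (kappa2_even K_inv K_hermitian K00).
have L1 := k2_mass_le1 Phi_spp rho1 rho2 mk2 k2_ge0 k2_le1.
pose L := fine (\int[@lebesgue_rV R d]_z (k2 z)%:E)%E.
have L0 : (0 <= \int[@lebesgue_rV R d]_z (k2 z)%:E)%E.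
  by apply: integral_ge0 => z _; rewrite lee_fin.
have LE : (\int[@lebesgue_rV R d]_z (k2 z)%:E = L%:E)%E.
  by rewrite /L fineK// ge0_fin_numE// (le_lt_trans L1)// ltry.
have L_le1 : L <= 1 by rewrite -lee_fin -LE.
exact: (rigidity_pole Phi_spp rho1 rho2 mk2 k2_ge0 k2_le1 k2_even LE L_le1 A_body).
Qed.
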